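(* Let $\Omega\subset\mathbb{R}^N$, $N>1$, be a bounded domain with Lipschitz boundary $\partial\Omega$ and let $1<p<\infty$. If $u\in W^{1,p}(\Omega)\cap L^\infty(\Omega)$, then $u\in L^\infty(\partial\Omega)$.
   Context: The values of $u\in W^{1,p}(\Omega)$ on $\partial\Omega$ are understood in the sense of traces, i.e. the conclusion says that the trace of $u$ belongs to $L^\infty(\partial\Omega)$, where $\partial\Omega$ carries the $(N-1)$-dimensional Hausdorff (surface) measure $\sigma$. *)

(* Defs.v *)
From HB Require Import structures.
From mathcomp Require Import all_boot all_order all_algebra.
From mathcomp Require Import all_classical all_reals all_analysis.

Set Implicit Arguments.
Unset Strict Implicit.
Unset Printing Implicit Defensive.
Import Order.TTheory GRing.Theory Num.Theory.
Import numFieldNormedType.Exports.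

Local Open Scope classical_set_scope.
Local Open Scope ring_scope.

(* Outer measures by coverings. [mu_ext] asks the covering sets to be          *)
(* measurable; on [all_sets T] every set is, so [cover_outer w A] is the       *)
(* infimum of \sum_k w (C k) over all sequences of sets C covering A.          *)

Definition all_sets (T : Type) : Type := T.

HB.instance Definition _ (T : pointedType) := Pointed.on (all_sets T).
HB.instance Definition _ (T : pointedType) :=
  @isMeasurable.Build default_measure_display (all_sets T)
    (@discrete_measurable T) (@discrete_measurable0 T)
    (@discrete_measurableC T) (@discrete_measurableU T).

Definition cover_outer (R : realType) (T : pointedType) (w : set T -> \bar R)
    (A : set T) : \bar R :=
  @mu_ext _ (all_sets T) R w A.

(* Euclidean norm: the library norm of 'rV[R]_n is the maximum norm. *)
Definition enorm (R : realType) (n : nat) (x : 'rV[R]_n) : R :=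
  Num.sqrt (\sum_(i < n) x 0 i ^+ 2).

(* Lebesgue measure on R^n. *)

Definition box (R : realType) (n : nat) (a b : 'rV[R]_n) : set 'rV[R]_n :=
  [set x | forall i, a 0 i <= x 0 i <= b 0 i].

(* Least volume of a box containing A, +oo if A is unbounded. For A nonempty,  *)
(* A `<=` box a b forces a <= b coordinatewise.                                *)
Definition box_volume (R : realType) (n : nat) (A : set 'rV[R]_n) : \bar R :=
  if A == set0 then 0%E
  else ereal_inf [set v | exists a b : 'rV[R]_n,
         A `<=` box a b /\ v = (\prod_(i < n) (b 0 i - a 0 i))%:E].

Definition lebesgue_outer (R : realType) (n : nat) : set 'rV[R]_n -> \bar R :=
  cover_outer (@box_volume R n).

(* d-dimensional Hausdorff measure on R^n, normalised by the volume of the     *)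
(* unit ball of R^d so that it is the surface measure on d-dimensional sets.   *)

Definition diameter (R : realType) (n : nat) (A : set 'rV[R]_n) : \bar R :=
  ereal_sup [set z | exists x y, [/\ A x, A y & z = (enorm (x - y))%:E]].

Definition hausdorff_weight (R : realType) (n d : nat) (delta : R)
    (A : set 'rV[R]_n) : \bar R :=
  if A == set0 then 0%E
  else if (diameter A <= delta%:E)%E then
    (lebesgue_outer [set y : 'rV[R]_d | (enorm y <= 1)%R]
     * (2^-1%:E * diameter A) ^+ d)%E
  else +oo%E.

Definition hausdorff_outer (R : realType) (n d : nat) (A : set 'rV[R]_n) :
    \bar R :=
  ereal_sup [set cover_outer (hausdorff_weight d delta) A
            | delta in [set delta : R | 0 < delta]].

Section outer_measures.
Context (R : realType).
Local Open Scope ereal_scope.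

Lemma cover_outer0 (T : pointedType) (w : set T -> \bar R) :
  w set0 = 0 -> (forall A, 0 <= w A) -> cover_outer w set0 = 0.
Proof. by move=> w0 wge0; exact: (@mu_ext0 _ (all_sets T) R w). Qed.

Lemma cover_outer_ge0 (T : pointedType) (w : set T -> \bar R) :
  (forall A, 0 <= w A) -> forall A, 0 <= cover_outer w A.
Proof. by move=> wge0; exact: (@mu_ext_ge0 _ (all_sets T) R w). Qed.

Lemma le_cover_outer (T : pointedType) (w : set T -> \bar R) :
  {homo cover_outer w : A B / A `<=` B >-> A <= B}.
Proof. exact: (@le_mu_ext _ (all_sets T) R w). Qed.

Lemma cover_outer_sigma_subadditive (T : pointedType) (w : set T -> \bar R) :
  (forall A, 0 <= w A) -> sigma_subadditive (cover_outer w).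
Proof.
by move=> wge0; exact: (@mu_ext_sigma_subadditive _ (all_sets T) R w).
Qed.

Lemma box_volume0 n : box_volume (set0 : set 'rV[R]_n) = 0.
Proof. by rewrite /box_volume eqxx. Qed.

Lemma box_volume_ge0 n (A : set 'rV[R]_n) : 0 <= box_volume A.
Proof.
rewrite /box_volume; case: ifPn => // /set0P[x Ax].
apply: le_ereal_inf_tmp => _ [a [b [Aab ->]]].
rewrite lee_fin; apply: prodr_ge0 => i _.
by have /andP[ax xb] := Aab x Ax i; rewrite subr_ge0 (le_trans ax).
Qed.

HB.instance Definition _ n := isOuterMeasure.Build R 'rV[R]_n
  (@lebesgue_outer R n)
  (cover_outer0 (box_volume0 n) (@box_volume_ge0 n))
  (cover_outer_ge0 (@box_volume_ge0 n))
  (@le_cover_outer _ (@box_volume R n))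
  (cover_outer_sigma_subadditive (@box_volume_ge0 n)).

Lemma diameter_ge0 n (A : set 'rV[R]_n) : A !=set0 -> 0 <= diameter A.
Proof.
move=> [x Ax]; apply: ereal_sup_ubound; exists x, x; split=> //.
rewrite subrr /enorm big1 ?sqrtr0// => i _; by rewrite mxE expr0n.
Qed.

Lemma hausdorff_weight0 n d delta :
  hausdorff_weight d delta (set0 : set 'rV[R]_n) = 0.
Proof. by rewrite /hausdorff_weight eqxx. Qed.

Lemma hausdorff_weight_ge0 n d delta (A : set 'rV[R]_n) :
  0 <= hausdorff_weight d delta A.
Proof.
rewrite /hausdorff_weight; case: ifPn => // /set0P A0; case: ifPn => // _.
apply: mule_ge0; first exact: outer_measure_ge0.
by apply: expe_ge0; apply: mule_ge0; [rewrite lee_fin invr_ge0|exact: diameter_ge0].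
Qed.

Let hw_ge0 n d delta := @hausdorff_weight_ge0 n d delta.

Lemma hausdorff_outer_ge0 n d (A : set 'rV[R]_n) : 0 <= hausdorff_outer d A.
Proof.
apply: (@le_trans _ _ (cover_outer (hausdorff_weight d 1%R) A)).
  exact: (cover_outer_ge0 (@hw_ge0 n d 1%R)).
by apply: ereal_sup_ubound; exists 1%R => /=.
Qed.

Lemma hausdorff_outer0 n d : hausdorff_outer d (set0 : set 'rV[R]_n) = 0.
Proof.
apply/eqP; rewrite eq_le hausdorff_outer_ge0 andbT.
apply: ge_ereal_sup => _ [delta _ <-].
by rewrite cover_outer0//; exact: hausdorff_weight0.
Qed.

Lemma le_hausdorff_outer n d :
  {homo @hausdorff_outer R n d : A B / A `<=` B >-> A <= B}.
Proof.
move=> A B AB; apply: ge_ereal_sup => _ [delta delta0 <-].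
apply: (le_trans (le_cover_outer _ AB)).
by apply: ereal_sup_ubound; exists delta.
Qed.

Lemma hausdorff_outer_sigma_subadditive n d :
  sigma_subadditive (@hausdorff_outer R n d).
Proof.
move=> F; apply: ge_ereal_sup => _ [delta delta0 <-].
apply: (le_trans (cover_outer_sigma_subadditive (@hw_ge0 n d delta) F)).
apply: lee_nneseries => k _; last by apply: ereal_sup_ubound; exists delta.
by move=> _; exact: (cover_outer_ge0 (@hw_ge0 n d delta)).
Qed.

HB.instance Definition _ n d := isOuterMeasure.Build R 'rV[R]_n
  (@hausdorff_outer R n d)
  (@hausdorff_outer0 n d) (@hausdorff_outer_ge0 n d)
  (@le_hausdorff_outer n d) (@hausdorff_outer_sigma_subadditive n d).

End outer_measures.

(* The measures live on the sigma-algebras of Caratheodory-measurable sets;    *)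
(* both spaces below are copies of 'rV[R]_n.                                   *)

Definition caratheodory_measure (R : realType) (T : pointedType)
    (mu : {outer_measure set T -> \bar R}) :
    {measure set (caratheodory_type mu) -> \bar R} :=
  [the measure _ _ of (mu : set (caratheodory_type mu) -> _)].

Definition lebesgue_space (R : realType) (n : nat) : Type := 'rV[R]_n.

HB.instance Definition _ (R : realType) (n : nat) :=
  Measurable.copy (lebesgue_space R n)
    (caratheodory_type
      [the {outer_measure set 'rV[R]_n -> \bar R} of @lebesgue_outer R n]).

Definition lebesgue_rV (R : realType) (n : nat) :
    {measure set (lebesgue_space R n) -> \bar R} :=
  caratheodory_measure
    [the {outer_measure set 'rV[R]_n -> \bar R} of @lebesgue_outer R n].

Definition hausdorff_space (R : realType) (n d : nat) : Type := 'rV[R]_n.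

HB.instance Definition _ (R : realType) (n d : nat) :=
  Measurable.copy (hausdorff_space R n d)
    (caratheodory_type
      [the {outer_measure set 'rV[R]_n -> \bar R} of @hausdorff_outer R n d]).

Definition hausdorff (R : realType) (n d : nat) :
    {measure set (hausdorff_space R n d) -> \bar R} :=
  caratheodory_measure
    [the {outer_measure set 'rV[R]_n -> \bar R} of @hausdorff_outer R n d].

(* L^p of a subset D; functions are extended by 0 outside D. *)

Definition Lnorm_on d (T : measurableType d) (R : realType)
    (mu : {measure set T -> \bar R}) (D : set T) (p : \bar R) (f : T -> R) :
    \bar R :=
  Lnorm mu p (EFin \o (f \_ D)).

Definition Lp_on d (T : measurableType d) (R : realType)
    (mu : {measure set T -> \bar R}) (D : set T) (p : \bar R) (f : T -> R) :
    Prop :=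
  f \_ D \in Lfun mu p.

(* Bounded Lipschitz domains. *)

Definition boundary (T : topologicalType) (A : set T) : set T :=
  closure A `\` interior A.

Definition bounded_domain (R : realType) (n : nat) (Omega : set 'rV[R]_n) :=
  [/\ open Omega, connected Omega, Omega !=set0 & bounded_set Omega].

(* Near each boundary point Omega is, in suitable orthonormal coordinates      *)
(* z = y Q, the part lying strictly above the graph of a Lipschitz function of *)
(* the coordinates other than z_i.                                             *)
Definition lipschitz_boundary (R : realType) (n : nat)
    (Omega : set 'rV[R]_n) :=
  forall x0 : 'rV[R]_n, boundary Omega x0 ->
    exists (Q : 'M[R]_n) (i : 'I_n) (r : R) (gamma : 'rV[R]_n.-1 -> R),
      [/\ Q *m Q^T = 1%:M, 0 < r, lipschitz gamma &
        forall y : 'rV[R]_n, enorm (y - x0) < r ->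
          Omega y <-> gamma (col' i (y *m Q)) < (y *m Q) 0 i].

(* Sobolev spaces. *)

Definition partial (R : realType) (n : nat) (i : 'I_n) (f : 'rV[R]_n -> R) :
    'rV[R]_n -> R :=
  fun x => derive f x (delta_mx 0 i).

Fixpoint continuously_differentiable (R : realType) (n k : nat)
    (f : 'rV[R]_n -> R) : Prop :=
  if k is k'.+1 then
    [/\ continuous f,
        forall (i : 'I_n) x, derivable f x (delta_mx 0 i) &
        forall i : 'I_n, continuously_differentiable k' (partial i f)]
  else continuous f.

Definition smooth (R : realType) (n : nat) (f : 'rV[R]_n -> R) :=
  forall k, continuously_differentiable k f.

Definition test_function (R : realType) (n : nat) (Omega : set 'rV[R]_n)
    (phi : 'rV[R]_n -> R) :=
  let supp := closure [set x | phi x != 0] in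
  [/\ smooth phi, compact supp & supp `<=` Omega].

Definition weak_partial (R : realType) (n : nat) (Omega : set 'rV[R]_n)
    (i : 'I_n) (u g : 'rV[R]_n -> R) :=
  forall phi, test_function Omega phi ->
    \int[@lebesgue_rV R n]_(x in Omega) (u x * partial i phi x) =
    - \int[@lebesgue_rV R n]_(x in Omega) (g x * phi x).

Definition weak_gradient (R : realType) (n : nat) (p : R)
    (Omega : set 'rV[R]_n) (u : 'rV[R]_n -> R) (g : 'I_n -> 'rV[R]_n -> R) :=
  forall i, Lp_on (@lebesgue_rV R n) Omega p%:E (g i) /\
    weak_partial Omega i u (g i).

Definition sobolev (R : realType) (n : nat) (p : R) (Omega : set 'rV[R]_n)
    (u : 'rV[R]_n -> R) :=
  Lp_on (@lebesgue_rV R n) Omega p%:E u /\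
  exists g, weak_gradient p Omega u g.

(* Norm of u in W^{1,p}(Omega), g being the weak gradient of u. *)
Definition sobolev_norm (R : realType) (n : nat) (p : R)
    (Omega : set 'rV[R]_n) (u : 'rV[R]_n -> R) (g : 'I_n -> 'rV[R]_n -> R) :
    \bar R :=
  (Lnorm_on (@lebesgue_rV R n) Omega p%:E u +
   \sum_(i < n) Lnorm_on (@lebesgue_rV R n) Omega p%:E (g i))%E.

(* The trace operator: the bounded linear map from W^{1,p}(Omega) to           *)
(* L^p(boundary Omega) which restricts to the boundary every function of       *)
(* W^{1,p}(Omega) that is continuous up to the boundary. It acts here on       *)
(* representatives; linearity and boundedness make the class of T u depend     *)
(* only on the class of u.                                                     *)
Record trace_operator (R : realType) (n : nat) (p : R)
    (Omega : set 'rV[R]_n) (T : ('rV[R]_n -> R) -> ('rV[R]_n -> R)) : Prop := {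
  trace_Lp : forall u, sobolev p Omega u ->
    Lp_on (@hausdorff R n n.-1) (boundary Omega) p%:E (T u) ;
  trace_linear : forall (a : R) u v,
    sobolev p Omega u -> sobolev p Omega v ->
    {ae @hausdorff R n n.-1, forall x, boundary Omega x ->
      T (fun y => a * u y + v y) x = a * T u x + T v x} ;
  trace_bounded : exists C : R,
    forall (u : 'rV[R]_n -> R) (g : 'I_n -> 'rV[R]_n -> R),
    Lp_on (@lebesgue_rV R n) Omega p%:E u -> weak_gradient p Omega u g ->
    (Lnorm_on (@hausdorff R n n.-1) (boundary Omega) p%:E (T u) <=
     C%:E * sobolev_norm p Omega u g)%E ;
  trace_continuous : forall u, sobolev p Omega u ->
    {within closure Omega, continuous u} ->
    {ae @hausdorff R n n.-1, forall x, boundary Omega x -> T u x = u x} }.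

(* Main.v *)
(* Let V be eta u extended by 0, with eta a smooth cutoff supported near a     *)
(* point x0 of the closure of Omega. Since the boundary is Lipschitz, some      *)
(* cone of directions t e + B(0, kappa t) points into Omega from every point    *)
(* of Omega near x0. Averaging V against a kernel supported in that cone gives  *)
(* functions v which are continuous on the whole space, bounded by the          *)
(* essential bound M of u, and which tend to eta u in W^{1,p}(Omega) as t goes  *)
(* to 0: only values of V inside Omega are seen, so that differentiation        *)
(* commutes with averaging. The trace of v is its restriction, hence is bounded *)
(* by M, and T v tends to T (eta u) in L^p of the boundary; by Markov T (eta u) *)
(* is essentially bounded. Finitely many cutoffs cover the closure of Omega.    *)

From HB Require Import structures.
Require Import Defs.
From mathcomp Require Import all_boot all_order all_algebra finmap.
From mathcomp Require Import all_classical all_reals all_analysis.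
From mathcomp Require Import measurable_realfun ess_sup_inf.
From mathcomp Require Import ring lra.

Set Implicit Arguments.
Unset Strict Implicit.
Unset Printing Implicit Defensive.
Import Order.TTheory GRing.Theory Num.Theory.
Import numFieldNormedType.Exports.

Local Open Scope classical_set_scope.
Local Open Scope ring_scope.

(** * Lebesgue measure and integration on R^n *)

(** An essential bound on [u] inside [Omega] does not speak about boundary values directly. It
    reaches them through approximants that are continuous on the whole space, bounded everywhere by
    a fixed constant [M], and convergent in W^{1,p}. On such functions the trace is the restriction,
    hence bounded by [M]. Since [T] is bounded, the traces converge in L^p of the boundary, and the
    bound survives in the limit with [M + 1] in place of [M] ([trace_bounded_limit], by the Markov
    argument of [ae_bounded_approx]). The approximants come from [local_approx]. Near a point of the
    closure a cone of directions leads into [Omega] ([interior_cone]), because moving up by [t]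
    beats the change of a Lipschitz graph under a small sideways move. Let V be eta u extended by 0,
    with eta a cutoff near that point, and average V over translates x + s with s in the cone.
    Averages never exceed the essential bound ([mollify_le]), are Lipschitz because the kernel is
    ([mollify_lip]), and converge in L^p of [Omega] ([mollify_cvg]), by the contraction property
    [lebnorm_mollify] and the density of Lipschitz functions ([lip_dense]). The delicate point is
    the gradient, since V may jump across the boundary. By [mollify_dual], testing the average
    against phi amounts to averaging the tests of V against phi(. - s). The cone forces eta phi(. -
    s) to be supported in [Omega], so the weak derivative of [u] applies to it
    ([weak_product_shift]), and the average of the extended gradient is the gradient of the average
    ([mollify_weak_partial]). Finitely many cutoffs suffice by compactness ([local_cutoffs_cover]),
    and [trace_bounded_cover] adds up the local bounds. A null [Omega] is treated apart in
    [trace_bounded_null]. *)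

Section lebesgue_measure_rV.
Context (R : realType) (n : nat).
Implicit Types (x y a b : 'rV[R]_n) (A B : set 'rV[R]_n).
Local Notation leb := (@lebesgue_rV R n).

Lemma rV_norm_le x (e : R) : 0 <= e ->
  (`|x| <= e) = [forall i, `|x 0 i| <= e].
Proof.
move=> e0; rewrite {1}/Num.Def.normr/= mx_normrE; apply/bigmax_leP/forallP => [[_ h] i|h].
  exact: (h (0, i)).
by split => // -[j i] _; rewrite ord1.
Qed.

Lemma rV_norm_lt x (e : R) : 0 < e ->
  (`|x| < e) = [forall i, `|x 0 i| < e].
Proof.
move=> e0; rewrite {1}/Num.Def.normr/= mx_normrE; apply/bigmax_ltP/forallP => [[_ h] i|h].
  exact: (h (0, i)).
by split => // -[j i] _; rewrite ord1.
Qed.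

Lemma rV_coord_le x i : `|x 0 i| <= `|x|.
Proof. by have := rV_norm_le x (normr_ge0 x); rewrite lexx => /esym/forallP. Qed.

Lemma le_box_volume A B : A `<=` B -> (box_volume A <= box_volume B)%E.
Proof.
move=> AB; rewrite {1}/box_volume; case: ifPn => [_|A0]; first exact: box_volume_ge0.
have B0 : B != set0.
  by apply: contra_neq A0 => B0; move: AB; rewrite B0 subset0.
rewrite /box_volume (negPf B0); apply: ereal_inf_le_tmp => _ [a [b [Bab ->]]].
by exists a, b; split => //; exact: subset_trans Bab.
Qed.

Lemma box_volume_le A a b : A !=set0 -> A `<=` box a b ->
  (box_volume A <= (\prod_(i < n) (b 0 i - a 0 i))%:E)%E.
Proof.
move=> /set0P A0 Aab; rewrite /box_volume (negPf A0).
by apply: ereal_inf_lbound; exists a, b.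
Qed.

(** Cutting a bounding box at height [c] gives boxes for both pieces, and their [i]-th sides add up
    to the old one: (c - a_i) + (b_i - c) = b_i - a_i. Empty pieces are set apart, since [c] may
    then fall outside the box. *)
Lemma box_volume_split A i (c : R) :
  (box_volume (A `&` [set x | (x 0 i < c)%R]) +
   box_volume (A `&` ~` [set x | (x 0 i < c)%R]) <= box_volume A)%E.
Proof.
set H := [set x | _].
have [->|/set0P[x [Ax xc]]] := eqVneq (A `&` H) set0.
  by rewrite box_volume0 add0e le_box_volume//; exact: subIsetl.
have [->|/set0P[y [Ay /negP yc]]] := eqVneq (A `&` ~` H) set0.
  by rewrite box_volume0 adde0 le_box_volume//; exact: subIsetl.
rewrite {3}/box_volume ifF; last by apply/eqP/eqP/set0P; exists x.
apply: le_ereal_inf_tmp => _ [a [b [Aab ->]]].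
pose b' := \row_j (if j == i then c else b 0 j).
pose a' := \row_j (if j == i then c else a 0 j).
have h1 : A `&` H `<=` box a b'.
  move=> z [Az zc] j; rewrite mxE; have /andP[-> ?] := Aab _ Az j.
  by case: eqP => [->|]//=; rewrite ltW.
have h2 : A `&` ~` H `<=` box a' b.
  move=> z [Az /negP zc] j; rewrite mxE; have /andP[? ->] := Aab _ Az j.
  by case: eqP => [->|]//=; [rewrite leNgt zc|rewrite andbT].
apply: (le_trans (leeD (box_volume_le _ h1) (box_volume_le _ h2))).
- by exists x.
- by exists y; split => //; apply/negP.
rewrite -EFinD lee_fin (bigD1 i)//= [X in _ + X](bigD1 i)//= [leRHS](bigD1 i)//=.
rewrite !mxE eqxx.
rewrite (eq_bigr (fun j => b 0 j - a 0 j)); last by move=> j /negPf ji; rewrite !mxE ji.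
rewrite [X in _ + _ * X](eq_bigr (fun j => b 0 j - a 0 j)); last by move=> j /negPf ji; rewrite !mxE ji.
by rewrite -mulrDl [X in X * _](_ : _ = b 0 i - a 0 i)//; ring.
Qed.

(** Half-spaces satisfy the Caratheodory criterion: each set of a covering is cut by the hyperplane,
    and by [box_volume_split] the cut costs no volume. *)
Lemma measurable_coord (i : 'I_n) :
  measurable_fun [set: lebesgue_space R n] (fun x : lebesgue_space R n => (x : 'rV[R]_n) 0 i).
Proof.
apply: (measurability _ (RGenInftyO.measurableE R)) => //= _ [_ [c ->] <-].
rewrite setTI; apply: le_caratheodory_measurable => X.
rewrite (_ : _ @^-1` _ = [set x : 'rV[R]_n | (x 0 i < c)%R]); last first.
  by apply/seteqP; split => z /=; rewrite in_itv.
apply: le_ereal_inf_tmp => _ [F [_ XF] <-].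
set H := [set x : 'rV[R]_n | _].
apply: (@le_trans _ _ (\sum_(k <oo) (box_volume (F k `&` H) + box_volume (F k `&` ~` H)))%E).
  rewrite nneseriesD//; try by move=> *; exact: box_volume_ge0.
  apply: leeD; apply: ereal_inf_lbound.
    exists (fun k => F k `&` H) => //; split => //.
    by rewrite -setI_bigcupl; exact: setSI.
  exists (fun k => F k `&` ~` H) => //; split => //.
  by rewrite -setI_bigcupl; exact: setSI.
apply: lee_nneseries => *; first by rewrite adde_ge0// box_volume_ge0.
exact: box_volume_split.
Qed.

(** An open set is a countable union of cubes with rational centres, and each cube is a finite
    intersection of coordinate slabs. The map [m] is general so that maps of two points such as
    [x - y] are covered too. *)
Lemma measurable_open_preimage d (T : measurableType d) (m : T -> 'rV[R]_n)
    (U : set 'rV[R]_n) :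
  (forall i, measurable_fun setT (fun t => m t 0 i)) -> open U ->
  measurable (m @^-1` U).
Proof.
move=> mm oU.
pose B (q : 'rV[rat]_n * nat) := [set x : 'rV[R]_n |
  forall i, `|x 0 i - ratr (q.1 0 i)| < q.2.+1%:R^-1].
have -> : U = \bigcup_(q in [set q | B q `<=` U]) B q.
  apply/seteqP; split => [x Ux|x [q Bq qx]]; last exact: Bq.
  have /nbhs_ballP[e /= e0 xe] := open_nbhs_nbhs (conj oU Ux).
  have e20 : 0 < e / 2 by rewrite divr_gt0.
  (* With half-side 1/(k+1) at most e / 2, a cube containing [x] lies in the ball of radius [e]
     about [x]. *)
  have [k] := ltr_add_invr e20; rewrite add0r => /ltW ke.
  have /choice[q qP] : forall i, exists q : rat, `|x 0 i - ratr q| < k.+1%:R^-1.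
    move=> i; have : x 0 i - k.+1%:R^-1 < x 0 i + k.+1%:R^-1 by rewrite ltrD2l gtrN.
    move=> /rat_in_itvoo[q /itvP qP]; exists q.
    by rewrite ltr_distlC !qP.
  exists (\row_i q i, k) => /=; last by move=> i; rewrite mxE.
  move=> y yq; apply: xe; rewrite -ball_normE/= rV_norm_lt//; apply/forallP => i.
  rewrite !mxE (splitr e).
  have := yq i; have := qP i; rewrite /= mxE.
  set z := ratr _ => h1 h2; rewrite -(subrKA z) (le_lt_trans (ler_normD _ _))//.
  by apply: ltrD; [apply: lt_le_trans ke|apply: lt_le_trans ke; rewrite distrC].
rewrite preimage_bigcup bigcup_mkcond; apply: countable_bigcupT_measurable => // q; case: ifPn => // _.
rewrite (_ : m @^-1` _ = \bigcap_(i in [set: 'I_n])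
  (setT `&` (fun t => m t 0 i) @^-1`
    `](ratr (q.1 0 i) - q.2.+1%:R^-1), (ratr (q.1 0 i) + q.2.+1%:R^-1)[%classic)); last first.
  apply/seteqP; split => t /=.
    by move=> h i _; split => //=; rewrite in_itv/= -ltr_distl.
  by move=> h i; have [_] := h i I; rewrite /= in_itv/= -ltr_distl.
apply: fin_bigcap_measurable => // i _.
by apply: mm => //; exact: measurable_itv.
Qed.

Lemma open_lebesgue_measurable (U : set 'rV[R]_n) : open U ->
  measurable (U : set (lebesgue_space R n)).
Proof.
by move=> oU; apply: (@measurable_open_preimage _ (lebesgue_space R n) (fun x => x) U _ oU) => i; exact: measurable_coord.
Qed.

Lemma measurable_continuous_comp d (T : measurableType d) (m : T -> 'rV[R]_n)
    (f : 'rV[R]_n -> R) :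
  (forall i, measurable_fun setT (fun t => m t 0 i)) -> continuous f ->
  measurable_fun setT (f \o m).
Proof.
move=> mm cf; apply: (measurability _ (RGenOpens.measurableE R)) => //= _ [_ [a [b ->]] <-].
rewrite setTI comp_preimage; apply: measurable_open_preimage => //.
by apply: open_comp => [x _|]; [exact: cf|exact: itv_open].
Qed.

Lemma measurable_continuous (f : 'rV[R]_n -> R) : continuous f ->
  measurable_fun [set: lebesgue_space R n] f.
Proof.
move=> cf; apply: (@measurable_continuous_comp _ (lebesgue_space R n) (fun x => x) f _ cf) => i.
exact: measurable_coord.
Qed.

End lebesgue_measure_rV.

(** * Measure-preserving maps and reflections *)

Section measure_preserving.
Context d (T : measurableType d) (R : realType).
Variables (mu : {measure set T -> \bar R}) (phi : T -> T).
Hypothesis mphi : measurable_fun [set: T] phi.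
Hypothesis muphi : forall A, measurable A -> mu (phi @^-1` A) = mu A.
Local Open Scope ereal_scope.

Lemma ge0_integral_preserving (f : T -> \bar R) :
  measurable_fun [set: T] f -> (forall x, 0 <= f x) ->
  \int[mu]_x f (phi x) = \int[mu]_x f x.
Proof.
move=> mf f0; transitivity (\int[pushforward mu phi]_x f x).
  by rewrite (ge0_integral_pushforward mphi).
by apply: eq_measure_integral => A mA _; exact: muphi.
Qed.

Lemma integrable_preserving (f : T -> \bar R) :
  mu.-integrable [set: T] f -> mu.-integrable [set: T] (f \o phi).
Proof.
move=> /integrableP[mf fi]; apply/integrableP; split.
  exact: measurableT_comp mf mphi.
rewrite (ge0_integral_preserving (f := fun x => `|f x|))//.
exact: measurableT_comp.
Qed.

Lemma integral_preserving (f : T -> \bar R) :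
  mu.-integrable [set: T] f -> \int[mu]_x f (phi x) = \int[mu]_x f x.
Proof.
move=> fi; have mf := measurable_int _ fi.
transitivity (\int[pushforward mu phi]_x f x).
  by rewrite (integral_pushforward mphi)// preimage_setT; exact: integrable_preserving.
by apply: eq_measure_integral => A mA _; exact: muphi.
Qed.

End measure_preserving.

Section lebesgue_invariance.
Context (R : realType) (n : nat).
Implicit Types (x y a b : 'rV[R]_n) (A B : set 'rV[R]_n).
Local Notation leb := (@lebesgue_rV R n).

Lemma lebesgue_outer_le_box_volume A : (lebesgue_outer A <= box_volume A)%E.
Proof.
apply: ereal_inf_lbound; exists (fun k => if k == 0%N then A else set0).
  by split => // x Ax; exists 0%N.
rewrite (nneseries_split 0%N 1%N); last by move=> *; exact: box_volume_ge0.
by rewrite add0n big_nat1 eseries0 ?adde0// => -[|k]//= _ _; exact: box_volume0.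
Qed.

Lemma lebesgue_bounded_lty A : bounded_set A -> (lebesgue_outer A < +oo)%E.
Proof.
move=> [M [_ MA]].
have [->|/set0P A0] := eqVneq A set0; first by rewrite outer_measure0 ltry.
apply: (le_lt_trans (lebesgue_outer_le_box_volume A)).
have h : A `<=` box (const_mx (- (M + 1))) (const_mx (M + 1)).
  move=> x Ax i; rewrite !mxE -ler_norml.
  apply: (le_trans (rV_coord_le _ _)); apply: MA Ax; by rewrite ltrDl.
exact: (le_lt_trans (box_volume_le A0 h)) (ltry _).
Qed.

(** Reflections [x |-> a - x] are the basic change of variables here: being involutions, they turn
    one inequality into an equality, and two of them compose to a translation. *)
Lemma box_volume_reflect A a : (box_volume [set x | A (a - x)%R] <= box_volume A)%E.
Proof.
have [->|/set0P[x Ax]] := eqVneq A set0.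
  by rewrite (_ : [set x | _] = set0)//; apply/seteqP; split.
rewrite [leRHS]/box_volume ifF; last by apply/eqP/eqP/set0P; exists x.
apply: le_ereal_inf_tmp => _ [b [c [Abc ->]]].
have h : [set x | A (a - x)] `<=` box (a - c) (a - b).
  move=> z /= /Abc bc i; have := bc i; rewrite !mxE.
  by move=> /andP[? ?]; apply/andP; split; lra.
rewrite [leRHS](_ : _ = (\prod_(i < n) ((a - b) 0 i - (a - c) 0 i))%:E).
  by apply: box_volume_le h; exists (a - x); rewrite /= subKr.
by congr EFin; apply: eq_bigr => i _; rewrite !mxE; ring.
Qed.

Lemma lebesgue_outer_reflect_le A a :
  (lebesgue_outer [set x | A (a - x)%R] <= lebesgue_outer A)%E.
Proof.
apply: le_ereal_inf_tmp => _ [F [_ AF] <-].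
apply: (@le_trans _ _ (\sum_(k <oo) box_volume [set x | F k (a - x)%R])%E).
  apply: ereal_inf_lbound; exists (fun k => [set x | F k (a - x)]) => //; split => //.
  by move=> x /= /AF[k _ Fk]; exists k.
by apply: lee_nneseries => *; [exact: box_volume_ge0|exact: box_volume_reflect].
Qed.

Lemma lebesgue_outer_reflect A a :
  lebesgue_outer [set x | A (a - x)] = lebesgue_outer A.
Proof.
apply/eqP; rewrite eq_le lebesgue_outer_reflect_le/=.
rewrite [leLHS](_ : _ = lebesgue_outer [set x | [set x | A (a - x)] (a - x)]).
  exact: lebesgue_outer_reflect_le.
by congr lebesgue_outer; apply/seteqP; split => x /=; rewrite subKr.
Qed.

(** The Caratheodory condition for a reflected set tested on [X] is the one for the set itself
    tested on the reflection of [X]. *)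
Lemma measurable_reflect a :
  measurable_fun [set: lebesgue_space R n]
    (fun x : lebesgue_space R n => (a - x : 'rV[R]_n)%R : lebesgue_space R n).
Proof.
move=> _ /= A mA; rewrite setTI; apply: le_caratheodory_measurable => X.
have h := mA [set x | X (a - x)].
rewrite -[leRHS](lebesgue_outer_reflect X a) h; apply: leeD.
  rewrite -[leRHS](lebesgue_outer_reflect _ a); apply: le_outer_measure.
  by move=> x /=; rewrite subKr.
rewrite -[leRHS](lebesgue_outer_reflect _ a); apply: le_outer_measure.
by move=> x /=; rewrite subKr.
Qed.

Lemma measurable_reflect_comp d (T : measurableType d) a
    (f : lebesgue_space R n -> T) :
  measurable_fun setT f ->
  measurable_fun setT (fun x : lebesgue_space R n => f (a - x : 'rV[R]_n)).
Proof. by move=> mf; apply: (measurableT_comp mf (measurable_reflect a)). Qed.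

Lemma lebesgue_rV_reflect a (A : set (lebesgue_space R n)) : measurable A ->
  leb ((fun x : lebesgue_space R n => (a - x : 'rV[R]_n)%R : lebesgue_space R n) @^-1` A) = leb A.
Proof. by move=> _; exact: (lebesgue_outer_reflect A a). Qed.

Lemma integral_reflect a (f : 'rV[R]_n -> \bar R) :
  leb.-integrable [set: lebesgue_space R n] f ->
  (\int[leb]_x f (a - (x : 'rV[R]_n))%R = \int[leb]_x f x)%E.
Proof.
exact: (integral_preserving (measurable_reflect a) (@lebesgue_rV_reflect a)).
Qed.

Lemma integrable_reflect a (f : 'rV[R]_n -> \bar R) :
  leb.-integrable [set: lebesgue_space R n] f ->
  leb.-integrable [set: lebesgue_space R n] (fun x => f (a - (x : 'rV[R]_n))%R).
Proof.
exact: (integrable_preserving (measurable_reflect a) (@lebesgue_rV_reflect a)).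
Qed.

End lebesgue_invariance.

Section lebesgue_sigma_finite.
Context (R : realType) (n : nat).

Lemma bounded_norm_lt (M : R) : bounded_set [set x : 'rV[R]_n | `|x| < M].
Proof.
exists M; split; first exact: num_real.
by move=> k Mk x /= xM; rewrite (le_trans (ltW xM))// ltW.
Qed.

Lemma open_norm_lt (M : R) : open [set x : 'rV[R]_n | `|x| < M].
Proof.
rewrite (_ : [set x | _] = Num.Def.normr @^-1` [set t : R | t < M])//.
by apply: open_comp; [move=> x _; exact: norm_continuous|exact: open_lt].
Qed.

Lemma sigma_finite_lebesgue_rV : sigma_finite setT (@lebesgue_rV R n).
Proof.
exists (fun k => [set x : 'rV[R]_n | `|x| < k%:R]).
  apply/seteqP; split => // x _.
  exists (Num.truncn `|x|).+1 => //=; exact: truncnS_gt.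
move=> k; split; first exact/open_lebesgue_measurable/open_norm_lt.
exact/lebesgue_bounded_lty/bounded_norm_lt.
Qed.

End lebesgue_sigma_finite.

(** * Sigma-finiteness and Fubini *)

Section sigma_finite_copy.
Context d (T : measurableType d) (R : realType).
Variables (mu : {measure set T -> \bar R}) (sf : sigma_finite setT mu).

(* Carries as a structure the sigma-finiteness which [mu] only has as a         *)
(* hypothesis, so that the library Fubini theorems apply.                       *)
Definition sigma_finite_copy : set T -> \bar R := let _ := sf in mu.

HB.instance Definition _ := isMeasure.Build d T R sigma_finite_copy
  (measure0 mu) (measure_ge0 mu) (@measure_semi_sigma_additive _ _ _ mu).

HB.instance Definition _ := Measure_isSigmaFinite.Build d T R sigma_finite_copy sf.

End sigma_finite_copy.

Section sigma_finite_fubini.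
Local Open Scope ereal_scope.
Context d1 d2 (T1 : measurableType d1) (T2 : measurableType d2) (R : realType).
Variables (m1 : {measure set T1 -> \bar R}) (m2 : {measure set T2 -> \bar R}).
Hypotheses (sf1 : sigma_finite setT m1) (sf2 : sigma_finite setT m2).

Let m1' : {sigma_finite_measure set T1 -> \bar R} := sigma_finite_copy sf1.
Let m2' : {sigma_finite_measure set T2 -> \bar R} := sigma_finite_copy sf2.

Lemma sigma_finite_tonelli (f : T1 * T2 -> \bar R) :
  measurable_fun setT f -> (forall xy, 0 <= f xy) ->
  \int[m1]_x \int[m2]_y f (x, y) = \int[m2]_y \int[m1]_x f (x, y).
Proof. by move=> mf f0; exact: (sfinite_Fubini m1' m2'). Qed.

Lemma sigma_finite_fubini (f : T1 * T2 -> \bar R) :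
  measurable_fun setT f ->
  \int[m1]_x \int[m2]_y `|f (x, y)| < +oo ->
  \int[m1]_x \int[m2]_y f (x, y) = \int[m2]_y \int[m1]_x f (x, y).
Proof.
by move=> mf fi; apply: (Fubini (m1 := m1') (m2 := m2')); apply/integrable12ltyP.
Qed.

Lemma measurable_tonelli (f : T1 * T2 -> \bar R) :
  measurable_fun setT f -> (forall xy, 0 <= f xy) ->
  measurable_fun setT (fun x => \int[m2]_y f (x, y)).
Proof. by move=> mf f0; exact: (measurable_fun_fubini_tonelli_F (m2 := m2')). Qed.

Lemma integrable_fubini (f : T1 * T2 -> \bar R) :
  measurable_fun setT f ->
  \int[m1]_x \int[m2]_y `|f (x, y)| < +oo ->
  m1.-integrable setT (fun x => \int[m2]_y f (x, y)).
Proof.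
move=> mf fi.
by apply: (integrable_fubini_F (m1 := m1') (m2 := m2')); apply/integrable12ltyP.
Qed.

End sigma_finite_fubini.

Section Rintegral_fubini.
Context d1 d2 (T1 : measurableType d1) (T2 : measurableType d2) (R : realType).
Variables (m1 : {measure set T1 -> \bar R}) (m2 : {measure set T2 -> \bar R}).
Hypotheses (sf1 : sigma_finite setT m1) (sf2 : sigma_finite setT m2).

Lemma integrable_dominated d (T : measurableType d) (mu : {measure set T -> \bar R})
    (f g : T -> R) :
  measurable_fun setT f -> (forall x, `|f x| <= g x) ->
  mu.-integrable setT (EFin \o g) -> mu.-integrable setT (EFin \o f).
Proof.
move=> mf fg; apply: le_integrable => //; first exact/measurable_EFinP.
by move=> x _ /=; rewrite lee_fin (le_trans (fg x))// ler_norm.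
Qed.

Variables (F : T1 * T2 -> R) (a : T1 -> R) (b : T2 -> R).
Hypotheses (mF : measurable_fun setT F)
  (ai : m1.-integrable setT (EFin \o a)) (bi : m2.-integrable setT (EFin \o b))
  (Fab : forall x y, `|F (x, y)| <= a x * b y).

Lemma integrable_section1 x : m2.-integrable setT (fun y => (F (x, y))%:E).
Proof.
apply: (@integrable_dominated _ _ _ (fun y => F (x, y)) (fun y => a x * b y)) => //.
  by apply: (measurableT_comp mF); exact: measurable_fun_pair.
by rewrite (_ : _ \o _ = fun y => ((a x)%:E * (EFin \o b) y)%E)//; exact: integrableZl.
Qed.

Lemma integrable_section2 y : m1.-integrable setT (fun x => (F (x, y))%:E).
Proof.
apply: (@integrable_dominated _ _ _ (fun x => F (x, y)) (fun x => b y * a x)).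
- by apply: (measurableT_comp mF); exact: measurable_fun_pair.
- by move=> x; rewrite mulrC.
by rewrite (_ : _ \o _ = fun x => ((b y)%:E * (EFin \o a) x)%E)//; exact: integrableZl.
Qed.

(** The majorant [a x * b y] separates the variables, so its iterated integral is a product of two
    finite integrals. *)
Let fubini_finite : (\int[m1]_x \int[m2]_y `|(EFin \o F) (x, y)| < +oo)%E.
Proof.
have /integrableP[ma aoo] := ai; have /integrableP[mb boo] := bi.
apply: (@le_lt_trans _ _ (\int[m1]_x (`|(a x)%:E| * \int[m2]_y `|(b y)%:E|))%E).
  apply: ge0_le_integral => //.
  - by move=> x _; exact: integral_ge0.
  - apply: (measurable_tonelli sf2 (f := fun xy => `|(EFin \o F) xy|%E)) => //.
    by apply: measurableT_comp => //; exact/measurable_EFinP.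
  - by apply: emeasurable_funM => //; exact: measurableT_comp.
  move=> x _; rewrite -ge0_integralZl//; last exact: measurableT_comp.
  apply: ge0_le_integral => //.
  - apply: measurableT_comp => //; apply/measurable_EFinP.
    by apply: (measurableT_comp mF); exact: measurable_fun_pair.
  - by apply: emeasurable_funM => //; exact: measurableT_comp.
  move=> y _; rewrite -abseM -EFinM/= lee_fin.
  by rewrite (le_trans (Fab x y))// ler_norm.
rewrite ge0_integralZr//; last 2 first.
- exact: measurableT_comp.
- exact: integral_ge0.
by rewrite lte_mul_pinfty// ?integral_ge0// ge0_fin_numE// integral_ge0.
Qed.

Let mF' : measurable_fun setT (EFin \o F). Proof. exact/measurable_EFinP. Qed.

Lemma integrable_Rintegral_section :
  m1.-integrable setT (fun x => (\int[m2]_y F (x, y))%:E).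
Proof.
have := integrable_fubini sf1 sf2 mF' fubini_finite.
apply: eq_integrable => // x _; rewrite /Rintegral fineK//.
exact: integrable_fin_num (integrable_section1 x).
Qed.

Lemma Rintegral_fubini :
  \int[m1]_x \int[m2]_y F (x, y) = \int[m2]_y \int[m1]_x F (x, y).
Proof.
congr fine.
transitivity (\int[m1]_x \int[m2]_y (F (x, y))%:E)%E.
  apply: eq_integral => x _; rewrite /Rintegral fineK//.
  exact: integrable_fin_num (integrable_section1 x).
transitivity (\int[m2]_y \int[m1]_x (F (x, y))%:E)%E; last first.
  apply: eq_integral => y _; rewrite /Rintegral fineK//.
  exact: integrable_fin_num (integrable_section2 y).
exact: (sigma_finite_fubini sf1 sf2 mF' fubini_finite).
Qed.

End Rintegral_fubini.

Lemma ge0_le_poweR (R : realType) (x y : \bar R) (r : R) : 0 <= r ->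
  (0 <= x)%E -> (x <= y)%E -> (x `^ r <= y `^ r)%E.
Proof.
move=> r0 x0 xy; apply: gt0_ler_poweR => //; rewrite in_itv/= leey andbT//.
exact: le_trans xy.
Qed.

Section almost_everywhere_lemmas.
Context d (T : measurableType d) (R : realType) (mu : {measure set T -> \bar R}).
Implicit Types P Q : T -> Prop.

Lemma ae_mono P Q : (forall x, P x -> Q x) ->
  {ae mu, forall x, P x} -> {ae mu, forall x, Q x}.
Proof. by move=> PQ; exact: filterS. Qed.

Lemma ae_conj P Q : {ae mu, forall x, P x} -> {ae mu, forall x, Q x} ->
  {ae mu, forall x, P x /\ Q x}.
Proof. by move=> aP aQ; exact: filterI. Qed.

End almost_everywhere_lemmas.

(** * L^p norms for finite exponents *)

Section Lnorm_lemmas.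
Context d (T : measurableType d) (R : realType).
Variables (mu : {measure set T -> \bar R}) (p : R).
Hypothesis p1 : 1 < p.
Local Notation "'N[ f ]" := (Lnorm mu p%:E (EFin \o f)) (format "''N[' f ]").
Implicit Types f g h : T -> R.

Let p0 : 0 < p. Proof. exact: lt_trans p1. Qed.

Lemma LnormE f : 'N[f] = ((\int[mu]_x (`|f x| `^ p)%:E) `^ p^-1)%E.
Proof. by rewrite unlock. Qed.

Lemma Lnorm_powR f : ('N[f] `^ p)%E = (\int[mu]_x (`|f x| `^ p)%:E)%E.
Proof.
by rewrite LnormE -poweRrM mulVf ?gt_eqF// poweRe1// integral_ge0// => x _; rewrite lee_fin powR_ge0.
Qed.

Let pV0 : 0 <= p^-1. Proof. by rewrite invr_ge0 ltW. Qed.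

Let int_ge0 f : (0 <= \int[mu]_x (`|f x| `^ p)%:E)%E.
Proof. by rewrite integral_ge0// => x _; rewrite lee_fin powR_ge0. Qed.

Lemma Lnorm_leP f (e : R) : 0 <= e ->
  ('N[f] <= e%:E)%E <-> (\int[mu]_x (`|f x| `^ p)%:E <= (e `^ p)%:E)%E.
Proof.
move=> e0; split => h.
  by rewrite -Lnorm_powR -poweR_EFin ge0_le_poweR ?(ltW p0) ?Lnorm_ge0.
rewrite LnormE -[e%:E](@poweRe1 R)// -(mulfV (lt0r_neq0 p0)) poweRrM poweR_EFin.
exact: ge0_le_poweR.
Qed.

Lemma Lnorm_ltyP f : ('N[f] < +oo)%E <-> (\int[mu]_x (`|f x| `^ p)%:E < +oo)%E.
Proof.
rewrite LnormE; split; last exact: poweR_lty.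
by apply: lty_poweRy; rewrite invr_neq0 ?gt_eqF.
Qed.

Lemma measurable_normpowR f : measurable_fun setT f ->
  measurable_fun setT (fun x => (`|f x| `^ p)%:E).
Proof.
move=> mf; apply/measurable_EFinP.
by apply: (measurableT_comp (measurable_powR p) (measurableT_comp (@normr_measurable _ _) mf)).
Qed.

Lemma le_Lnorm f g : measurable_fun setT f -> measurable_fun setT g ->
  (forall x, `|f x| <= `|g x|) -> ('N[f] <= 'N[g])%E.
Proof.
move=> mf mg fg; rewrite !LnormE ge0_le_poweR//.
apply: ge0_le_integral => //.
- exact: measurable_normpowR.
- exact: measurable_normpowR.
- by move=> x _; rewrite lee_fin ge0_ler_powR ?(ltW p0)// nnegrE.
Qed.

Lemma Lnorm_scale f (c : R) : measurable_fun setT f ->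
  'N[fun x => c * f x] = (`|c|%:E * 'N[f])%E.
Proof.
move=> mf; rewrite !LnormE.
under eq_integral do rewrite normrM powRM// EFinM.
rewrite ge0_integralZl//; last exact: measurable_normpowR.
rewrite poweRM; last 2 first.
- by rewrite lee_fin powR_ge0.
- exact: int_ge0.
by rewrite poweR_EFin -powRrM mulfV ?gt_eqF// powRr1.
Qed.

Lemma Lnorm_add f g : measurable_fun setT f -> measurable_fun setT g ->
  ('N[fun x => (f x + g x)%R] <= 'N[f] + 'N[g])%E.
Proof. by move=> mf mg; apply: minkowski_EFin => //; exact: ltW. Qed.

Lemma Lnorm_sub f g : measurable_fun setT f -> measurable_fun setT g ->
  ('N[fun x => (f x - g x)%R] <= 'N[f] + 'N[g])%E.
Proof.
move=> mf mg; apply: (le_trans (Lnorm_add mf (measurableT_comp (@oppr_measurable _ _) mg))).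
rewrite leeD2l// le_Lnorm//; first exact: measurableT_comp.
by move=> x /=; rewrite normrN.
Qed.

Lemma Lnorm_zero : 'N[fun=> 0] = 0%E.
Proof.
by rewrite LnormE integral0_eq ?poweR0r ?invr_eq0 ?gt_eqF// => x _; rewrite normr0 powR0// gt_eqF.
Qed.

(** Dominated convergence for |f_k|^p under the majorant |h|^p. One good index for each [e] is what
    the density arguments consume. *)
Lemma Lnorm_dominated (f_ : nat -> T -> R) h :
  (forall k, measurable_fun setT (f_ k)) -> measurable_fun setT h ->
  (forall x, f_ ^~ x @ \oo --> 0) -> (forall k x, `|f_ k x| <= h x) ->
  ('N[h] < +oo)%E ->
  forall e, 0 < e -> exists k, ('N[f_ k] <= e%:E)%E.
Proof.
move=> mf mh f0 fh hfin e e0.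
have h0 x : 0 <= h x by apply: le_trans (fh 0%N x).
pose F k x := (`|f_ k x| `^ p)%:E.
have F0 x : F ^~ x @ \oo --> 0%E.
  apply: cvg_EFin; first exact: nearW.
  (* To bring |f_k|^p below [r], |f_k| is brought below r^(1/p). *)
  apply/cvgrPdist_lt => r r0; have r'0 : 0 < r `^ p^-1 by rewrite powR_gt0.
  have /cvgrPdist_lt/(_ _ r'0) := f0 x; apply: filterS => k; rewrite sub0r normrN => hk.
  rewrite sub0r normrN /= ger0_norm ?powR_ge0//.
  rewrite -[ltRHS]powRr1 ?(ltW r0)// -(mulVf (lt0r_neq0 p0)) powRrM.
  by rewrite gt0_ltr_powR// nnegrE// powR_ge0.
have mF k : measurable_fun setT (F k) by exact: measurable_normpowR.
have hi : mu.-integrable setT (fun x => (`|h x| `^ p)%:E).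
  apply/integrableP; split; first exact: measurable_normpowR.
  by under eq_integral do rewrite gee0_abs ?lee_fin ?powR_ge0//; apply/Lnorm_ltyP.
have Fh : {ae mu, forall x k, setT x -> (`|F k x| <= (`|h x| `^ p)%:E)%E}.
  apply: aeW => x k _; rewrite gee0_abs ?lee_fin ?powR_ge0//.
  by rewrite ge0_ler_powR ?(ltW p0)// ?nnegrE// (le_trans (fh k x))// ler_norm.
have [_ _ /= F_to0] := @dominated_convergence _ T R mu setT measurableT F (cst 0%E) _
  mF (measurable_cst _) (aeW _ (fun x _ => F0 x)) hi Fh.
rewrite integral0 in F_to0.
have ep : nbhs 0%E [set y | (y < (e `^ p)%:E)%E].
  by apply: open_nbhs_nbhs; split; [exact: open_ereal_lt_ereal|rewrite /= lte_fin powR_gt0].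
have [k _ /(_ k (leqnn k)) /= Fk] := F_to0 _ ep; exists k.
by apply/Lnorm_leP; [exact: ltW|exact: ltW].
Qed.

End Lnorm_lemmas.

(** * Integration against Lebesgue measure *)

Section lebesgue_integration.
Context (R : realType) (n : nat).
Implicit Types (f g : 'rV[R]_n -> R) (A B : set 'rV[R]_n).
Local Notation leb := (@lebesgue_rV R n).
Local Notation Rn := (lebesgue_space R n).

(* These names keep unification from unfolding the Caratheodory sigma-algebra.   *)
Definition lebset A : Prop := measurable (A : set Rn).
Definition lebmeas f : Prop := measurable_fun [set: Rn] f.
Definition lebint f : Prop := leb.-integrable [set: Rn] (EFin \o f).
Definition lebnorm (p : R) f : \bar R := Lnorm leb p%:E (EFin \o f).

Lemma lebset_open A : open A -> lebset A.
Proof. exact: open_lebesgue_measurable. Qed.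

Lemma lebsetD A B : lebset A -> lebset B -> lebset (A `\` B).
Proof. exact: measurableD. Qed.

Lemma lebmeas_continuous f : continuous f -> lebmeas f.
Proof. exact: measurable_continuous. Qed.

Lemma lebmeas_cst (c : R) : lebmeas (fun=> c).
Proof. exact: measurable_cst. Qed.

Lemma lebmeasD f g : lebmeas f -> lebmeas g -> lebmeas (fun x => f x + g x).
Proof. exact: measurable_funD. Qed.

Lemma lebmeasB f g : lebmeas f -> lebmeas g -> lebmeas (fun x => f x - g x).
Proof. exact: measurable_funB. Qed.

Lemma lebmeasM f g : lebmeas f -> lebmeas g -> lebmeas (fun x => f x * g x).
Proof. exact: measurable_funM. Qed.

Lemma lebmeasN f : lebmeas f -> lebmeas (fun x => - f x).
Proof. exact: (measurableT_comp (@oppr_measurable R setT)). Qed.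

Lemma lebmeas_norm f : lebmeas f -> lebmeas (fun x => `|f x|).
Proof. exact: (measurableT_comp (@normr_measurable R setT)). Qed.

Lemma lebmeas_powR f (p : R) : lebmeas f -> lebmeas (fun x => f x `^ p).
Proof. exact: (measurableT_comp (@measurable_powR R p)). Qed.

Lemma lebmeas_max0 f : lebmeas f -> lebmeas (fun x => Num.max (f x) 0).
Proof. by move=> mf; exact: (@measurable_maxr _ Rn R setT f (cst 0) mf (@measurable_cst _ _ Rn R setT 0)). Qed.

Lemma lebmeas_indic A : lebset A -> lebmeas (\1_A : 'rV[R]_n -> R).
Proof. exact: (@measurable_indic _ Rn R setT A). Qed.

Lemma lebmeas_sum (I : Type) (s : seq I) (F : I -> 'rV[R]_n -> R) :
  (forall i, lebmeas (F i)) -> lebmeas (fun x => \sum_(i <- s) F i x).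
Proof. exact: (@measurable_sum _ Rn R setT I s F). Qed.

Lemma lebmeas_shift f (x : 'rV[R]_n) : continuous f -> lebmeas (fun y => f (y - x)).
Proof.
move=> cf; apply: (@measurable_continuous_comp _ _ _ Rn (fun y => y - x : 'rV[R]_n) f _ cf) => i.
under eq_fun do rewrite !mxE.
exact: (measurable_funB (@measurable_coord R n i) (@measurable_cst _ _ Rn R setT (x 0 i))).
Qed.

Lemma lebint_meas f : lebint f -> lebmeas f.
Proof. by move=> /measurable_int/measurable_EFinP. Qed.

Lemma lebint_le f g : lebmeas f -> (forall x, `|f x| <= g x) -> lebint g -> lebint f.
Proof. exact: integrable_dominated. Qed.

Lemma lebint_norm f : lebint f -> lebint (fun x => `|f x|).
Proof. exact: integrable_abse. Qed.

Lemma lebintZ (c : R) f : lebint f -> lebint (fun x => c * f x).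
Proof. exact: (integrableZl measurableT). Qed.

Lemma lebintB f g : lebint f -> lebint g -> lebint (fun x => f x - g x).
Proof. exact: (integrableB measurableT). Qed.

Lemma lebintD f g : lebint f -> lebint g -> lebint (fun x => f x + g x).
Proof. exact: (integrableD measurableT). Qed.

Lemma lebint_bounded_support f (B M : R) : lebmeas f -> (forall x, `|f x| <= B) ->
  (forall x, M <= `|x| -> f x = 0) -> lebint f.
Proof.
move=> mf fB fM; pose A := [set x : 'rV[R]_n | `|x| < M].
have mA : lebset A by exact/lebset_open/open_norm_lt.
have i1 : lebint \1_A.
  apply/integrableP; split; first by apply/measurable_EFinP; exact: lebmeas_indic.
  under eq_integral do rewrite gee0_abs ?lee_fin ?indicE ?ler0n//.
  by rewrite integral_indic// setIT; exact/lebesgue_bounded_lty/bounded_norm_lt.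
apply: (lebint_le mf _ (lebintZ B i1)) => x.
rewrite indicE; have [xA|xA] := boolP (x \in A); first by rewrite mulr1.
rewrite fM ?normr0 ?mulr0// leNgt; apply/negP => h; by move/negP: xA; apply; rewrite inE.
Qed.

Lemma lebint_norm_le f : lebint f ->
  `|\int[leb]_x f x| <= \int[leb]_x `|f x|.
Proof. exact: (le_normr_Rintegral measurableT). Qed.

Lemma lebint_mono f g : lebint f -> lebint g -> (forall x, f x <= g x) ->
  \int[leb]_x f x <= \int[leb]_x g x.
Proof. by move=> fi gi fg; exact: (le_Rintegral measurableT fi gi (fun x _ => fg x)). Qed.

Lemma Rintegral_lebZ (c : R) f : lebint f ->
  \int[leb]_x (c * f x) = c * \int[leb]_x f x.
Proof. by move=> fi; exact: (RintegralZl c measurableT fi). Qed.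

Lemma Rintegral_lebB f g : lebint f -> lebint g ->
  \int[leb]_x (f x - g x) = \int[leb]_x f x - \int[leb]_x g x.
Proof. exact: (RintegralB measurableT). Qed.

Lemma Rintegral_lebD f g : lebint f -> lebint g ->
  \int[leb]_x (f x + g x) = \int[leb]_x f x + \int[leb]_x g x.
Proof. exact: (RintegralD measurableT). Qed.

Lemma Rintegral_leb_shift (x : 'rV[R]_n) f : lebint f ->
  \int[leb]_y f ((y : 'rV[R]_n) - x)%R = \int[leb]_y f y.
Proof.
move=> fi; congr fine; have fi' := integrable_reflect 0 fi.
rewrite -[RHS](integral_reflect 0 fi) -[RHS](integral_reflect x fi').
by apply: eq_integral => y _ /=; rewrite sub0r opprB.
Qed.

Lemma Rintegral_leb_reflect (x : 'rV[R]_n) f : lebint f ->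
  \int[leb]_y f (x - (y : 'rV[R]_n))%R = \int[leb]_y f y.
Proof. by move=> fi; congr fine; exact: (integral_reflect x fi). Qed.

Lemma lebint_fin_num f : lebint f -> (\int[leb]_x (f x)%:E)%E \is a fin_num.
Proof. exact: integrable_fin_num. Qed.

Lemma eq_integral_leb (f g : 'rV[R]_n -> \bar R) : f =1 g ->
  (\int[leb]_x f x = \int[leb]_x g x)%E.
Proof. by move=> fg; apply: eq_integral => x _; exact: fg. Qed.

Lemma eq_Rintegral_leb f g : f =1 g -> \int[leb]_x f x = \int[leb]_x g x.
Proof. by move=> fg; apply: eq_Rintegral => x _; exact: fg. Qed.

Lemma ge0_integral_lebZ (c : R) (f : 'rV[R]_n -> \bar R) : 0 <= c ->
  measurable_fun [set: Rn] f -> (forall x, 0 <= f x)%E ->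
  (\int[leb]_x (c%:E * f x) = c%:E * \int[leb]_x f x)%E.
Proof.
move=> c0 mf f0.
by rewrite (ge0_integralZl leb measurableT mf (fun x _ => f0 x)) ?lee_fin.
Qed.

Section norm.
Variable (p : R).
Hypothesis p1 : 1 < p.
Let p0 : 0 < p. Proof. exact: lt_trans p1. Qed.

Lemma lebnorm_ge0 f : (0 <= lebnorm p f)%E.
Proof. exact: Lnorm_ge0. Qed.

Lemma lebnorm_leP f (e : R) : 0 <= e ->
  (lebnorm p f <= e%:E)%E <-> (\int[leb]_x (`|f x| `^ p)%:E <= (e `^ p)%:E)%E.
Proof. exact: Lnorm_leP. Qed.

Lemma le_lebnorm f g : lebmeas f -> lebmeas g -> (forall x, `|f x| <= `|g x|) ->
  (lebnorm p f <= lebnorm p g)%E.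
Proof. exact: le_Lnorm. Qed.

Lemma lebnormZ f (c : R) : lebmeas f ->
  lebnorm p (fun x => c * f x) = (`|c|%:E * lebnorm p f)%E.
Proof. exact: Lnorm_scale. Qed.

Lemma lebnormD f g : lebmeas f -> lebmeas g ->
  (lebnorm p (fun x => f x + g x)%R <= lebnorm p f + lebnorm p g)%E.
Proof. exact: Lnorm_add. Qed.

Lemma lebnormB f g : lebmeas f -> lebmeas g ->
  (lebnorm p (fun x => f x - g x)%R <= lebnorm p f + lebnorm p g)%E.
Proof. exact: Lnorm_sub. Qed.

Lemma lebnorm0 : lebnorm p (fun=> 0) = 0%E.
Proof. exact: Lnorm_zero. Qed.

Lemma lebnorm_dominated (f_ : nat -> 'rV[R]_n -> R) h :
  (forall k, lebmeas (f_ k)) -> lebmeas h ->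
  (forall x, f_ ^~ x @ \oo --> 0) -> (forall k x, `|f_ k x| <= h x) ->
  (lebnorm p h < +oo)%E ->
  forall e, 0 < e -> exists k, (lebnorm p (f_ k) <= e%:E)%E.
Proof. exact: Lnorm_dominated. Qed.

Let normr_indic_powR (T : Type) (A : set T) (x : T) :
  `|\1_A x : R| `^ p = \1_A x.
Proof.
rewrite indicE; case: (_ \in _); first by rewrite normr1 powR1.
by rewrite normr0 powR0// gt_eqF.
Qed.

Lemma lebnorm_indic_le A (e : R) : 0 <= e -> lebset A ->
  (leb A <= (e `^ p)%:E)%E -> (lebnorm p \1_A <= e%:E)%E.
Proof.
move=> e0 mA Ae; apply/lebnorm_leP => //; apply: le_trans Ae.
by under eq_integral do rewrite normr_indic_powR; rewrite integral_indic// setIT.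
Qed.

Lemma lebnorm_indic_bounded A : lebset A -> bounded_set A ->
  (lebnorm p \1_A < +oo)%E.
Proof.
move=> mA bA; apply/Lnorm_ltyP => //; apply: le_lt_trans (lebesgue_bounded_lty bA).
by under eq_integral do rewrite normr_indic_powR; rewrite integral_indic// setIT.
Qed.

(** On a set of finite measure L^p embeds in L^1, since |f| <= 1 + |f|^p there, whether |f| is below
    or above 1. *)
Lemma lebint_lebnorm f A : lebset A -> bounded_set A -> lebmeas f ->
  (forall x, ~ A x -> f x = 0) -> (lebnorm p f < +oo)%E -> lebint f.
Proof.
move=> mA bA mf f0 fp.
have i1 : lebint \1_A.
  apply/integrableP; split; first by apply/measurable_EFinP; exact: lebmeas_indic.
  under eq_integral do rewrite gee0_abs ?lee_fin ?indicE ?ler0n//.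
  by rewrite integral_indic// setIT; exact: lebesgue_bounded_lty.
have ip : lebint (fun x => `|f x| `^ p).
  apply/integrableP; split.
    by apply/measurable_EFinP; apply: lebmeas_powR; exact: lebmeas_norm.
  under eq_integral do rewrite gee0_abs ?lee_fin ?powR_ge0//.
  by apply/Lnorm_ltyP.
apply: (lebint_le mf _ (lebintD i1 ip)) => x.
have [Ax|/f0 ->] := pselect (A x); last first.
  by rewrite normr0 powR0 ?gt_eqF// addr0 indicE ler0n.
rewrite indicE mem_set//; have [f1|f1] := leP `|f x| 1.
  by rewrite (le_trans f1)// lerDl powR_ge0.
by rewrite (le_trans (le1r_powR (ltW f1) (ltW p1)))// lerDr.
Qed.

End norm.

End lebesgue_integration.

(** * Density of Lipschitz functions in L^p *)

Section outer_regularity.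
Context (R : realType) (n : nat).
Implicit Types (x y a b : 'rV[R]_n) (A B : set 'rV[R]_n).
Local Notation leb := (@lebesgue_rV R n).

Lemma open_coord_gt (i : 'I_n) (c : R) : open [set x : 'rV[R]_n | c < x 0 i].
Proof.
rewrite (_ : [set x | _] = (fun x : 'rV[R]_n => x 0 i) @^-1` [set t | c < t])//.
by apply: open_comp; [move=> x _; exact: coord_continuous|exact: open_gt].
Qed.

Lemma open_coord_lt (i : 'I_n) (c : R) : open [set x : 'rV[R]_n | x 0 i < c].
Proof.
rewrite (_ : [set x | _] = (fun x : 'rV[R]_n => x 0 i) @^-1` [set t | t < c])//.
by apply: open_comp; [move=> x _; exact: coord_continuous|exact: open_lt].
Qed.

Lemma open_box_enlarged a b (r : R) :
  open [set x : 'rV[R]_n | forall i, a 0 i - r < x 0 i < b 0 i + r].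
Proof.
rewrite openE => x xV.
suff : \forall y \near (x : 'rV[R]_n), forall i, a 0 i - r < (y : 'rV[R]_n) 0 i < b 0 i + r by [].
have FF : Filter (nbhs (x : 'rV[R]_n)) by exact: nbhs_filter.
refine (@filter_forall _ _ (fun i => [set y : 'rV[R]_n | a 0 i - r < y 0 i < b 0 i + r]) _ FF _) => i; have /andP[ax xb] := xV i.
near=> y; apply/andP; split; near: y.
  by apply: open_nbhs_nbhs; split; [exact: open_coord_gt|].
by apply: open_nbhs_nbhs; split; [exact: open_coord_lt|].
Unshelve. all: end_near. Qed.

Lemma continuous_prod_affine (I : Type) (s : seq I) (c : I -> R) :
  continuous (fun r : R => \prod_(i <- s) (c i + 2 * r)).
Proof.
elim: s => [|i s ih] x.
  by under eq_fun do rewrite big_nil; exact: cvg_cst.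
under eq_fun do rewrite big_cons.
apply: cvgM; last exact: ih.
by apply: cvgD; [exact: cvg_cst|apply: cvgMr; exact: cvg_id].
Qed.

(** A bounding box within e / 2 of optimal is thickened by [r] on every side and opened. The
    thickened volume is a polynomial in [r], so a small [r] costs at most the other e / 2. *)
Lemma box_volume_enlarge A (e : R) : 0 < e ->
  exists V : set 'rV[R]_n,
    [/\ open V, A `<=` V & (lebesgue_outer V <= box_volume A + e%:E)%E].
Proof.
move=> e0; have [->|A0] := eqVneq A set0.
  exists set0; split; [exact: open0|by []|].
  by rewrite outer_measure0 box_volume0 add0e lee_fin ltW.
have [Aoo|Afin] := eqVneq (box_volume A) +oo%E.
  by exists setT; split; [exact: openT|by []|rewrite Aoo addye// leey].
have Afn : box_volume A \is a fin_num.
  by rewrite ge0_fin_numE ?box_volume_ge0// ltey.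
have : (box_volume A < box_volume A + (e / 2)%:E)%E.
  by rewrite lteDl// lte_fin divr_gt0.
rewrite {1}/box_volume (negPf A0) => /ereal_inf_lt[_ [a [b [Aab ->]]] vlt].
pose v (r : R) := \prod_(i < n) (b 0 i - a 0 i + 2 * r).
have /cvgrPdist_lt/(_ (e / 2)) : v r @[r --> (0 : R)] --> v 0.
  exact: continuous_prod_affine.
rewrite divr_gt0// => /(_ isT) /nbhs_ballP[d /= d0] /(_ (d / 2)).
rewrite -ball_normE /= sub0r normrN gtr0_norm ?divr_gt0// ltr_pdivrMr// ltr_pMr// ltr1n.
move=> /(_ isT); set r := d / 2 => vr.
have r0 : 0 < r by rewrite divr_gt0.
pose V := [set x : 'rV[R]_n | forall i, a 0 i - r < x 0 i < b 0 i + r].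
have AV : A `<=` V.
  by move=> x /Aab xab i; have /andP[? ?] := xab i; apply/andP; split; lra.
exists V; split => //; first exact: open_box_enlarged.
apply: (le_trans (lebesgue_outer_le_box_volume _)).
have Vr : V `<=` box (a - const_mx r) (b + const_mx r).
  by move=> x Vx i; rewrite !mxE; have /andP[? ?] := Vx i; apply/andP; split; lra.
have V0 : V !=set0 by move/set0P : A0 => [x /AV]; exists x.
apply: (le_trans (box_volume_le V0 Vr)).
rewrite (_ : \prod_(i < n) _ = v r); last first.
  by apply: eq_bigr => i _; rewrite !mxE; ring.
have v0 : v 0 = \prod_(i < n) (b 0 i - a 0 i).
  by apply: eq_bigr => i _; rewrite mulr0 addr0.
rewrite -v0 in vlt.
rewrite (splitr e) EFinD addeA; apply: (@le_trans _ _ (v 0 + e / 2)%:E).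
  by rewrite lee_fin; move: vr; rewrite ltr_norml => /andP[? ?]; lra.
by rewrite EFinD leeD2r// ltW.
Qed.

(** In a covering within e / 2 of optimal, the [k]-th set is enlarged to an open one at cost (e / 2)
    / 2^(k+1); these costs sum to e / 2. *)
Lemma lebesgue_outer_regular A (e : R) : 0 < e ->
  exists V : set 'rV[R]_n,
    [/\ open V, A `<=` V & (lebesgue_outer V <= lebesgue_outer A + e%:E)%E].
Proof.
move=> e0.
have [Aoo|Afin] := eqVneq (lebesgue_outer A) +oo%E.
  by exists setT; split; [exact: openT|by []|rewrite Aoo addye// leey].
have Afn : lebesgue_outer A \is a fin_num.
  by rewrite ge0_fin_numE ?outer_measure_ge0// ltey.
have : (lebesgue_outer A < lebesgue_outer A + (e / 2)%:E)%E.
  by rewrite lteDl// lte_fin divr_gt0.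
move=> /ereal_inf_lt[_ [F [_ AF] <-] Flt].
have e20 : 0 < e / 2 by rewrite divr_gt0.
have /choice[V VP] : forall k, exists V : set 'rV[R]_n,
    [/\ open V, F k `<=` V & (lebesgue_outer V <= box_volume (F k) + (e / 2 / (2 ^ k.+1)%:R)%:E)%E].
  by move=> k; apply: box_volume_enlarge; rewrite divr_gt0// ltr0n expn_gt0.
exists (\bigcup_k V k); split.
- by apply: bigcup_open => k _; have [] := VP k.
- by move=> x /AF[k _ Fk]; exists k => //; have [_ + _] := VP k; apply.
apply: (le_trans (outer_measure_sigma_subadditive _ V)).
apply: (@le_trans _ _ (\sum_(k <oo) (box_volume (F k) + (e / 2 / (2 ^ k.+1)%:R)%:E))%E).
  by apply: lee_nneseries => k *; [exact: outer_measure_ge0|have [] := VP k].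
apply: (le_trans (epsilon_trick _ _ (ltW e20))); first by move=> *; exact: box_volume_ge0.
by rewrite [in leRHS](splitr e) EFinD addeA leeD2r// ltW.
Qed.

Lemma lebesgue_open_approx A (D : set 'rV[R]_n) (e : R) : 0 < e ->
  open D -> bounded_set D -> A `<=` D ->
  measurable (A : set (lebesgue_space R n)) ->
  exists V : set 'rV[R]_n, [/\ open V, A `<=` V, V `<=` D &
    (leb (V `\` A) <= e%:E)%E].
Proof.
move=> e0 oD bD AD mA; have [V [oV AV Ve]] := lebesgue_outer_regular A e0.
exists (V `&` D); split; [exact: openI|by move=> x Ax; split; [exact: AV|exact: AD]|exact: subIsetr|].
have mVD : measurable (V `&` D : set (lebesgue_space R n)).
  exact/open_lebesgue_measurable/openI.
have Afin : (leb A < +oo)%E.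
  exact: (le_lt_trans (le_outer_measure _ _ _ AD) (lebesgue_bounded_lty bD)).
have VDA : V `&` D `&` A = A.
  by apply/seteqP; split => [x []//|x Ax]; split => //; split; [exact: AV|exact: AD].
have VDfin : (leb (V `&` D) < +oo)%E.
  exact: (le_lt_trans (le_outer_measure _ _ _ (@subIsetr _ V D)) (lebesgue_bounded_lty bD)).
rewrite measureD// VDA leeBlDr//; last by rewrite ge0_fin_numE.
rewrite addeC; apply: le_trans Ve; apply: le_outer_measure; exact: subIsetl.
Qed.

End outer_regularity.

Section lip_functions.
Context (R : realType) (n : nat).
Implicit Types (x y : 'rV[R]_n) (f g : 'rV[R]_n -> R).

(** Global Lipschitz functions serve both as the dense class in L^p and as kernels: an explicit
    constant turns every continuity estimate for averages into a one-line bound. *)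
Definition lip g := exists2 k : R, 0 <= k & forall x y, `|g x - g y| <= k * `|x - y|.

Lemma lip0 : lip (fun=> 0).
Proof. by exists 0 => // x y; rewrite subrr normr0 mul0r. Qed.

Lemma lip_add f g : lip f -> lip g -> lip (fun x => f x + g x).
Proof.
move=> [k k0 fk] [l l0 gl]; exists (k + l); first exact: addr_ge0.
move=> x y; rewrite [_ - _](_ : _ = (f x - f y) + (g x - g y)); last by ring.
by rewrite mulrDl (le_trans (ler_normD _ _))// lerD.
Qed.

Lemma lip_scale (c : R) f : lip f -> lip (fun x => c * f x).
Proof.
move=> [k k0 fk]; exists (`|c| * k); first exact: mulr_ge0.
by move=> x y; rewrite -mulrBr normrM -mulrA ler_wpM2l.
Qed.

Lemma lip_continuous f : lip f -> continuous f.
Proof.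
move=> [k k0 fk] x A /nbhs_ballP[e /= e0 eA].
have d0 : 0 < e / (k + 1) by rewrite divr_gt0// ltr_wpDl.
apply/nbhs_ballP; exists (e / (k + 1)) => // y; rewrite -ball_normE /= => h.
apply: eA; rewrite -ball_normE/=; apply: (le_lt_trans (fk _ _)); move: h.
rewrite ltr_pdivlMr ?ltr_wpDl// => h; apply: le_lt_trans h.
by rewrite mulrDr mulr1 mulrC lerDl.
Qed.

(* The point 1 makes the infimum one of a nonempty set even if [U] is [setT].   *)
Definition codist (U : set 'rV[R]_n) x : R :=
  inf ([set 1] `|` [set `|x - y| | y in ~` U]).

Let codist_inf U x :
  has_inf ([set 1] `|` [set `|x - y| | y in ~` U]).
Proof.
split; first by exists 1; left.
by exists 0 => _ [->|[y _ <-]].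
Qed.

Lemma codist_ge0 U x : 0 <= codist U x.
Proof. by apply: lb_le_inf; [exists 1; left|move=> _ [->|[y _ <-]]]. Qed.

Lemma codist_le1 U x : codist U x <= 1.
Proof. by apply: ge_inf; [have [] := codist_inf U x|left]. Qed.

Lemma codist_out U x : ~ U x -> codist U x = 0.
Proof.
move=> Ux; apply/eqP; rewrite eq_le codist_ge0 andbT.
apply: ge_inf; first by have [] := codist_inf U x.
by right; exists x; rewrite ?subrr ?normr0.
Qed.

Lemma codist_gt0 U x : open U -> U x -> 0 < codist U x.
Proof.
move=> oU Ux; have /nbhs_ballP[e /= e0 xe] := open_nbhs_nbhs (conj oU Ux).
apply: (@lt_le_trans _ _ (Num.min 1 e)); first by rewrite lt_min ltr01.
apply: lb_le_inf; first by exists 1; left.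
move=> _ [->|[y Uy <-]]; first by rewrite ge_min lexx.
rewrite ge_min; apply/orP; right; rewrite leNgt; apply/negP => xy.
by apply: Uy; apply: xe; rewrite -ball_normE.
Qed.

Lemma codist_lip U x y : `|codist U x - codist U y| <= `|x - y|.
Proof.
suff h u v : codist U u <= codist U v + `|u - v|.
  rewrite ler_norml; apply/andP; split.
    by have := h y x; rewrite (distrC y); lra.
  by have := h x y; lra.
rewrite -lerBlDr; apply: lb_le_inf; first by exists 1; left.
have [_ lb] := codist_inf U u.
move=> _ [->|[z Uz <-]].
  by rewrite lerBlDr (le_trans (codist_le1 _ _))// lerDl.
rewrite lerBlDr addrC; apply: (@le_trans _ _ `|u - z|).
  by apply: ge_inf => //; right; exists z.
by rewrite -(subrKA v) ler_normD.
Qed.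

End lip_functions.

Section lip_density.
Import HBNNSimple.
Context (R : realType) (n : nat) (p : R) (D : set 'rV[R]_n).
Hypotheses (p1 : 1 < p) (oD : open D) (bD : bounded_set D).
Implicit Types (f g : 'rV[R]_n -> R).
Local Notation leb := (@lebesgue_rV R n).
Local Notation "'N[ f ]" := (lebnorm p f) (format "''N[' f ]").

(** Vanishing off the bounded set [D] makes the approximant integrable, so that it can be
    mollified. *)
Definition lip_approx f := forall e : R, 0 < e -> exists g,
  [/\ lip g, forall x, ~ D x -> g x = 0 & ('N[fun x => (f x - g x)%R] <= e%:E)%E].

Lemma lebmeas_lip g : lip g -> lebmeas g.
Proof. by move=> /lip_continuous; exact: lebmeas_continuous. Qed.

Lemma lip_approx_add f1 f2 : lebmeas f1 -> lebmeas f2 ->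
  lip_approx f1 -> lip_approx f2 -> lip_approx (fun x => f1 x + f2 x).
Proof.
move=> mf1 mf2 h1 h2 e e0.
have e20 : 0 < e / 2 by rewrite divr_gt0.
have [g1 [lg1 g10 fg1]] := h1 _ e20; have [g2 [lg2 g20 fg2]] := h2 _ e20.
exists (fun x => g1 x + g2 x); split; first exact: lip_add.
  by move=> x Dx; rewrite g10// g20// addr0.
rewrite (_ : (fun x => _) = (fun x => (f1 x - g1 x) + (f2 x - g2 x))); last first.
  by apply/funext => x; ring.
apply: (le_trans (lebnormD p1 _ _)).
- by apply: lebmeasB => //; exact: lebmeas_lip.
- by apply: lebmeasB => //; exact: lebmeas_lip.
by rewrite (splitr e) EFinD leeD.
Qed.

Lemma lip_approx_scale (c : R) f : lebmeas f -> lip_approx f -> lip_approx (fun x => c * f x).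
Proof.
move=> mf h e e0; have c0 : 0 < `|c| + 1 by rewrite ltr_wpDl.
have [g [lg g0 fg]] := h (e / (`|c| + 1)) (divr_gt0 e0 c0).
exists (fun x => c * g x); split; first exact: lip_scale.
  by move=> x Dx; rewrite g0// mulr0.
rewrite (_ : (fun x => _) = (fun x => c * (f x - g x))); last first.
  by apply/funext => x; ring.
rewrite lebnormZ//; last by apply: lebmeasB => //; exact: lebmeas_lip.
apply: (@le_trans _ _ (`|c|%:E * (e / (`|c| + 1))%:E)%E); first by rewrite lee_wpmul2l.
rewrite -EFinM lee_fin mulrCA ler_piMr ?(ltW e0)// ler_pdivrMr// mul1r lerDl//.
Qed.

Lemma lip_approx_lim f : lebmeas f ->
  (forall e : R, 0 < e -> exists f',
    [/\ lebmeas f', lip_approx f' & ('N[fun x => (f x - f' x)%R] <= e%:E)%E]) ->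
  lip_approx f.
Proof.
move=> mf h e e0; have e20 : 0 < e / 2 by rewrite divr_gt0.
have [f' [mf' hf' ff']] := h _ e20; have [g [lg g0 fg]] := hf' _ e20.
exists g; split => //.
rewrite (_ : (fun x => _) = (fun x => (f x - f' x) + (f' x - g x))); last first.
  by apply/funext => x; ring.
apply: (le_trans (lebnormD p1 _ _)).
- exact: lebmeasB.
- by apply: lebmeasB => //; exact: lebmeas_lip.
by rewrite (splitr e) EFinD leeD.
Qed.

Lemma lip_approx0 : lip_approx (fun=> 0).
Proof.
move=> e e0; exists (fun=> 0); split; [exact: lip0|by []|].
by rewrite (_ : (fun x => _) = fun=> 0) ?lebnorm0 ?lee_fin ?ltW//; apply/funext => x; rewrite subrr.
Qed.

(** The functions min(1, k d(x)), with d the truncated distance to the complement of [U], reach 1 at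
    every point of [U] for large [k], vanish off [U], and the error is dominated by the indicator of
    [D]. *)
Lemma lip_approx_open U : open U -> U `<=` D -> lip_approx \1_U.
Proof.
move=> oU UD e e0.
pose g k x := Num.min 1 (k%:R * codist U x).
have lg k : lip (g k).
  exists k%:R; first by [].
  move=> x y; apply: (@le_trans _ _ `|k%:R * codist U x - k%:R * codist U y|).
    rewrite /g; set a := k%:R * _; set b := k%:R * _.
    have h1 := ler_norm (a - b); have h2 := ler_norm (b - a); rewrite (distrC b a) in h2.
    by rewrite ler_norml minEle (minEle 1 b); case: (leP 1 a) => ?; case: (leP 1 b) => ?; apply/andP; split; lra.
  by rewrite -mulrBr normrM ger0_norm// ler_wpM2l// codist_lip.
have mU := lebset_open oU.
have g01 k x : 0 <= g k x <= 1.
  by rewrite /g le_min ler01 mulr_ge0 ?codist_ge0//= ge_min lexx.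
have gU k x : ~ U x -> g k x = 0 by move=> Ux; rewrite /g codist_out// mulr0; apply/min_idPr.
have [|||||k hk] := @lebnorm_dominated _ _ p p1 (fun k x => \1_U x - g k x) \1_D _ _ _ _ _ e e0.
- by move=> k; apply: lebmeasB; [exact: lebmeas_indic|exact: lebmeas_lip].
- exact/lebmeas_indic/lebset_open.
- move=> x; have [Ux|Ux] := pselect (U x); last first.
    rewrite (_ : (fun k => _) = fun=> 0); first exact: cvg_cst.
    by apply/funext => k; rewrite gU// indicE memNset// subrr.
  apply: cvg_near_cst; rewrite indicE mem_set//.
  have c0 := codist_gt0 oU Ux.
  near=> k; rewrite /g; apply/eqP; rewrite subr_eq0 eq_sym; apply/eqP/min_idPl.
  rewrite -ler_pdivrMr// div1r; apply/ltW; near: k; exact: nbhs_infty_gtr.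
- move=> k x; rewrite !indicE.
  have [Ux|Ux] := pselect (U x).
    rewrite (mem_set Ux) (mem_set (UD _ Ux)); have /andP[? ?] := g01 k x.
    by rewrite /= ler_norml; apply/andP; split; lra.
  by rewrite gU// (memNset Ux) subrr normr0.
- by apply: lebnorm_indic_bounded => //; exact: lebset_open.
by exists (g k); split => // x Dx; apply: gU => /UD.
Unshelve. all: end_near. Qed.

(** Outer regularity inside [D] replaces [A] by an open set up to a set of measure at most e^p,
    whose indicator has norm at most [e]. *)
Lemma lip_approx_set A : lebset A -> A `<=` D ->
  lip_approx \1_A.
Proof.
move=> mA AD; apply: lip_approx_lim; first exact: lebmeas_indic.
move=> e e0; have ep : 0 < e `^ p by rewrite powR_gt0.
have [V [oV AV VD VA]] := lebesgue_open_approx ep oD bD AD mA.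
have mV := lebset_open oV.
exists \1_V; split; [exact: lebmeas_indic|exact: lip_approx_open|].
apply: (@le_trans _ _ ('N[\1_(V `\` A)])).
  apply: le_lebnorm => //.
  - by apply: lebmeasB; exact: lebmeas_indic.
  - by apply: lebmeas_indic; exact: lebsetD.
  move=> x; rewrite !indicE in_setD.
  have [Ax|Ax] := boolP (x \in A); first by rewrite (mem_set (AV _ (set_mem Ax))) subrr normr0.
  by rewrite /= andbT sub0r normrN.
apply: (lebnorm_indic_le p1); [exact: ltW|exact: lebsetD|exact: VA].
Qed.

Lemma lip_approx_sum (I : Type) (s : seq I) (F : I -> 'rV[R]_n -> R) :
  (forall i, lebmeas (F i)) -> (forall i, lip_approx (F i)) ->
  lip_approx (fun x => \sum_(i <- s) F i x).
Proof.
move=> mF hF; elim: s => [|i s ih].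
  by under eq_fun do rewrite big_nil; exact: lip_approx0.
under eq_fun do rewrite big_cons; apply: lip_approx_add => //.
exact: lebmeas_sum.
Qed.

Lemma lip_approx_nnsfun (f : {nnsfun (lebesgue_space R n) >-> R}) :
  (forall x, ~ D x -> f x = 0) -> lip_approx (f : 'rV[R]_n -> R).
Proof.
move=> f0; rewrite (_ : (f : 'rV[R]_n -> R) = fun x =>
  \sum_(c <- fset_set (range f)) (c * \1_(f @^-1` [set c]) x)); last first.
  by apply/funext => x; rewrite -fsbig_finite//; exact: fimfunE.
have mf c : lebset (f @^-1` [set c]).
  by rewrite /lebset -[X in measurable X]setTI; exact: measurable_funP.
apply: lip_approx_sum => c.
  by apply: lebmeasM; [exact: lebmeas_cst|exact: lebmeas_indic].
(* The level set of 0 need not lie in [D], but its term vanishes; every other level set lies in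
   [D]. *)
have [->|c0] := eqVneq c 0.
  by under eq_fun do rewrite mul0r; exact: lip_approx0.
apply: lip_approx_scale; first exact: lebmeas_indic.
apply: lip_approx_set => // x /= fxc; apply: contrapT => Dx.
by move: c0; rewrite -fxc f0// eqxx.
Qed.

(** Simple functions converge to [f] from below: the errors are dominated by [f], and the simple
    functions vanish wherever [f] does. *)
Lemma lip_approx_nonneg f : lebmeas f -> (forall x, 0 <= f x) ->
  (forall x, ~ D x -> f x = 0) -> ('N[f] < +oo)%E -> lip_approx f.
Proof.
move=> mf f0 fD fi; apply: lip_approx_lim => // e e0.
have mf' : measurable_fun [set: lebesgue_space R n] (EFin \o f) by exact/measurable_EFinP.
have f0' (x : lebesgue_space R n) : [set: lebesgue_space R n] x -> (0 <= (EFin \o f) x)%E.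
  by move=> _; rewrite lee_fin.
pose g := nnsfun_approx measurableT mf'.
have gf k x : 0 <= g k x <= f x.
  apply/andP; split; first exact: fun_ge0.
  by rewrite -lee_fin /g nnsfun_approxE; apply: le_approx.
have [|||||k hk] := @lebnorm_dominated _ _ p p1 (fun k x => f x - g k x) f _ _ _ _ _ e e0 => //.
- move=> k; apply: lebmeasB => //; exact: (measurable_funP (g k)).
- move=> x; have /fine_cvgP[_ /= h] := cvg_nnsfun_approx measurableT mf' f0' (I : setT x).
  by rewrite -[X in _ --> X](subrr (f x)); apply: cvgB; [exact: cvg_cst|exact: h].
- by move=> k x; have /andP[? ?] := gf k x; rewrite ger0_norm ?subr_ge0// gerBl.
exists (g k); split => //; first exact: (measurable_funP (g k)).
apply: lip_approx_nnsfun => x /fD fx0.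
by apply/eqP; rewrite eq_le; have := gf k x; rewrite fx0 andbC.
Qed.

Lemma lip_dense f : lebmeas f -> (forall x, ~ D x -> f x = 0) ->
  ('N[f] < +oo)%E -> lip_approx f.
Proof.
move=> mf f0 fi.
pose fp x := Num.max (f x) 0; pose fn x := Num.max (- f x) 0.
have mfp : lebmeas fp by exact: lebmeas_max0.
have mfn : lebmeas fn by apply: lebmeas_max0; exact: lebmeasN.
have fpf x : `|fp x| <= `|f x|.
  by rewrite ger0_norm ?le_max ?lexx ?orbT// ge_max ler_norm normr_ge0.
have fnf x : `|fn x| <= `|f x|.
  by rewrite ger0_norm ?le_max ?lexx ?orbT// ge_max normr_ge0 -normrN ler_norm.
rewrite (_ : f = fun x => fp x + (-1) * fn x); last first.
  apply/funext => x; rewrite /fp /fn maxEle (maxEle (- f x)).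
  by case: (leP (f x) 0) => ?; case: (leP (- f x) 0) => ?; lra.
apply: lip_approx_add => //.
- by apply: lebmeasM => //; exact: lebmeas_cst.
- apply: lip_approx_nonneg => //.
  + by move=> x; rewrite le_max lexx orbT.
  + by move=> x /f0 fx; rewrite /fp fx maxxx.
  + exact: le_lt_trans (le_lebnorm p1 mfp mf fpf) fi.
- apply: lip_approx_scale => //; apply: lip_approx_nonneg => //.
  + by move=> x; rewrite le_max lexx orbT.
  + by move=> x /f0 fx; rewrite /fn fx oppr0 maxxx.
  + exact: le_lt_trans (le_lebnorm p1 mfn mf fnf) fi.
Qed.

End lip_density.

(** * Measurability and Fubini for functions of two points *)

Section lebesgue_fubini.
Context (R : realType) (n : nat).
Implicit Types (f g : 'rV[R]_n -> R) (F G : 'rV[R]_n * 'rV[R]_n -> R).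
Local Notation leb := (@lebesgue_rV R n).
Local Notation Rn := (lebesgue_space R n).

Definition lebmeas2 F : Prop := measurable_fun [set: Rn * Rn] F.

Lemma lebmeas2M F G : lebmeas2 F -> lebmeas2 G -> lebmeas2 (fun z => F z * G z).
Proof. exact: measurable_funM. Qed.

Lemma lebmeas2_fst f : lebmeas f -> lebmeas2 (fun z => f z.1).
Proof. by move=> mf; exact: (measurableT_comp mf (@measurable_fst _ _ Rn Rn)). Qed.

Lemma lebmeas2_snd f : lebmeas f -> lebmeas2 (fun z => f z.2).
Proof. by move=> mf; exact: (measurableT_comp mf (@measurable_snd _ _ Rn Rn)). Qed.

Lemma lebmeas2_comp (m : 'rV[R]_n * 'rV[R]_n -> 'rV[R]_n) f :
  (forall i, lebmeas2 (fun z => m z 0 i)) -> continuous f -> lebmeas2 (f \o m).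
Proof.
by move=> mm cf; exact: (@measurable_continuous_comp _ _ _ (Rn * Rn)%type m f mm cf).
Qed.

Lemma lebmeas2_sub12 f : continuous f -> lebmeas2 (fun z => f (z.1 - z.2)).
Proof.
apply: (@lebmeas2_comp (fun z => z.1 - z.2)) => i; rewrite /lebmeas2.
under eq_fun do rewrite !mxE.
exact: (measurable_funB (lebmeas2_fst (@measurable_coord R n i))
  (lebmeas2_snd (@measurable_coord R n i))).
Qed.

Lemma lebmeas2_sub21 f : continuous f -> lebmeas2 (fun z => f (z.2 - z.1)).
Proof.
apply: (@lebmeas2_comp (fun z => z.2 - z.1)) => i; rewrite /lebmeas2.
under eq_fun do rewrite !mxE.
exact: (measurable_funB (lebmeas2_snd (@measurable_coord R n i))
  (lebmeas2_fst (@measurable_coord R n i))).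
Qed.

Lemma lebesgue_tonelli F : lebmeas2 F -> (forall z, 0 <= F z) ->
  (\int[leb]_x \int[leb]_y (F (x, y))%:E = \int[leb]_y \int[leb]_x (F (x, y))%:E)%E.
Proof.
move=> mF F0.
have mF' : measurable_fun [set: Rn * Rn] (EFin \o F) by exact/measurable_EFinP.
have F0' z : (0 <= (EFin \o F) z)%E by rewrite lee_fin.
exact: (sigma_finite_tonelli (@sigma_finite_lebesgue_rV R n) (@sigma_finite_lebesgue_rV R n) mF' F0').
Qed.

Lemma measurable_lebesgue_tonelli F : lebmeas2 F -> (forall z, 0 <= F z) ->
  measurable_fun [set: Rn] (fun x => \int[leb]_y (F (x, y))%:E)%E.
Proof.
move=> mF F0.
have mF' : measurable_fun [set: Rn * Rn] (EFin \o F) by exact/measurable_EFinP.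
have F0' z : (0 <= (EFin \o F) z)%E by rewrite lee_fin.
exact: (measurable_tonelli (@sigma_finite_lebesgue_rV R n) mF' F0').
Qed.

Lemma lebesgue_fubini F (a b : 'rV[R]_n -> R) : lebmeas2 F -> lebint a -> lebint b ->
  (forall x y, `|F (x, y)| <= a x * b y) ->
  \int[leb]_x \int[leb]_y F (x, y) = \int[leb]_y \int[leb]_x F (x, y).
Proof.
exact: (Rintegral_fubini (@sigma_finite_lebesgue_rV R n) (@sigma_finite_lebesgue_rV R n)).
Qed.

Lemma lebint_section F (a b : 'rV[R]_n -> R) : lebmeas2 F -> lebint a -> lebint b ->
  (forall x y, `|F (x, y)| <= a x * b y) -> lebint (fun x => \int[leb]_y F (x, y)).
Proof.
exact: (integrable_Rintegral_section (@sigma_finite_lebesgue_rV R n) (@sigma_finite_lebesgue_rV R n)).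
Qed.

End lebesgue_fubini.

(** * Mollification by a Lipschitz kernel *)

Section mollification.
Context (R : realType) (n : nat).
Implicit Types (f g V : 'rV[R]_n -> R) (x y z : 'rV[R]_n).
Local Notation leb := (@lebesgue_rV R n).
Variables (K : 'rV[R]_n -> R) (rho : R).
Hypotheses (lipK : lip K) (K01 : forall z, 0 <= K z <= 1)
  (Kout : forall z, rho <= `|z| -> K z = 0).
Let c := \int[leb]_z K z.
Hypothesis c_gt0 : 0 < c.

Let K0 z : 0 <= K z. Proof. by have /andP[] := K01 z. Qed.
Let K1 z : K z <= 1. Proof. by have /andP[] := K01 z. Qed.
Let cK : continuous K. Proof. exact: lip_continuous. Qed.
Let mK : lebmeas K. Proof. exact: lebmeas_continuous. Qed.
Let nK z : `|K z| <= 1. Proof. by rewrite ger0_norm. Qed.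
Let cV0 : 0 <= c^-1. Proof. by rewrite invr_ge0 ltW. Qed.

Lemma lebint_kernel : lebint K.
Proof. exact: lebint_bounded_support mK nK Kout. Qed.

Lemma Rintegral_kernel_left x : \int[leb]_y K (y - x) = c.
Proof. exact: (Rintegral_leb_shift x lebint_kernel). Qed.

Lemma Rintegral_kernel_right y : \int[leb]_x K (y - x) = c.
Proof. exact: (Rintegral_leb_reflect y lebint_kernel). Qed.

Lemma lebint_kernel_left x : lebint (fun y => K (y - x)).
Proof.
apply: (@lebint_bounded_support _ _ _ 1 (rho + `|x|)) => // [|y h].
  exact: lebmeas_shift.
apply: Kout; rewrite -(lerD2r `|x|) (le_trans h)//.
by rewrite -[leRHS]addrC -{1}(addrNK x y) addrC ler_normD.
Qed.

Lemma lebint_kernel_mul V x : lebint V -> lebint (fun y => V y * K (y - x)).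
Proof.
move=> iV; apply: (@lebint_le _ _ _ (fun y => `|V y|)).
- by apply: lebmeasM; [exact: lebint_meas|exact: lebmeas_shift].
- by move=> y; rewrite normrM ler_piMr.
exact: lebint_norm.
Qed.

(** A correlation rather than a convolution: the value at [x] averages [V] over the points x + s
    with weight [K s]. A kernel supported in a cone thus looks from [x] in the directions of that
    cone. *)
Definition mollify V x := c^-1 * \int[leb]_y (V y * K (y - x)).

Lemma mollify_sub f g x : lebint f -> lebint g ->
  mollify (fun y => f y - g y) x = mollify f x - mollify g x.
Proof.
move=> fi gi; rewrite /mollify -mulrBr; congr (_ * _).
under eq_Rintegral do rewrite mulrBl.
by apply: Rintegral_lebB; exact: lebint_kernel_mul.
Qed.

(** An almost everywhere bound becomes a bound at every point, since an average ignores null sets.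
    This is what gives the bound a meaning on the boundary. *)
Lemma mollify_le f (M : R) x : 0 <= M -> lebint f -> {ae leb, forall y, `|f y| <= M} ->
  `|mollify f x| <= M.
Proof.
move=> M0 fi fM; rewrite /mollify normrM ger0_norm// ler_pdivrMl//.
have ik := lebint_kernel_mul x fi; have iKx := lebint_kernel_left x.
apply: (le_trans (lebint_norm_le ik)).
rewrite -(Rintegral_kernel_left x) mulrC -Rintegral_lebZ//.
apply: fine_le.
- exact: lebint_fin_num (lebint_norm ik).
- exact: lebint_fin_num (lebintZ M iKx).
apply: ae_ge0_le_integral.
- exact: measurableT.
- by move=> y _; rewrite lee_fin.
- by apply/measurable_EFinP; exact: (lebint_meas (lebint_norm ik)).
- by move=> y _; rewrite lee_fin mulr_ge0.
- by apply/measurable_EFinP; exact: (lebint_meas (lebintZ M iKx)).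
apply: (ae_mono (mu := leb) _ fM) => y yM _.
by rewrite lee_fin normrM (ger0_norm (K0 _)) ler_wpM2r.
Qed.

(** All regularity comes from [K]: its Lipschitz constant is multiplied by the L^1 norm of [f] over
    the total mass [c]. *)
Lemma mollify_lip f : lebint f -> lip (mollify f).
Proof.
move=> fi; have [k k0 Kk] := lipK; have fi' := lebint_norm fi.
exists (c^-1 * (k * \int[leb]_y `|f y|)).
  by rewrite mulr_ge0// mulr_ge0// Rintegral_ge0.
move=> x y; rewrite /mollify -mulrBr normrM ger0_norm//.
rewrite -mulrA ler_wpM2l//.
have ix := lebint_kernel_mul x fi; have iy := lebint_kernel_mul y fi.
rewrite -Rintegral_lebB// (le_trans (lebint_norm_le (lebintB ix iy)))//.
rewrite mulrAC -Rintegral_lebZ//; apply: lebint_mono.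
- exact: lebint_norm (lebintB ix iy).
- exact: lebintZ.
move=> z; rewrite -mulrBr normrM mulrC ler_wpM2r// (le_trans (Kk _ _))//.
by have -> : z - x - (z - y) = y - x; [rewrite opprB addrC subrKA|rewrite distrC].
Qed.

Lemma lebmeas_mollify f : lebint f -> lebmeas (mollify f).
Proof. by move=> /mollify_lip; exact: lebmeas_lip. Qed.

(** Only points within [rho] of [x] carry weight, and there [g] differs from [g x] by at most k
    rho. *)
Lemma mollify_near g (k : R) x : lebint g -> 0 <= k ->
  (forall y z, `|g y - g z| <= k * `|y - z|) -> `|mollify g x - g x| <= k * rho.
Proof.
move=> gi k0 gk; have ik := lebint_kernel_mul x gi; have iKx := lebint_kernel_left x.
have -> : g x = c^-1 * \int[leb]_y (g x * K (y - x)).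
  by rewrite Rintegral_lebZ// Rintegral_kernel_left mulrCA mulVf ?mulr1// gt_eqF.
rewrite /mollify -mulrBr normrM ger0_norm// ler_pdivrMl//.
have iB := lebintB ik (lebintZ (g x) iKx).
rewrite -Rintegral_lebB//; last exact: lebintZ.
apply: (le_trans (lebint_norm_le iB)).
rewrite -(Rintegral_kernel_left x) mulrC -Rintegral_lebZ//; apply: lebint_mono.
- exact: lebint_norm.
- exact: lebintZ.
move=> y; rewrite -mulrBl normrM (ger0_norm (K0 _)).
have [yx|xy] := ltP `|y - x| rho; last by rewrite Kout// !mulr0.
by rewrite ler_wpM2r// (le_trans (gk _ _))// ler_wpM2l// ltW.
Qed.

(* Hoelder for the splitting K = K^(1/p) K^(1/q).                               *)
Lemma mollify_powR_le (p : R) V x : 1 < p -> lebint V ->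
  ((`|mollify V x| `^ p)%:E <= (c^-1)%:E * \int[leb]_y (`|V y| `^ p * K (y - x))%:E)%E.
Proof.
move=> p1 iV; have p0 : 0 < p by exact: lt_trans p1.
have mV := lebint_meas iV; have iKx := lebint_kernel_left x.
have mKx := lebint_meas iKx.
pose q := (1 - p^-1)^-1.
have pq : p^-1 + q^-1 = 1 by rewrite /q invrK addrCA subrr addr0.
have q0 : 0 < q by rewrite invr_gt0 subr_gt0 invf_lt1.
pose a y := `|V y| * K (y - x) `^ p^-1; pose b y := K (y - x) `^ q^-1.
have ma : lebmeas a by apply: lebmeasM; [exact: lebmeas_norm|exact: lebmeas_powR].
have mb : lebmeas b by exact: lebmeas_powR.
have KpV (r z : R) : 0 < r -> 0 <= z -> (z `^ r^-1) `^ r = z.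
  by move=> r0 z0; rewrite -powRrM mulVf ?gt_eqF// powRr1.
set J := (\int[leb]_y (`|V y| `^ p * K (y - x))%:E)%E.
have J0 : (0 <= J)%E by apply: integral_ge0 => y _; rewrite lee_fin mulr_ge0// powR_ge0.
have Na : (Lnorm leb p%:E (EFin \o a) `^ p)%E = J.
  rewrite Lnorm_powR//; apply: eq_integral => y _; congr EFin.
  by rewrite ger0_norm ?mulr_ge0 ?powR_ge0// powRM ?powR_ge0// KpV.
have Nb : Lnorm leb q%:E (EFin \o b) = (c `^ q^-1)%:E.
  rewrite unlock -poweR_EFin; congr (_ `^ _)%E.
  rewrite -(Rintegral_kernel_left x) /Rintegral fineK; last exact: lebint_fin_num.
  by apply: eq_integral => y _ /=; rewrite ger0_norm ?powR_ge0// KpV.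
have Nab : Lnorm leb 1%:E (EFin \o (a \* b)%R) = (\int[leb]_y `|V y * K (y - x)|)%:E.
  rewrite Lnorm1 /Rintegral fineK; last exact: lebint_fin_num (lebint_norm (lebint_kernel_mul x iV)).
  apply: eq_integral => y _ /=; congr EFin.
  rewrite /a /b -mulrA -powRD ?pq ?powRr1// ?oner_eq0//.
  by rewrite !normrM normr_id.
have := hoelder leb ma mb p0 q0 pq; rewrite Nab Nb => H.
have I0 : 0 <= \int[leb]_y `|V y * K (y - x)| by exact: Rintegral_ge0.
have {}H : (((\int[leb]_y `|V y * K (y - x)|) `^ p)%:E <= J * (c `^ (p / q))%:E)%E.
  have key (N : \bar R) (I s : R) : (0 <= N)%E -> 0 <= I -> 0 <= s ->
      (I%:E <= N * s%:E)%E -> ((I `^ p)%:E <= N `^ p * (s `^ p)%:E)%E.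
    move=> N0 I0' s0 IN; rewrite -!poweR_EFin -poweRM//.
    by apply: ge0_le_poweR => //; exact: ltW.
  rewrite -Na mulrC powRrM.
  by apply: key => //; [exact: Lnorm_ge0|exact: powR_ge0].
have c0 : 0 <= c by exact: ltW.
apply: (@le_trans _ _ ((c^-1 `^ p)%:E * (J * (c `^ (p / q))%:E))%E).
  apply: le_trans (lee_wpmul2l _ H); last by rewrite lee_fin powR_ge0.
  rewrite -EFinM lee_fin -powRM// ge0_ler_powR ?(ltW p0)// ?nnegrE ?mulr_ge0//.
  rewrite /mollify normrM ger0_norm// ler_wpM2l//.
  exact: lebint_norm_le (lebint_kernel_mul x iV).
have -> : c^-1 = c `^ (-1) by rewrite powR_inv1.
(* The powers of [c] combine to the exponent -p + p/q = -1. *)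
have pq1 : p / q = p - 1 by rewrite /q invrK mulrBr mulr1 mulfV ?gt_eqF.
rewrite muleCA muleC -EFinM -powRrM -powRD; last first.
  by rewrite pq1 mulN1r addrA addNr add0r oppr_eq0 oner_eq0.
by rewrite pq1 mulN1r addrA addNr add0r.
Qed.

(** Young's inequality with constant 1: the pointwise Hoelder bound is integrated in [x], Tonelli
    exchanges the integrals, and the mass [c] of the kernel cancels the factor 1/c. *)
Lemma lebnorm_mollify (p : R) V : 1 < p -> lebint V ->
  (lebnorm p (mollify V) <= lebnorm p V)%E.
Proof.
move=> p1 iV; have p0 : 0 < p by exact: lt_trans p1.
have mV := lebint_meas iV.
pose F (z : 'rV[R]_n * 'rV[R]_n) := `|V z.2| `^ p * K (z.2 - z.1).
have mF : lebmeas2 F.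
  apply: lebmeas2M; last exact: lebmeas2_sub21.
  by apply: (lebmeas2_snd (f := fun y => `|V y| `^ p)); apply: lebmeas_powR; exact: lebmeas_norm.
have F0 w : 0 <= F w by rewrite mulr_ge0// powR_ge0.
rewrite /lebnorm !LnormE; apply: ge0_le_poweR; first by rewrite invr_ge0 ltW.
  by apply: integral_ge0 => x _; rewrite lee_fin powR_ge0.
apply: (@le_trans _ _ (\int[leb]_x ((c^-1)%:E * \int[leb]_y (F (x, y))%:E))%E).
  apply: ge0_le_integral.
  - exact: measurableT.
  - by move=> x _; rewrite lee_fin powR_ge0.
  - apply/measurable_EFinP.
    by apply: lebmeas_powR; apply: lebmeas_norm; exact: lebmeas_mollify.
  - by apply: measurable_funeM; exact: measurable_lebesgue_tonelli.
  by move=> x _; exact: mollify_powR_le.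
rewrite (ge0_integral_lebZ cV0 (measurable_lebesgue_tonelli mF F0)); last first.
  by move=> x; apply: integral_ge0 => y _; rewrite lee_fin.
rewrite (lebesgue_tonelli mF F0).
have mVp : measurable_fun [set: lebesgue_space R n] (fun y => (`|V y| `^ p)%:E).
  by apply/measurable_EFinP; apply: lebmeas_powR; exact: lebmeas_norm.
have Vp0 y : (0 <= (`|V y| `^ p)%:E)%E by rewrite lee_fin powR_ge0.
rewrite (@eq_integral_leb _ _ _ (fun y => (c%:E * (`|V y| `^ p)%:E)%E)); last first.
  move=> y; rewrite /F /= (@eq_integral_leb _ _ _ (fun x => ((`|V y| `^ p)%:E * (K (y - x))%:E)%E))//.
  have mKy : measurable_fun [set: lebesgue_space R n] (fun x => (K (y - x))%:E).
    by apply/measurable_EFinP; exact: (measurable_reflect_comp y mK).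
  have Ky0 x : (0 <= (K (y - x))%:E)%E by rewrite lee_fin.
  rewrite (ge0_integral_lebZ (powR_ge0 _ _) mKy Ky0).
  rewrite muleC -(Rintegral_kernel_right y) /Rintegral fineK//.
  by rewrite (integral_reflect y lebint_kernel); exact: lebint_fin_num lebint_kernel.
rewrite (ge0_integral_lebZ (ltW c_gt0) mVp Vp0).
by rewrite muleA -EFinM mulVf ?gt_eqF// mul1e.
Qed.

(** Fubini and the substitution s = y - x move the averaging from [V] to the test function: the
    average is tested by testing [V] against the translates of [psi]. *)
Lemma mollify_dual V (psi : 'rV[R]_n -> R) (B M : R) : lebint V ->
  continuous psi -> (forall x, `|psi x| <= B) -> (forall x, M <= `|x| -> psi x = 0) ->
  \int[leb]_x (mollify V x * psi x) =
  c^-1 * \int[leb]_s (K s * \int[leb]_y (V y * psi (y - s))).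
Proof.
move=> iV cpsi psiB psiM; have mV := lebint_meas iV.
have mpsi : lebmeas psi by exact: lebmeas_continuous.
have ipsi : lebint psi by exact: lebint_bounded_support psiB psiM.
have B0 : 0 <= B by rewrite (le_trans _ (psiB 0)).
have iVpsi s : lebint (fun y => V y * psi (y - s)).
  apply: (@lebint_le _ _ _ (fun y => B * `|V y|)).
  - by apply: lebmeasM => //; exact: lebmeas_shift.
  - by move=> y; rewrite normrM mulrC ler_wpM2r.
  by apply: lebintZ; exact: lebint_norm.
have imp : lebint (fun x => mollify V x * psi x).
  apply: (@lebint_le _ _ _ (fun x => (c^-1 * \int[leb]_y `|V y|) * `|psi x|)).
  - by apply: lebmeasM => //; exact: lebmeas_mollify.
  - move=> x; rewrite normrM ler_wpM2r// /mollify normrM ger0_norm// ler_wpM2l//.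
    have iK := lebint_kernel_mul x iV; apply: (le_trans (lebint_norm_le iK)).
    apply: lebint_mono => //; [exact: lebint_norm|exact: lebint_norm|].
    by move=> y; rewrite normrM ler_piMr.
  by apply: lebintZ; exact: lebint_norm.
pose F (w : 'rV[R]_n * 'rV[R]_n) := V w.2 * K (w.2 - w.1) * psi w.1.
pose G (w : 'rV[R]_n * 'rV[R]_n) := V w.1 * K w.2 * psi (w.1 - w.2).
transitivity (c^-1 * \int[leb]_x \int[leb]_y F (x, y)).
  rewrite [in RHS](@eq_Rintegral_leb _ _ _ (fun x => c * (mollify V x * psi x))).
    by rewrite Rintegral_lebZ// mulrA mulVf ?mul1r// gt_eqF.
  move=> x; rewrite /mollify !mulrA mulfV ?gt_eqF// mul1r.
  rewrite mulrC -Rintegral_lebZ; last exact: lebint_kernel_mul.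
  by apply: eq_Rintegral_leb => y; rewrite mulrC.
congr (_ * _); rewrite (lebesgue_fubini (a := fun x => `|psi x|) (b := fun y => `|V y|)); first last.
- by move=> x y; rewrite /F /= !normrM mulrC ler_wpM2l// ler_piMr.
- exact: lebint_norm.
- exact: lebint_norm.
- apply: lebmeas2M; last exact: lebmeas2_fst.
  by apply: lebmeas2M; [exact: lebmeas2_snd|exact: lebmeas2_sub21].
(* For fixed [y] the inner integral is reflected by x = y - s. *)
transitivity (\int[leb]_y \int[leb]_s G (y, s)).
  apply: eq_Rintegral => y _.
  rewrite -(Rintegral_leb_reflect y (f := fun x => F (x, y))).
    by apply: eq_Rintegral => s _; rewrite /F /G /= subKr.
  apply: (@lebint_le _ _ _ (fun x => `|V y| * `|psi x|)).
  - rewrite /F /=; apply: lebmeasM => //.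
    by apply: lebmeasM; [exact: lebmeas_cst|exact: measurable_reflect_comp].
  - by move=> x; rewrite /F /= !normrM ler_wpM2r// ler_piMr.
  by apply: lebintZ; exact: lebint_norm.
rewrite (lebesgue_fubini (a := fun y => `|V y|) (b := fun s => B * K s)); first last.
- move=> y s; rewrite /G /= !normrM -mulrA ler_wpM2l// (ger0_norm (K0 _)) mulrC.
  by rewrite ler_wpM2r.
- by apply: lebintZ; exact: lebint_kernel.
- exact: lebint_norm.
- apply: lebmeas2M; last exact: lebmeas2_sub12.
  by apply: lebmeas2M; [exact: lebmeas2_fst|exact: lebmeas2_snd].
apply: eq_Rintegral => s _; rewrite -Rintegral_lebZ//.
by apply: eq_Rintegral => y _; rewrite /G /= mulrAC mulrC.
Qed.

End mollification.

Section mollify_convergence.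
Context (R : realType) (n : nat).
Local Notation leb := (@lebesgue_rV R n).

Lemma patch_indic (f : 'rV[R]_n -> R) (D : set 'rV[R]_n) :
  f \_ D = fun x => f x * \1_D x.
Proof.
by apply/funext => x; rewrite patchE indicE; case: ifPn; rewrite ?mulr1 ?mulr0.
Qed.

Lemma lebmeas_restrict (f : 'rV[R]_n -> R) (D : set 'rV[R]_n) : lebset D ->
  lebmeas f -> lebmeas (f \_ D).
Proof.
by move=> mD mf; rewrite patch_indic; apply: lebmeasM => //; exact: lebmeas_indic.
Qed.

(** With a Lipschitz [g] close to [f], the error splits into f - g, its average (no larger in norm),
    and g minus its average, which is small where the kernel is short. The threshold [delta] depends
    only on the reach of the kernel, so one kernel later serves a function and all its derivatives,
    and it may be off-centre. *)
Lemma mollify_cvg (p : R) (D : set 'rV[R]_n) (f : 'rV[R]_n -> R) : 1 < p ->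
  open D -> bounded_set D -> lebmeas f -> (forall x, ~ D x -> f x = 0) ->
  (lebnorm p f < +oo)%E ->
  forall e : R, 0 < e -> exists2 delta, 0 < delta &
    forall (K : 'rV[R]_n -> R) (rho : R), lip K -> (forall z, 0 <= K z <= 1) ->
      (forall z, rho <= `|z| -> K z = 0) -> 0 < \int[leb]_z K z -> 0 <= rho <= delta ->
      (lebnorm p ((fun x => f x - mollify K f x)%R \_ D) <= e%:E)%E.
Proof.
move=> p1 oD bD mf f0 fp e e0; have e30 : 0 < e / 3 by rewrite divr_gt0.
have mD := lebset_open oD.
have [g [[k k0 gk] g0 fg]] := lip_dense p1 oD bD mf f0 fp e30.
have mg : lebmeas g by apply: lebmeas_lip; exists k.
have mfg := lebmeasB mf mg.
have gp : (lebnorm p g < +oo)%E.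
  rewrite (_ : g = fun x => f x - (f x - g x)); last by apply/funext => x; rewrite subKr.
  apply: (le_lt_trans (lebnormB p1 mf mfg)).
  by rewrite lte_add_pinfty// (le_lt_trans fg)// ltry.
have fi := lebint_lebnorm p1 mD bD mf f0 fp.
have gi := lebint_lebnorm p1 mD bD mg g0 gp.
have fgi := lebintB fi gi.
have ND := lebnorm_indic_bounded p1 mD bD.
have NDf : lebnorm p (\1_D : 'rV[R]_n -> R) \is a fin_num by rewrite ge0_fin_numE// lebnorm_ge0.
pose a := fine (lebnorm p (\1_D : 'rV[R]_n -> R)).
have a0 : 0 <= a by rewrite fine_ge0// lebnorm_ge0.
have ka0 : 0 < k * a + 1 by rewrite ltr_wpDl// mulr_ge0.
(* The last error is at most k rho on [D], of norm at most k rho a; the added 1 keeps the quotient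
   meaningful when k a = 0. *)
exists (e / 3 / (k * a + 1)); first by rewrite divr_gt0.
move=> K rho lK K01 Kout c0 /andP[rho0 rhod].
have mm := lebmeas_mollify lK K01 c0.
pose h1 x := f x - g x; pose h2 := mollify K h1; pose h3 x := (k * rho) * \1_D x.
pose h4 := (fun x => g x - mollify K g x) \_ D.
have m2 : lebmeas h2 by exact: mm.
have m4 : lebmeas h4 := lebmeas_restrict mD (lebmeasB mg (mm _ gi)).
have m24 : lebmeas (fun x => h2 x - h4 x) by exact: lebmeasB.
(* The two functions agree on [D], and off [D] the left one is 0. *)
apply: (@le_trans _ _ (lebnorm p (fun x => h1 x - (h2 x - h4 x)))).
  apply: (le_lebnorm p1 (lebmeas_restrict mD (lebmeasB mf (mm _ fi))) (lebmeasB mfg m24)).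
  move=> x; rewrite /h4 !patchE; case: ifPn => xD; last by rewrite normr0.
  rewrite /h2 (mollify_sub lK K01 x fi gi) /h1.
  rewrite le_eqVlt; apply/orP; left; apply/eqP; congr (`|_|); ring.
apply: (le_trans (lebnormB p1 mfg m24)).
rewrite (_ : e = e / 3 + (e / 3 + e / 3)); last by field.
rewrite !EFinD; apply: leeD => //.
apply: (le_trans (lebnormB p1 m2 m4)); apply: leeD.
  exact: le_trans (lebnorm_mollify lK K01 Kout c0 p1 fgi) fg.
have m3 : lebmeas h3 by apply: lebmeasM; [exact: lebmeas_cst|exact: lebmeas_indic].
apply: (@le_trans _ _ (lebnorm p h3)).
  apply: le_lebnorm => // x; rewrite /h4 /h3 patchE indicE.
  case: ifPn => xD; last by rewrite normr0.
  rewrite mulr1 [leRHS]ger0_norm ?mulr_ge0// distrC.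
  exact: (mollify_near lK K01 Kout c0 x gi k0 gk).
rewrite lebnormZ//; last exact: lebmeas_indic.
rewrite -(fineK NDf) -EFinM lee_fin ger0_norm ?mulr_ge0// -/a.
rewrite mulrAC (le_trans (ler_wpM2l _ rhod)) ?mulr_ge0//.
by rewrite mulrCA ler_piMr ?(ltW e30)// ler_pdivrMr// mul1r lerDl.
Qed.

End mollify_convergence.

(** * Smooth functions *)

Section flat_function.
Context (R : realType).

(* Allowing the factor t^-k makes the family of exp(-1/t) closed under          *)
(* differentiation.                                                             *)
Definition flat (k : nat) (t : R) : R :=
  if 0 < t then expR (- t^-1) * t^-1 ^+ k else 0.

Lemma flat_ge0 k t : 0 <= flat k t.
Proof.
rewrite /flat; case: ifP => // t0.
by rewrite mulr_ge0 ?expR_ge0// exprn_ge0// invr_ge0 ltW.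
Qed.

Lemma flat_gt0 k t : 0 < t -> 0 < flat k t.
Proof. by move=> t0; rewrite /flat t0 mulr_gt0 ?expR_gt0// exprn_gt0// invr_gt0. Qed.

Lemma flat_out k t : t <= 0 -> flat k t = 0.
Proof. by move=> t0; rewrite /flat ltNge t0. Qed.

Lemma flat_div k t : t != 0 -> t^-1 * flat k t = flat k.+1 t.
Proof.
move=> t0; rewrite /flat; case: ifP => _; last by rewrite mulr0.
by rewrite exprS mulrCA.
Qed.

(** One term of the exponential series gives exp(s) >= s^(k+1)/(k+1)!, used at s = 1/t. *)
Lemma flat_le k t : `|flat k t| <= k.+1`!%:R * `|t|.
Proof.
rewrite ger0_norm ?flat_ge0//; have [t0|t0] := leP t 0.
  by rewrite flat_out// mulr_ge0.
rewrite /flat t0 (gtr0_norm t0) expRN.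
have s0 : 0 < t^-1 by rewrite invr_gt0.
have := expR_ge1Dxn k (ltW s0).
set E := expR _ => h.
have fact0 : 0 < k.+1`!%:R :> R by rewrite ltr0n fact_gt0.
have E0 : 0 < E by exact: expR_gt0.
rewrite mulrC ler_pdivrMr//.
have : t^-1 ^+ k.+1 / k.+1`!%:R <= E by apply: le_trans h; rewrite lerDr.
rewrite ler_pdivrMr// exprS => h2.
rewrite -(ler_pM2l s0) (le_trans h2)// mulrC mulrA [leRHS](_ : _ = t^-1 * t * (k.+1`!%:R * E)); last by ring.
by rewrite mulVf ?mul1r// gt_eqF.
Qed.

Lemma is_derive_flat (k : nat) (t : R) :
  is_derive t (1 : R) (flat k) (flat k.+2 t - k%:R * flat k.+1 t).
Proof.
have [t0|t0|->] := ltgtP t 0.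
- rewrite !flat_out ?(ltW t0)// mulr0 subr0.
  have h : {near t, cst 0 =1 flat k}.
    near=> s; rewrite /= flat_out//; apply: ltW; near: s; exact: lt_nbhsl.
  by apply: near_eq_is_derive h _; exact: is_derive_cst.
- pose g (s : R) := expR (- s^-1) * s^-1 ^+ k.
  have h : {near t, g =1 flat k}.
    near=> s; rewrite /flat ifT//; near: s; exact: lt_nbhsr.
  apply: near_eq_is_derive h _.
  have tn0 : t != 0 by rewrite gt_eqF.
  have dV : is_derive t (1 : R) (fun s : R => s^-1) (- t ^- 2).
    by have := is_deriveV tn0 (is_derive_id t (1 : R)); rewrite /= [_ *: 1]mulr1.
  have dN : is_derive t (1 : R) (fun s : R => - s^-1) (t ^- 2).
    by have := is_deriveN dV; rewrite opprK.
  have dE := @is_derive1_comp R expR (fun s => - s^-1) t _ _ (is_derive_expR (- t^-1)) dN.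
  have dX := is_deriveX k dV.
  have -> : g = (expR \o (fun s => - s^-1)) * ((fun s : R => s^-1) ^+ k).
    by apply/funext => s; rewrite /g mulrfctE exprfctE.
  apply: (is_derive_eq (is_deriveM dE dX)) => /=.
  rewrite /flat t0 exprfctE /GRing.scale /= -exprVn.
  by set E := expR _; set s := t^-1; case: (k) => [|m]; rewrite ?exprS /=; ring.
rewrite !flat_out// mulr0 subr0.
have h : (fun h : R => h^-1 *: ((flat k \o shift 0) (h *: 1) - flat k 0)) @ 0^' --> (0:R).
  apply/cvgrPdist_lt => e e0; near=> h.
  have h0 : h != 0 by near: h; exact: nbhs_dnbhs_neq.
  rewrite /= addr0 [h *: 1]mulr1 (flat_out _ (lexx 0)) subr0 sub0r normrN.
  (* The difference quotient at 0 is [flat k.+1 h], which [flat_le] bounds by a multiple of |h|. *)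
  rewrite [_ *: _](flat_div k h0) (le_lt_trans (flat_le _ _))//.
  rewrite -ltr_pdivlMl ?ltr0n ?fact_gt0//.
  by near: h; apply: dnbhs0_lt; rewrite mulr_gt0// invr_gt0 ltr0n fact_gt0.
split; first by apply/cvg_ex; exists 0.
exact: cvg_lim h.
Unshelve. all: end_near. Qed.

Lemma continuous_flat k : continuous (flat k).
Proof.
move=> t; have [? _] := is_derive_flat k t.
by apply: differentiable_continuous; exact/derivable1_diffP.
Qed.

End flat_function.

Section chain_rule.
Context (R : realType) (n : nat).

(** A directional derivative of [q] is an ordinary derivative along the line [h *: v + x], so the
    one-variable chain rule applies. *)
Lemma is_derive_comp_line (F : R -> R) (q : 'rV[R]_n -> R) (x v : 'rV[R]_n) (dF dq : R) :
  is_derive (q x) (1 : R) F dF -> is_derive x v q dq -> is_derive x v (F \o q) (dF * dq).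
Proof.
pose line (h : R) := h *: v + x.
have lineE (G : 'rV[R]_n -> R) :
    (fun h : R => h^-1 *: ((G \o shift x) (h *: v) - G x)) =
    (fun h : R => h^-1 *: (((G \o line) \o shift 0) (h *: 1) - (G \o line) 0)).
  apply/funext => h /=; rewrite /line scale0r add0r addr0.
  by rewrite [h *: 1](mulr1).
have is_derive_line (G : 'rV[R]_n -> R) d : is_derive x v G d <-> is_derive (0 : R) (1 : R) (G \o line) d.
  split=> -[hd he]; apply: DeriveDef.
  - by rewrite /derivable -lineE.
  - by rewrite /derive -lineE.
  - by rewrite /derivable lineE.
  - by rewrite /derive lineE.
move=> hF /is_derive_line hq; apply/is_derive_line.
have hF' : is_derive ((q \o line) 0) (1 : R) F dF by rewrite /= /line scale0r add0r.
rewrite -compA.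
exact: (is_derive1_comp hF' hq).
Qed.

Lemma is_derive_translate (f : 'rV[R]_n -> R) (s x v : 'rV[R]_n) d :
  is_derive (x - s) v f d -> is_derive x v (fun y => f (y - s)) d.
Proof.
have E : (fun h : R => h^-1 *: (((fun y => f (y - s)) \o shift x) (h *: v) - f (x - s))) =
    (fun h : R => h^-1 *: ((f \o shift (x - s)) (h *: v) - f (x - s))).
  by apply/funext => h /=; rewrite addrA.
by move=> [hd he]; apply: DeriveDef; rewrite /derivable /derive E.
Qed.

End chain_rule.

Section continuous_operations.
Context (R : realType) (T : topologicalType).
Implicit Types f g : T -> R.

Lemma fun_continuousD f g : continuous f -> continuous g -> continuous (fun x => f x + g x).
Proof. by move=> cf cg x; apply: cvgD; [exact: cf|exact: cg]. Qed.

Lemma fun_continuousM f g : continuous f -> continuous g -> continuous (fun x => f x * g x).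
Proof. by move=> cf cg x; apply: cvgM; [exact: cf|exact: cg]. Qed.

Lemma fun_continuousV f : (forall x, f x != 0) -> continuous f ->
  continuous (fun x => (f x)^-1).
Proof. by move=> f0 cf x; apply: cvgV; [exact: f0|exact: cf]. Qed.

Lemma fun_continuous_comp (F : R -> R) f : continuous F -> continuous f ->
  continuous (fun x => F (f x)).
Proof. by move=> cF cf x; apply: (@continuous_comp _ _ _ f F); [exact: cf|exact: cF]. Qed.

End continuous_operations.

Lemma continuous_sub_cst (R : realType) (V : normedModType R) (s : V) :
  continuous (fun x : V => x - s).
Proof. by move=> x; apply: cvgB; [exact: cvg_id|exact: cvg_cst]. Qed.

Lemma continuous_translate (R : realType) (V : normedModType R) (g : V -> R) (s : V) :
  continuous g -> continuous (fun x => g (x - s)).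
Proof.
move=> cg x; apply: (@continuous_comp _ _ _ (fun x => x - s) g); last exact: cg.
exact: continuous_sub_cst.
Qed.

Section smooth_functions.
Context (R : realType) (n : nat).
Implicit Types (f g : 'rV[R]_n -> R) (x s : 'rV[R]_n).
Local Notation "'e_ i" := (delta_mx 0 i : 'rV[R]_n) (at level 8, i at level 2, format "''e_' i").
Local Notation Ck := (@continuously_differentiable R n).

(** Lets the partial derivatives be given by formulas; the closure properties below then follow by
    induction on the order. *)
Lemma cdS_intro k f (df : 'I_n -> 'rV[R]_n -> R) :
  [/\ continuous f, forall i x, is_derive x 'e_i f (df i x) & forall i, Ck k (df i)] ->
  Ck k.+1 f.
Proof.
move=> [cf hdf cdf]; split => [//|i x|i]; first by have [] := hdf i x.
rewrite (_ : partial i f = df i)//; apply/funext => x.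
by have [_ <-] := hdf i x.
Qed.

Lemma cd_continuous k f : Ck k f -> continuous f.
Proof. by case: k => [//|k []]. Qed.

Lemma cd_is_derive k f i x : Ck k.+1 f -> is_derive x 'e_i f (partial i f x).
Proof. by move=> [_ df _]; exact: DeriveDef. Qed.

Lemma cdW k f : Ck k.+1 f -> Ck k f.
Proof.
elim: k f => [|k ih] f; first by case.
by move=> [cf df pf]; split => // i; exact: ih.
Qed.

Lemma cd_cst k (c : R) : Ck k (fun=> c).
Proof.
elim: k c => [|k ih] c; first exact: cst_continuous.
apply: (@cdS_intro k _ (fun _ _ => 0)); split => [|i x|i]; [exact: cd_continuous (ih c)|exact: is_derive_cst|exact: ih].
Qed.

Lemma cdD k f g : Ck k f -> Ck k g -> Ck k (fun x => f x + g x).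
Proof.
elim: k f g => [|k ih] f g cf cg; first exact: (fun_continuousD cf cg).
have cf0 := cd_continuous cf; have cg0 := cd_continuous cg.
apply: (@cdS_intro k _ (fun i x => partial i f x + partial i g x)); split.
- exact: fun_continuousD.
- by move=> i x; apply: is_deriveD; exact: (@cd_is_derive k).
- by move=> i; have [_ _ pf] := cf; have [_ _ pg] := cg; exact: (ih _ _ (pf i) (pg i)).
Qed.

Lemma cdM k f g : Ck k f -> Ck k g -> Ck k (fun x => f x * g x).
Proof.
elim: k f g => [|k ih] f g cf cg; first exact: (fun_continuousM cf cg).
have cf0 := cd_continuous cf; have cg0 := cd_continuous cg.
apply: (@cdS_intro k _ (fun i x => f x * partial i g x + g x * partial i f x)); split.
- exact: fun_continuousM.
- by move=> i x; apply: (is_deriveM (cd_is_derive i x cf) (cd_is_derive i x cg)).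
- move=> i; have [_ _ pf] := cf; have [_ _ pg] := cg.
  by apply: cdD; [exact: (ih _ _ (cdW cf) (pg i))|exact: (ih _ _ (cdW cg) (pf i))].
Qed.

Lemma cd_scale k (c : R) f : Ck k f -> Ck k (fun x => c * f x).
Proof. by move=> cf; apply: cdM => //; exact: cd_cst. Qed.

Lemma cd_coord k j : Ck k (fun x => x 0 j).
Proof.
have cc : continuous (fun x : 'rV[R]_n => x 0 j) by exact: coord_continuous.
case: k => [//|k].
apply: (@cdS_intro k _ (fun i _ => (i == j)%:R)); split => [//|i x|i]; last exact: cd_cst.
have E : (fun h : R => h^-1 *: (((fun x : 'rV[R]_n => x 0 j) \o shift x) (h *: 'e_i) - x 0 j)) @ 0^' --> ((i == j)%:R : R).
  apply: cvg_near_cst; near=> h.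
  have h0 : h != 0 by near: h; exact: nbhs_dnbhs_neq.
  by rewrite /= !mxE eqxx /= addrK (eq_sym j) /GRing.scale/= mulrA mulVf// mul1r.
apply: DeriveDef; first by apply/cvg_ex; exists (i == j)%:R.
exact: cvg_lim E.
Unshelve. all: end_near. Qed.

Lemma cd_translate k f s : Ck k f -> Ck k (fun x => f (x - s)).
Proof.
elim: k f => [|k ih] f cf; first exact: (@continuous_translate R 'rV[R]_n f s cf).
have cf0 := cd_continuous cf.
apply: (@cdS_intro k _ (fun i x => partial i f (x - s))); split.
- exact: (@continuous_translate R 'rV[R]_n f s cf0).
- by move=> i x; apply: is_derive_translate; exact: (@cd_is_derive k).
- by move=> i; have [_ _ pf] := cf; exact: (ih _ (pf i)).
Qed.

Lemma cd_inv k f : (forall x, f x != 0) -> Ck k f -> Ck k (fun x => (f x)^-1).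
Proof.
move=> f0; elim: k => [|k ih] cf.
  exact: fun_continuousV.
have cf0 := cd_continuous cf; have cV := ih (cdW cf).
apply: (@cdS_intro k _ (fun i x => (-1) * ((f x)^-1 * ((f x)^-1 * partial i f x)))); split.
- exact: fun_continuousV.
- move=> i x; have [df dfE] := cd_is_derive i x cf.
  apply: DeriveDef; first exact: derivableV.
  rewrite deriveV// dfE.
  by rewrite -exprVn expr2 mulN1r /GRing.scale /= mulNr !mulrA.
- by move=> i; have [_ _ pf] := cf; exact: (cd_scale _ (cdM cV (cdM cV (pf i)))).
Qed.

(** Differentiation raises the index [m], so the induction on [k] treats all [m] at once. *)
Lemma cd_flat k m f : Ck k f -> Ck k (fun x => flat m (f x)).
Proof.
elim: k m f => [|k ih] m f cf.
  by apply: fun_continuous_comp => //; exact: continuous_flat.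
have cf0 := cd_continuous cf.
apply: (@cdS_intro k _ (fun i x => (flat m.+2 (f x) + (- m%:R) * flat m.+1 (f x)) * partial i f x)); split.
- by apply: fun_continuous_comp => //; exact: continuous_flat.
- move=> i x; rewrite mulNr.
  exact: (is_derive_comp_line (is_derive_flat m (f x)) (cd_is_derive i x cf)).
- move=> i; have [_ _ pf] := cf; apply: (cdM _ (pf i)); apply: cdD; first exact: (ih _ _ (cdW cf)).
  exact: (cd_scale _ (ih _ _ (cdW cf))).
Qed.

Lemma cd_sum k (I : Type) (r : seq I) (F : I -> 'rV[R]_n -> R) :
  (forall i, Ck k (F i)) -> Ck k (fun x => \sum_(i <- r) F i x).
Proof.
move=> cF; elim: r => [|i r ih].
  by under eq_fun do rewrite big_nil; exact: cd_cst.
by under eq_fun do rewrite big_cons; exact: cdD.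
Qed.

(** The cutoff is A / (A + B), built from the squared Euclidean distance [q], which is smooth as the
    maximum norm is not. [A] vanishes once q >= r^2, [B] as long as q <= r^2 / 2, and never both
    together. *)
Lemma smooth_cutoff (c : 'rV[R]_n) (r : R) : 0 < r ->
  exists2 eta : 'rV[R]_n -> R, smooth eta /\ (forall x, 0 <= eta x <= 1) &
    (forall x, r <= `|x - c| -> eta x = 0) /\
    exists2 r1, 0 < r1 & forall x, `|x - c| < r1 -> eta x = 1.
Proof.
move=> r0; pose q x := \sum_(i < n) (x 0 i - c 0 i) * (x 0 i - c 0 i).
have cq k : Ck k q.
  by apply: cd_sum => i; apply: cdM; apply: cdD; [exact: cd_coord|exact: cd_cst|exact: cd_coord|exact: cd_cst].
pose A x := flat 0 (r ^+ 2 + (-1) * q x).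
pose B x := flat 0 (q x + (- (r ^+ 2 / 2))).
have cA k : Ck k A by apply: cd_flat; apply: cdD; [exact: cd_cst|exact: cd_scale].
have cB k : Ck k B by apply: cd_flat; apply: cdD; [|exact: cd_cst].
have A0 x : 0 <= A x by exact: flat_ge0.
have B0 x : 0 <= B x by exact: flat_ge0.
have r20 : 0 < r ^+ 2 by rewrite exprn_gt0.
have AB x : 0 < A x + B x.
  have [h|h] := ltP (q x) (r ^+ 2).
    by rewrite ltr_pwDl// flat_gt0// mulN1r subr_gt0.
  rewrite ltr_wpDl// flat_gt0// subr_gt0; apply: lt_le_trans h.
  by rewrite ltr_pdivrMr// ltr_pMr// ltr1n.
have q0 x : 0 <= q x by apply: sumr_ge0 => i _; rewrite -expr2 sqr_ge0.
exists (fun x => A x * (A x + B x)^-1).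
  split=> [k|x].
    apply: cdM => //; apply: cd_inv => [x|]; first by rewrite gt_eqF.
    exact: cdD.
  rewrite divr_ge0 ?(ltW (AB x))//= ler_pdivrMr// mul1r lerDl//.
split.
  move=> x xr; rewrite /A flat_out ?mul0r// mulN1r subr_le0.
  have /forallPn [i] : ~~ [forall i, `|(x - c) 0 i| < r].
    by rewrite -rV_norm_lt// -leNgt.
  rewrite -leNgt !mxE => ri.
  rewrite /q (bigD1 i)//=.
  apply: (@le_trans _ _ ((x 0 i - c 0 i) * (x 0 i - c 0 i))); last first.
    by rewrite lerDl; apply: sumr_ge0 => j _; rewrite -expr2 sqr_ge0.
  by rewrite -expr2 -(real_normK (num_real (_ - _))) lerXn2r// nnegrE ltW.
have n0 : 0 < 2 * (n.+1%:R : R) by rewrite mulr_gt0// ltr0n.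
(* Within this radius [q] is at most n r^2 / (4 (n+1)^2), hence at most r^2 / 2. *)
exists (r / (2 * n.+1%:R)); first by rewrite divr_gt0.
move=> x xr; have Bx : B x = 0.
  rewrite /B flat_out// subr_le0.
  apply: (@le_trans _ _ (\sum_(i < n) (r / (2 * n.+1%:R)) ^+ 2)).
    apply: ler_sum => i _; rewrite -expr2 -(real_normK (num_real (_ - _))).
    rewrite lerXn2r// ?nnegrE ?divr_ge0 ?(ltW r0) ?(ltW n0)//.
    by have := rV_coord_le (x - c) i; rewrite !mxE => /le_trans -> //; exact: ltW.
  rewrite sumr_const card_ord -[leLHS]mulr_natl expr_div_n mulrA (mulrC n%:R) -mulrA.
  rewrite ler_wpM2l ?(ltW r20)//.
  rewrite ler_pdivrMr ?exprn_gt0// -(natr1 n).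
  have m0 : (0 : R) <= n%:R by [].
  move: m0; set m : R := n%:R => m0.
  have -> : 2^-1 * (2 * (m + 1)) ^+ 2 = m + (2 * m ^+ 2 + 3 * m + 2) by field.
  by rewrite lerDl !addr_ge0// ?mulr_ge0// exprn_ge0.
by have := AB x; rewrite Bx addr0 => ?; rewrite divff// gt_eqF.
Qed.

End smooth_functions.

(** * Interior cones of Lipschitz domains *)

Section interior_cone.
Context (R : realType) (n : nat).
Implicit Types (x y s : 'rV[R]_n).

Lemma enorm_le y : enorm y <= n.+1%:R * `|y|.
Proof.
have h0 : 0 <= n.+1%:R * `|y| by rewrite mulr_ge0.
rewrite /enorm -[leRHS]ger0_norm// -sqrtr_sqr ler_sqrt ?sqr_ge0//.
apply: (@le_trans _ _ (\sum_(i < n) `|y| ^+ 2)).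
  apply: ler_sum => i _; rewrite -(real_normK (num_real (y 0 i))).
  by rewrite lerXn2r ?nnegrE// rV_coord_le.
rewrite sumr_const card_ord -[leLHS]mulr_natl exprMn ler_wpM2r ?sqr_ge0//.
by rewrite -natrX ler_nat (leq_trans (leqnSn n))// expnS expn1 leq_pmulr.
Qed.

Lemma norm_mulmx_le (Q : 'M[R]_n) :
  exists2 C : R, 0 <= C & forall y j, `|(y *m Q) 0 j| <= C * `|y|.
Proof.
exists (\sum_k \sum_j `|Q k j|); first by do 2 apply: sumr_ge0 => ? _.
move=> y j; rewrite mxE mulr_suml (le_trans (ler_norm_sum _ _ _))//.
apply: ler_sum => k _; rewrite normrM mulrC ler_pM ?rV_coord_le//.
by rewrite (bigD1 j)//= lerDl sumr_ge0.
Qed.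

Lemma lipschitz_bound m (gamma : 'rV[R]_m -> R) : lipschitz gamma ->
  exists2 M : R, 0 <= M & forall a b, `|gamma a - gamma b| <= M * `|a - b|.
Proof.
move=> /pinfty_ex_gt0[M M0 h]; exists M => [|a b]; [exact: ltW|exact: (h (a, b))].
Qed.

(** In graph coordinates a step [t *: e] raises the height by [t]. An extra displacement of size
    kappa t lowers the height by at most C kappa t and raises the graph by at most M C kappa t,
    which together stay below [t] for small [kappa]. *)
Lemma interior_cone (Omega : set 'rV[R]_n) (x0 : 'rV[R]_n) :
  open Omega -> lipschitz_boundary Omega -> closure Omega x0 ->
  exists (e : 'rV[R]_n) (r t0 kappa : R), [/\ 0 < r, 0 < t0, 0 < kappa &
    forall x, Omega x -> `|x - x0| < r -> forall t, 0 < t < t0 ->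
    forall s, `|s - t *: e| < kappa * t -> Omega (x + s)].
Proof.
move=> oO lO cx0; have [Ox0|Ox0] := pselect (Omega x0).
  have /nbhs_ballP[d /= d0 dO] := open_nbhs_nbhs (conj oO Ox0).
  (* At an interior point the axis [e] can be 0: the cone is then a small ball around the origin. *)
  exists 0, (d / 2), 1, (d / 2); have d20 : 0 < d / 2 by rewrite divr_gt0.
  split => // x _ xx0 t /andP[t0 t1] s; rewrite scaler0 subr0 => st.
  apply: dO; rewrite -ball_normE /= distrC addrAC (splitr d).
  rewrite (le_lt_trans (ler_normD _ _))// ltrD// (lt_trans st)//.
  by rewrite gtr_pMr.
have bx0 : boundary Omega x0 by split => // /interior_subset.
have [Q [i [r [gamma [QQ r0 /lipschitz_bound[M M0 gl] Or]]]]] := lO x0 bx0.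
have [C C0 QC] := norm_mulmx_le Q.
pose e : 'rV[R]_n := delta_mx 0 i *m Q^T.
have eQ : e *m Q = delta_mx 0 i by rewrite -mulmxA (mulmx1C QQ) mulmx1.
(* Chosen so that (M + 1) C kappa < 1, also when [M] or [C] is 0. *)
pose kappa := ((M + 1) * (C + 1))^-1 / 2.
have MC0 : 0 < (M + 1) * (C + 1) by rewrite mulr_gt0// ltr_wpDl.
have k0 : 0 < kappa by rewrite divr_gt0// invr_gt0.
have n0 : 0 < n.+1%:R :> R by rewrite ltr0n.
pose r' := r / n.+1%:R.
have r'0 : 0 < r' by rewrite divr_gt0.
have enr y : `|y| < r' -> enorm y < r.
  by rewrite ltr_pdivlMr// mulrC; exact: le_lt_trans (enorm_le y).
(* Displacements then have norm below r' / 2, so [x + s] stays in the chart around [x0]; [r']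
   converts the Euclidean radius [r] to the maximum norm. *)
pose t0 := r' / 2 / (`|e| + kappa).
have ek0 : 0 < `|e| + kappa by rewrite ltr_wpDl.
exists e, (r' / 2), t0, kappa; split => //; try by rewrite !divr_gt0.
move=> x Ox xx0 t /andP[t_gt0 tt0] s st.
have sn : `|s| <= t * (`|e| + kappa).
  rewrite -(subrK (t *: e) s) (le_trans (ler_normD _ _))// normrZ gtr0_norm//.
  by rewrite mulrDr addrC lerD2l mulrC ltW// [ltRHS]mulrC.
have sr : `|s| < r' / 2.
  by apply: (le_lt_trans sn); move: tt0; rewrite ltr_pdivlMr.
have xr : `|x - x0| < r'.
  by apply: (lt_le_trans xx0); rewrite ler_pdivrMr// ler_pMr// ler1n.
have xsr : `|x + s - x0| < r'.
  by rewrite addrAC (splitr r') (le_lt_trans (ler_normD _ _))// ltrD.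
apply/(Or _ (enr _ xsr)); have /(Or _ (enr _ xr)) xg := Ox.
set s' := s - t *: e in st.
have sE : (x + s) *m Q = x *m Q + t *: delta_mx 0 i + s' *m Q.
  by rewrite -eQ scalemxAl -!mulmxDl -addrA /s' [t *: e + _]addrC subrK.
have s'j j : `|(s' *m Q) 0 j| <= C * (kappa * t).
  by apply: (le_trans (QC _ _)); rewrite ler_wpM2l// ltW.
have ckt0 : 0 <= C * (kappa * t) by apply: mulr_ge0 => //; rewrite ltW// mulr_gt0.
(* The main step moves only coordinate [i], which [col' i] deletes; the argument of [gamma] changes
   by the part [s'] alone. *)
have gs : gamma (col' i ((x + s) *m Q)) <= gamma (col' i (x *m Q)) + M * (C * (kappa * t)).
  rewrite -lerBlDl (le_trans (ler_norm _))// (le_trans (gl _ _))// ler_wpM2l//.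
  rewrite rV_norm_le//; apply/forallP => j; rewrite sE !mxE eq_sym (negPf (neq_lift i j)) /=.
  rewrite mulr0 addr0 addrAC subrr add0r.
  by have := s'j (lift i j); rewrite mxE.
have rVD (A B : 'rV[R]_n) : (A + B) 0 i = A 0 i + B 0 i by rewrite mxE.
have sEi : ((x + s) *m Q) 0 i = (x *m Q) 0 i + t + (s' *m Q) 0 i.
  by rewrite sE !rVD; congr (_ + _ + _); rewrite !mxE !eqxx mulr1.
apply: (le_lt_trans gs); rewrite sEi.
have := s'j i; rewrite ler_norml => /andP[h _].
have hk : M * (C * (kappa * t)) + C * (kappa * t) < t.
  have -> : M * (C * (kappa * t)) + C * (kappa * t) = (M + 1) * C * kappa * t by ring.
  rewrite -[ltRHS]mul1r ltr_pM2r// /kappa mulrA ltr_pdivrMr// mul1r ltr_pdivrMr//.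
  have : 0 <= (M + 1) * C by rewrite mulr_ge0// addr_ge0.
  have : 0 < M + 1 by rewrite ltr_wpDl.
  by rewrite mulrDr mulr1; set a := _ * _; set b := _ + _ => ? ?; lra.
by move: xg h hk; lra.
Qed.

End interior_cone.

(** * Local approximation in Sobolev spaces *)

Section test_functions.
Context (R : realType) (n : nat).
Implicit Types (f phi eta : 'rV[R]_n -> R) (x s : 'rV[R]_n) (Omega : set 'rV[R]_n).

Definition supp f : set 'rV[R]_n := closure [set x | f x != 0].

Lemma supp_out f x : ~ supp f x -> f x = 0.
Proof. by move=> fx; apply: contrapT => /eqP fx0; apply: fx; exact: subset_closure. Qed.

Lemma smooth_partial f i : smooth f -> smooth (partial i f).
Proof. by move=> sf k; have [_ _] := sf k.+1; apply. Qed.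

Lemma smooth_continuous f : smooth f -> continuous f.
Proof. by move=> sf; exact: (cd_continuous (sf 0%N)). Qed.

Lemma smooth_is_derive f i x : smooth f ->
  is_derive x (delta_mx 0 i) f (partial i f x).
Proof. by move=> sf; exact: (cd_is_derive i x (sf 1%N)). Qed.

Lemma partial_out f i x : ~ supp f x -> partial i f x = 0.
Proof.
move=> fx; have oS : open (~` supp f) by apply: closed_openC; exact: closed_closure.
have h : {near x, cst 0 =1 f}.
  apply: filterS (open_nbhs_nbhs (conj oS fx)) => y /= /supp_out ->//.
by rewrite /partial -(near_eq_derive _ h) derive_cst.
Qed.

Lemma compact_bound f (A : set 'rV[R]_n) : compact A -> continuous f ->
  exists2 B : R, 0 <= B & forall x, A x -> `|f x| <= B.
Proof.
move=> cA cf.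
have : compact (f @` A) by apply: continuous_compact => //; exact: continuous_subspaceT.
move=> /compact_bounded[B [_ hB]]; exists (`|B| + 1) => [|x Ax]; first exact: addr_ge0.
by apply: (hB (`|B| + 1)); [rewrite (le_lt_trans (ler_norm _))// ltrDl|exists x].
Qed.

Lemma compact_norm_bound (A : set 'rV[R]_n) : compact A ->
  exists M : R, forall x, A x -> `|x| < M.
Proof.
move=> /compact_bounded[B [_ hB]]; exists (`|B| + 2) => x Ax.
have : B < `|B| + 1 by rewrite (le_lt_trans (ler_norm _))// ltrDl.
by move=> /hB /(_ x Ax) /le_lt_trans; apply; rewrite ltrD2l ltr1n.
Qed.

Lemma test_function_bounds Omega phi : test_function Omega phi ->
  exists B M : R, [/\ forall x, `|phi x| <= B,
    forall i x, `|partial i phi x| <= B,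
    forall x, M <= `|x| -> phi x = 0 &
    forall i x, M <= `|x| -> partial i phi x = 0].
Proof.
move=> [sphi cS _].
have [M SM] := compact_norm_bound cS.
have [B0 B00 phiB] := compact_bound cS (smooth_continuous sphi).
have /choice[B1 B1P] : forall i, exists B : R, 0 <= B /\ forall x, supp phi x -> `|partial i phi x| <= B.
  move=> i; have [B ? ?] := compact_bound cS (smooth_continuous (smooth_partial i sphi)).
  by exists B.
have S0 : 0 <= \sum_i B1 i by apply: sumr_ge0 => i _; have [] := B1P i.
exists (B0 + \sum_i B1 i), M; split.
- move=> x; have [/phiB h|/supp_out ->] := pselect (supp phi x); last by rewrite normr0 addr_ge0.
  by rewrite (le_trans h)// lerDl.
- move=> i x; have [h|/partial_out ->] := pselect (supp phi x); last by rewrite normr0 addr_ge0.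
  have [_ /(_ _ h) h'] := B1P i; rewrite (le_trans h')//.
  rewrite (bigD1 i)//= addrCA lerDl addr_ge0// sumr_ge0// => j _.
  by have [] := B1P j.
- by move=> x Mx; apply: supp_out => /SM; rewrite ltNge Mx.
- by move=> i x Mx; apply: partial_out => /SM; rewrite ltNge Mx.
Qed.

(** The support of the product lies in both the support of [eta] and the translated support of
    [phi]: the second makes it bounded, and the two together place it in [Omega]. *)
Lemma test_function_mul_shift Omega phi eta s : test_function Omega phi -> smooth eta ->
  (forall x, supp eta x -> supp phi (x - s) -> Omega x) ->
  test_function Omega (fun x => eta x * phi (x - s)).
Proof.
move=> [sphi cS SO] seta h; set f := fun x => _.
have fs : supp f `<=` supp eta `&` [set x | supp phi (x - s)].
  move=> x fx; split.
    by apply: closureS fx => y /=; apply: contra_neq => e0; rewrite /f e0 mul0r.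
  have cl : closed [set x | supp phi (x - s)].
    apply: (@closed_comp _ _ (fun x => x - s)); last exact: closed_closure.
    by move=> y _; exact: (@continuous_sub_cst R 'rV[R]_n s y).
  rewrite (proj1 (closure_id _) cl); apply: closureS fx => y /=.
  by rewrite /f mulf_eq0 negb_or => /andP[_ ?]; exact: subset_closure.
split.
- by move=> k; apply: cdM => //; exact: cd_translate.
- apply: bounded_closed_compact; last exact: closed_closure.
  have [M SM] := compact_norm_bound cS; exists (M + `|s|); split; first exact: num_real.
  move=> k Mk x /fs [_ /SM xs].
  have : `|x - s + s| <= k by rewrite (le_trans (ler_normD _ _))// (le_trans _ (ltW Mk))// lerD2r ltW.
  by rewrite subrK.
- by move=> x /fs[]; exact: h.
Qed.

Lemma partial_mul_shift phi eta s i x : smooth phi -> smooth eta ->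
  partial i (fun x => eta x * phi (x - s)) x =
  eta x * partial i phi (x - s) + phi (x - s) * partial i eta x.
Proof.
move=> sphi seta.
have h1 := smooth_is_derive i x seta.
have h2 := is_derive_translate (smooth_is_derive i (x - s) sphi).
by have [_ <-] := is_deriveM h1 h2.
Qed.

End test_functions.

Section sobolev_products.
Context (R : realType) (n : nat) (Omega : set 'rV[R]_n).
Hypotheses (oO : open Omega) (bO : bounded_set Omega).
Implicit Types (u g phi eta : 'rV[R]_n -> R).
Local Notation leb := (@lebesgue_rV R n).

Let mO : lebset Omega. Proof. exact: lebset_open. Qed.

Lemma Lp_onE (p : R) u : Lp_on leb Omega p%:E u <->
  lebmeas (u \_ Omega) /\ (lebnorm p (u \_ Omega) < +oo)%E.
Proof.
rewrite /Lp_on /Lfun /= inE /=; split => [/andP[m f]|[m f]].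
  by split; [move: m; rewrite inE|move: f; rewrite inE].
by apply/andP; split; rewrite inE.
Qed.

Lemma Rintegral_restrict u phi :
  \int[leb]_(x in Omega) (u x * phi x) = \int[leb]_x ((u \_ Omega) x * phi x).
Proof.
rewrite Rintegral_mkcond; apply: eq_Rintegral => x _.
by rewrite !patchE; case: ifPn; rewrite ?mul0r.
Qed.

Lemma restrict_out u x : ~ Omega x -> (u \_ Omega) x = 0.
Proof. by move=> Ox; rewrite patchE memNset. Qed.

Lemma compact_closure : compact (closure Omega).
Proof.
have [M [_ hM]] := bO.
have h : closure Omega `<=` [set x | `|x| <= M + 1].
  have cl : closed [set x : 'rV[R]_n | `|x| <= M + 1].
    rewrite (_ : [set x | _] = Num.Def.normr @^-1` [set t : R | t <= M + 1])//.
    by apply: closed_comp; [move=> x _; exact: norm_continuous|exact: closed_le].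
  rewrite (proj1 (closure_id _) cl); apply: closureS => x Ox.
  by apply: (hM (M + 1)); rewrite ?ltrDl.
apply: bounded_closed_compact; last exact: closed_closure.
exists (M + 1); split; first exact: num_real.
by move=> k Mk x /h; rewrite /= => /le_trans; apply; exact: ltW.
Qed.

Lemma continuous_bound_on phi : continuous phi ->
  exists2 B : R, 0 <= B & forall x, Omega x -> `|phi x| <= B.
Proof.
move=> cphi; have [B B0 h] := compact_bound compact_closure cphi.
by exists B => // x Ox; apply: h; exact: subset_closure.
Qed.

Lemma lebint_restrict_mul u phi : lebint (u \_ Omega) -> continuous phi ->
  lebint (fun x => (u \_ Omega) x * phi x).
Proof.
move=> ui cphi; have [B B0 h] := continuous_bound_on cphi.
apply: (@lebint_le _ _ _ (fun x => B * `|(u \_ Omega) x|)).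
- by apply: lebmeasM; [exact: lebint_meas|exact: lebmeas_continuous].
- move=> x; rewrite normrM mulrC; have [Ox|Ox] := pselect (Omega x).
    by rewrite ler_wpM2r// h.
  by rewrite restrict_out// normr0 !mulr0.
by apply: lebintZ; exact: lebint_norm.
Qed.

Lemma restrictM eta u x :
  ((fun y => eta y * u y) \_ Omega) x = (u \_ Omega) x * eta x.
Proof. by rewrite !patchE; case: ifPn; rewrite ?mul0r// mulrC. Qed.

Lemma restrictD u g x :
  ((fun y => u y + g y) \_ Omega) x = (u \_ Omega) x + (g \_ Omega) x.
Proof. by rewrite !patchE; case: ifPn; rewrite ?addr0. Qed.

(* phi(. - s) need not be supported in [Omega], so that u cannot be tested      *)
(* against it; eta phi(. - s) is supported in [Omega].                          *)
Lemma weak_product_shift u g eta phi s i :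
  lebint (u \_ Omega) -> lebint (g \_ Omega) -> weak_partial Omega i u g ->
  smooth eta -> test_function Omega phi ->
  (forall x, supp eta x -> supp phi (x - s) -> Omega x) ->
  \int[leb]_x (((fun y => eta y * u y) \_ Omega) x * partial i phi (x - s)) =
  - \int[leb]_x (((fun y => eta y * g y + partial i eta y * u y) \_ Omega) x * phi (x - s)).
Proof.
move=> ui gi wu seta tphi h; have [sphi _ _] := tphi.
have ceta := smooth_continuous seta.
have cdeta := smooth_continuous (smooth_partial i seta).
have cphis := @continuous_translate R 'rV[R]_n phi s (smooth_continuous sphi).
have cdphis := @continuous_translate R 'rV[R]_n _ s (smooth_continuous (smooth_partial i sphi)).
(* By the product rule this test contains the wanted integral and the term with u phi(. - s) and the
   derivative of eta, which goes to the right-hand side. *)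
have := wu _ (test_function_mul_shift tphi seta h).
rewrite !Rintegral_restrict.
rewrite (@eq_Rintegral_leb _ _ _ (fun x => (u \_ Omega) x * (eta x * partial i phi (x - s)) +
    (u \_ Omega) x * (phi (x - s) * partial i eta x))); last first.
  by move=> x; rewrite partial_mul_shift// mulrDr.
rewrite Rintegral_lebD; first last.
- by apply: lebint_restrict_mul => //; exact: fun_continuousM.
- by apply: lebint_restrict_mul => //; exact: fun_continuousM.
move=> wE.
rewrite (@eq_Rintegral_leb _ _ _ (fun x => (u \_ Omega) x * (eta x * partial i phi (x - s)))); last first.
  by move=> x; rewrite restrictM mulrA.
rewrite [in RHS](@eq_Rintegral_leb _ _ _ (fun x => (g \_ Omega) x * (eta x * phi (x - s)) +
    (u \_ Omega) x * (phi (x - s) * partial i eta x))); last first.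
  by move=> x; rewrite restrictD !restrictM; ring.
rewrite Rintegral_lebD; first last.
- by apply: lebint_restrict_mul => //; exact: fun_continuousM.
- by apply: lebint_restrict_mul => //; exact: fun_continuousM.
by rewrite opprD -wE addrK.
Qed.

End sobolev_products.

(** * Tent-shaped kernels and their mass *)

Section tent_kernel.
Context (R : realType) (n : nat).
Implicit Types (z a : 'rV[R]_n).
Local Notation leb := (@lebesgue_rV R n).

(** A Lipschitz bump of radius [d]; its free centre [a] lets it sit inside a cone with vertex 0. *)
Definition tent (a : 'rV[R]_n) (d : R) (z : 'rV[R]_n) : R :=
  Num.max (1 - d^-1 * `|z - a|) 0.

Lemma tent01 a d z : 0 < d -> 0 <= tent a d z <= 1.
Proof.
move=> d0; rewrite /tent le_max lexx orbT /= ge_max ler01 andbT.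
by rewrite gerBl mulr_ge0// invr_ge0 ltW.
Qed.

Lemma tent_out a d z : 0 < d -> d <= `|z - a| -> tent a d z = 0.
Proof.
move=> d0 dz; apply/max_idPr; rewrite subr_le0.
by rewrite ler_pdivlMl// mulr1.
Qed.

Lemma tent_lip a d : 0 < d -> lip (tent a d).
Proof.
move=> d0; exists d^-1; first by rewrite invr_ge0 ltW.
move=> x y; apply: (@le_trans _ _ (d^-1 * `|(`|x - a| - `|y - a|)|)); last first.
  rewrite ler_wpM2l ?invr_ge0 ?(ltW d0)// (le_trans (ler_dist_dist _ _))//.
  by rewrite opprB addrA subrK.
have -> : d^-1 * `|(`|x - a| - `|y - a|)| = `|(1 - d^-1 * `|x - a|) - (1 - d^-1 * `|y - a|)|.
  rewrite -[d^-1 in LHS]ger0_norm ?invr_ge0 ?(ltW d0)// -normrM -[RHS]normrN; congr `|_|; ring.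
rewrite /tent; set s := 1 - _; set t := 1 - _.
have h1 := ler_norm (s - t); have h2 := ler_norm (t - s); rewrite (distrC t s) in h2.
by rewrite ler_norml maxEle (maxEle t 0); case: (leP s 0) => ?; case: (leP t 0) => ?; apply/andP; split; lra.
Qed.

Lemma rat_row_approx z (d : R) : 0 < d ->
  exists q : 'rV[rat]_n, `|z - map_mx ratr q| < d.
Proof.
move=> d0; have /choice[q qP] : forall i, exists q : rat, `|z 0 i - ratr q| < d.
  move=> i; have : z 0 i - d < z 0 i + d by rewrite ltrD2l gtrN.
  by move=> /rat_in_itvoo[q /itvP qP]; exists q; rewrite ltr_distlC !qP.
exists (\row_i q i); rewrite rV_norm_lt//; apply/forallP => i.
by rewrite !mxE.
Qed.

(* Were a ball null, its countably many translates to rational points would     *)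
(* make every set null. This avoids computing the volume of a ball.             *)
Lemma lebesgue_ball_gt0 (A : set 'rV[R]_n) a (d : R) : 0 < d ->
  (0 < lebesgue_outer A)%E ->
  (0 < lebesgue_outer [set z : 'rV[R]_n | `|z - a| < d]%R)%E.
Proof.
move=> d0 A0; rewrite lt0e outer_measure_ge0 andbT; apply/eqP => B0.
have Bz b : lebesgue_outer [set z : 'rV[R]_n | `|z - b| < d]%R = 0%E.
  rewrite -B0 -[RHS](lebesgue_outer_reflect _ (a + b)); congr lebesgue_outer.
  by apply/seteqP; split => z /=; rewrite addrAC [a + b]addrC addrK distrC.
pose F (k : nat) : set 'rV[R]_n := if choice.unpickle k is Some q then
  [set z : 'rV[R]_n | `|z - map_mx ratr (q : 'rV[rat]_n)| < d] else set0.
have AF : A `<=` \bigcup_k F k.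
  move=> z _; have [q qz] := rat_row_approx z d0.
  by exists (choice.pickle q) => //; rewrite /F choice.pickleK.
have : (lebesgue_outer A <= \sum_(k <oo) lebesgue_outer (F k))%E.
  exact: le_trans (le_outer_measure _ _ _ AF) (outer_measure_sigma_subadditive _ F).
rewrite eseries0; last first.
  by move=> k _ _; rewrite /F; case: choice.unpickle => [q|]; [exact: Bz|exact: outer_measure0].
by rewrite leNgt A0.
Qed.

(** The tent is at least 1/2 on the ball of radius d / 2, and that ball has positive measure by
    [lebesgue_ball_gt0]. *)
Lemma tent_integral_gt0 (A : set 'rV[R]_n) a (d : R) : 0 < d ->
  (0 < lebesgue_outer A)%E -> 0 < \int[leb]_z tent a d z.
Proof.
move=> d0 A0; have d20 : 0 < d / 2 by rewrite divr_gt0.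
pose B := [set z : 'rV[R]_n | `|z - a| < d / 2].
have oB : open B.
  rewrite (_ : B = (fun z => z - a) @^-1` [set z : 'rV[R]_n | `|z| < d / 2])//.
  by apply: open_comp; [move=> x _; exact: (@continuous_sub_cst R 'rV[R]_n a x)|exact: open_norm_lt].
have mB := lebset_open oB.
have B0 := lebesgue_ball_gt0 a d20 A0.
have mK : lebmeas (tent a d) by apply: lebmeas_lip; exact: tent_lip.
have iK : lebint (tent a d).
  apply: (@lebint_bounded_support _ _ _ 1 (d + `|a|)) => // z.
    by have /andP[? ?] := tent01 a z d0; rewrite ger0_norm.
  move=> h; apply: tent_out => //; rewrite -(lerD2r `|a|) (le_trans h)//.
  by rewrite -{1}(subrK a z) ler_normD.
have h : (0 < \int[leb]_z (tent a d z)%:E)%E.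
  apply: (@lt_le_trans _ _ ((2^-1)%:E * leb B)%E); first by rewrite mule_gt0.
  have mB1 : measurable_fun [set: lebesgue_space R n] (fun z => (\1_B z)%:E : \bar R).
    by apply/measurable_EFinP; exact: (lebmeas_indic mB).
  have B1 z : (0 <= (\1_B z)%:E :> \bar R)%E by rewrite lee_fin indicE ler0n.
  rewrite -[X in leb X]setIT -integral_indic// -(ge0_integral_lebZ _ mB1 B1) ?invr_ge0//.
  apply: ge0_le_integral.
  - exact: measurableT.
  - by move=> z _; rewrite mule_ge0// lee_fin indicE ler0n.
  - apply: measurable_funeM.
    by apply/measurable_EFinP; exact: (lebmeas_indic mB).
  - by apply/measurable_EFinP.
  move=> z _; rewrite -EFinM lee_fin indicE; case: (boolP (z \in B)); last first.
    by rewrite mulr0; have /andP[] := tent01 a z d0.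
  rewrite inE /B /= mulr1 => zB; rewrite /tent le_max; apply/orP; left.
  have : d^-1 * `|z - a| < 2^-1 by rewrite ltr_pdivrMl.
  by lra.
by rewrite -lte_fin /Rintegral fineK//; exact: lebint_fin_num.
Qed.

End tent_kernel.

(** * Approximation of a localised function by averages along a cone *)

Section local_approximation.
Context (R : realType) (n : nat) (Omega : set 'rV[R]_n) (p : R).
Hypotheses (oO : open Omega) (bO : bounded_set Omega) (p1 : 1 < p).
Implicit Types (u eta phi : 'rV[R]_n -> R) (g : 'I_n -> 'rV[R]_n -> R).
Local Notation leb := (@lebesgue_rV R n).

Let mO : lebset Omega. Proof. exact: lebset_open. Qed.

Lemma Lp_on_lebint u : Lp_on leb Omega p%:E u -> lebint (u \_ Omega).
Proof.
move=> /Lp_onE[mu up]; apply: (lebint_lebnorm p1 mO bO mu _ up) => x.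
exact: restrict_out.
Qed.

Lemma Lp_on_mul u eta : continuous eta -> Lp_on leb Omega p%:E u ->
  Lp_on leb Omega p%:E (fun x => eta x * u x).
Proof.
move=> ceta /Lp_onE[mu up]; have [B B0 h] := continuous_bound_on bO ceta.
have mBu : lebmeas (fun x => B * (u \_ Omega) x) by apply: lebmeasM => //; exact: lebmeas_cst.
have meu : lebmeas ((fun x => eta x * u x) \_ Omega).
  rewrite (_ : _ \_ _ = fun x => (u \_ Omega) x * eta x); last first.
    by apply/funext => x; rewrite restrictM.
  by apply: lebmeasM => //; exact: lebmeas_continuous.
apply/Lp_onE; split => //.
apply: (@le_lt_trans _ _ (lebnorm p (fun x => B * (u \_ Omega) x))).
  apply: le_lebnorm => // x; rewrite restrictM !normrM mulrC (ger0_norm B0).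
  have [Ox|Ox] := pselect (Omega x); first by rewrite ler_wpM2r// h.
  by rewrite restrict_out// normr0 !mulr0.
by rewrite lebnormZ// lte_mul_pinfty// ge0_fin_numE// lebnorm_ge0.
Qed.

Lemma Lp_on_add u v : Lp_on leb Omega p%:E u -> Lp_on leb Omega p%:E v ->
  Lp_on leb Omega p%:E (fun x => u x + v x).
Proof.
move=> /Lp_onE[mu up] /Lp_onE[mv vp]; apply/Lp_onE.
rewrite (_ : _ \_ _ = fun x => (u \_ Omega) x + (v \_ Omega) x); last first.
  by apply/funext => x; rewrite restrictD.
split; first exact: lebmeasD.
by apply: (le_lt_trans (lebnormD p1 mu mv)); exact: lte_add_pinfty.
Qed.

(** The product rule is the case s = 0 of [weak_product_shift], where the condition on the supports
    is just that [phi] is supported in [Omega]. *)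
Lemma weak_gradient_mul u g eta : Lp_on leb Omega p%:E u ->
  weak_gradient p Omega u g -> smooth eta ->
  weak_gradient p Omega (fun x => eta x * u x)
    (fun i x => eta x * g i x + partial i eta x * u x).
Proof.
move=> up gw seta i; have [gp wp] := gw i; split.
  apply: Lp_on_add; apply: Lp_on_mul => //; first exact: smooth_continuous.
  exact/smooth_continuous/smooth_partial.
move=> phi tphi; rewrite !(Rintegral_restrict Omega).
have E (f h : 'rV[R]_n -> R) : \int[leb]_x (f x * h (x - 0)) = \int[leb]_x (f x * h x).
  by apply: eq_Rintegral_leb => x; rewrite subr0.
rewrite -E -[in RHS]E.
apply: (weak_product_shift bO (Lp_on_lebint up) (Lp_on_lebint gp) wp seta tphi).
by have [_ _ sO] := tphi => x _; rewrite subr0; exact: sO.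
Qed.

Lemma restrict_mul_test f phi : (forall x, ~ Omega x -> phi x = 0) ->
  \int[leb]_(x in Omega) (f x * phi x) = \int[leb]_x (f x * phi x).
Proof.
move=> phi0; rewrite (Rintegral_restrict Omega); apply: eq_Rintegral_leb => x.
have [Ox|Ox] := pselect (Omega x); last by rewrite phi0// !mulr0.
by rewrite patchE mem_set.
Qed.

(** By [mollify_dual] both sides are averages over [s], with weight [K s], of the integration by
    parts against the translate of [phi]. It is therefore asked only for the shifts that the kernel
    sees. *)
Lemma mollify_weak_partial (K : 'rV[R]_n -> R) (rho : R) (V G : 'rV[R]_n -> R) i :
  lip K -> (forall z, 0 <= K z <= 1) -> (forall z, rho <= `|z| -> K z = 0) ->
  0 < \int[leb]_z K z -> lebint V -> lebint G ->
  (forall phi s, test_function Omega phi -> K s != 0 ->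
    \int[leb]_x (V x * partial i phi (x - s)) = - \int[leb]_x (G x * phi (x - s))) ->
  weak_partial Omega i (mollify K V) (mollify K G).
Proof.
move=> lK K01 Kout c0 iV iG H phi tphi; have [sphi _ sO] := tphi.
have [B [M [phiB dphiB phiM dphiM]]] := test_function_bounds tphi.
rewrite !restrict_mul_test; first last.
- by move=> x Ox; apply: partial_out => /sO.
- by move=> x Ox; apply: supp_out => /sO.
rewrite (mollify_dual lK K01 Kout c0 iV (smooth_continuous (smooth_partial i sphi)) (dphiB i) (dphiM i)).
rewrite (mollify_dual lK K01 Kout c0 iG (smooth_continuous sphi) phiB phiM).
have cphi := smooth_continuous sphi.
have iK := lebint_kernel lK K01 Kout.
have iGphi s : lebint (fun y => G y * phi (y - s)).
  apply: (@lebint_le _ _ _ (fun y => B * `|G y|)).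
  - by apply: lebmeasM; [exact: lebint_meas|exact: lebmeas_shift].
  - by move=> y; rewrite normrM mulrC ler_wpM2r.
  by apply: lebintZ; exact: lebint_norm.
(* Integrability in [s], by Fubini, allows the minus sign to be taken out of the outer integral. *)
have iF : lebint (fun s => K s * \int[leb]_y (G y * phi (y - s))).
  pose F (w : 'rV[R]_n * 'rV[R]_n) := K w.1 * (G w.2 * phi (w.2 - w.1)).
  rewrite (_ : (fun s => _) = fun s => \int[leb]_y F (s, y)); last first.
    by apply/funext => s; rewrite -Rintegral_lebZ.
  apply: (@lebint_section _ _ F (fun s => B * K s) (fun y => `|G y|)).
  - exact: (lebmeas2M (lebmeas2_fst (lebint_meas iK))
      (lebmeas2M (lebmeas2_snd (lebint_meas iG)) (lebmeas2_sub21 cphi))).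
  - exact: lebintZ.
  - exact: lebint_norm.
  move=> s y; have /andP[Ks0 _] := K01 s.
  rewrite /F /= !normrM ger0_norm//.
  have -> : B * K s * `|G y| = K s * (`|G y| * B) by ring.
  by apply: ler_wpM2l => //; apply: ler_wpM2l => //; exact: phiB.
rewrite -mulrN; congr (_ * _); rewrite -mulN1r -Rintegral_lebZ//.
apply: eq_Rintegral_leb => s; have [->|Ks] := eqVneq (K s) 0; first by rewrite !mul0r mulr0.
by rewrite H// mulrN mulN1r.
Qed.

Lemma exists_le_all (I : finType) (d : I -> R) : (forall i, 0 < d i) ->
  exists2 e : R, 0 < e & forall i, e <= d i.
Proof.
(* Starting the minimum at 1 also settles an empty index type. *)
move=> d0; exists (\big[Num.min/1]_i d i); first exact: lt_bigmin.
by move=> i; exact: bigmin_le_cond.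
Qed.

(** The kernel is a tent centred at [t *: e] of radius kappa t, that is, a slice of the cone. As t
    goes to 0 its reach t (|e| + kappa) does too, so [mollify_cvg] applies to eta u and to each
    component of its gradient with the same kernel. *)
Lemma local_approx u g eta (x0 e : 'rV[R]_n) (r t0 kappa M : R) :
  Lp_on leb Omega p%:E u -> weak_gradient p Omega u g -> smooth eta ->
  0 < r -> 0 < t0 -> 0 < kappa ->
  (forall x, Omega x -> `|x - x0| < r -> forall t, 0 < t < t0 ->
    forall s, `|s - t *: e| < kappa * t -> Omega (x + s)) ->
  (forall x, r / 2 <= `|x - x0| -> eta x = 0) ->
  0 <= M -> {ae leb, forall x, `|((fun y => eta y * u y) \_ Omega) x| <= M} ->
  (0 < lebesgue_outer Omega)%E ->
  forall eps : R, 0 < eps -> exists v h,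
  [/\ lip v /\ (forall x, `|v x| <= M), Lp_on leb Omega p%:E v, weak_gradient p Omega v h,
    (lebnorm p ((fun x => eta x * u x - v x)%R \_ Omega) <= eps%:E)%E &
    forall i, (lebnorm p ((fun x => eta x * g i x + partial i eta x * u x - h i x)%R \_ Omega) <= eps%:E)%E].
Proof.
move=> up gw seta r0 t00 k0 cone eta0 M0 VM O0 eps eps0.
set V := (fun y => eta y * u y) \_ Omega.
pose G i := (fun x => eta x * g i x + partial i eta x * u x) \_ Omega.
have Vp : Lp_on leb Omega p%:E (fun y => eta y * u y).
  by apply: Lp_on_mul => //; exact: smooth_continuous.
have Gw := weak_gradient_mul up gw seta.
have iV : lebint V := Lp_on_lebint Vp.
have iG i : lebint (G i) by apply: Lp_on_lebint; have [] := Gw i.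
have Vout x : ~ Omega x -> V x = 0 by exact: restrict_out.
have Gout i x : ~ Omega x -> G i x = 0 by exact: restrict_out.
have Vn : (lebnorm p V < +oo)%E by have /Lp_onE[] := Vp.
have Gn i : (lebnorm p (G i) < +oo)%E by have [/Lp_onE[]] := Gw i.
have [dV dV0 HV] := mollify_cvg p1 oO bO (lebint_meas iV) Vout Vn eps0.
have /choice[dG dGP] : forall i, exists d : R, 0 < d /\
    forall (K : 'rV[R]_n -> R) (rho : R), lip K -> (forall z, 0 <= K z <= 1) ->
      (forall z, rho <= `|z| -> K z = 0) -> 0 < \int[leb]_z K z -> 0 <= rho <= d ->
      (lebnorm p ((fun x => G i x - mollify K (G i) x)%R \_ Omega) <= eps%:E)%E.
  move=> i; have [d d0 H] := mollify_cvg p1 oO bO (lebint_meas (iG i)) (Gout i) (Gn i) eps0.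
  by exists d.
have [dm dm0 dmG] := exists_le_all (fun i => (dGP i).1).
have ek0 : 0 < `|e| + kappa by rewrite ltr_wpDl.
(* The reach of the kernel must stay below r / 2, for the cone to apply, and within the thresholds
   for the function and all its derivatives. *)
have [t [t_gt0 tt0 tr tdV tdm]] : exists t : R, [/\ 0 < t, t < t0,
    t * (`|e| + kappa) < r / 2, t * (`|e| + kappa) <= dV & t * (`|e| + kappa) <= dm].
  pose m := Num.min (r / 2) (Num.min dV dm).
  have m0 : 0 < m by rewrite !lt_min dV0 dm0 divr_gt0.
  pose t := Num.min (t0 / 2) (m / (`|e| + kappa) / 2).
  have t0' : 0 < t by rewrite lt_min !divr_gt0.
  have tm : t * (`|e| + kappa) <= m / 2.
    rewrite -ler_pdivlMr// (le_trans (_ : _ <= m / (`|e| + kappa) / 2)) ?ge_min ?lexx ?orbT//.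
    by rewrite mulrAC.
  have mm : m / 2 < m by rewrite ltr_pdivrMr// ltr_pMr// ltr1n.
  have tm' := le_lt_trans tm mm; move: tm'; rewrite !lt_min => /and3P[h1 h2 h3].
  exists t; split => //; try exact: ltW.
  rewrite (@le_lt_trans _ _ (t0 / 2))// ?ge_min ?lexx//.
  by rewrite ltr_pdivrMr// ltr_pMr// ltr1n.
have kt0 : 0 < kappa * t by rewrite mulr_gt0.
pose K := tent (t *: e) (kappa * t).
pose rho := t * (`|e| + kappa).
have lK : lip K by exact: tent_lip.
have K01 z : 0 <= K z <= 1 by exact: tent01.
have Kne z : K z != 0 -> `|z - t *: e| < kappa * t.
  by move=> Kz; rewrite ltNge; apply: contra Kz => h; rewrite /K tent_out.
have Kz z : K z != 0 -> `|z| < rho.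
  move=> /Kne h; rewrite -(subrK (t *: e) z) (le_lt_trans (ler_normD _ _))//.
  by rewrite normrZ (gtr0_norm t_gt0) /rho mulrDr addrC ltrD2l [ltRHS]mulrC.
have Kout z : rho <= `|z| -> K z = 0.
  by move=> h; apply: contraTeq h => /Kz; rewrite -ltNge.
have c0 : 0 < \int[leb]_z K z by exact: (tent_integral_gt0 _ kt0 O0).
have rho0 : 0 <= rho by rewrite mulr_ge0// ltW.
have moll_Lp f : lebint f -> (lebnorm p f < +oo)%E -> Lp_on leb Omega p%:E (mollify K f).
  move=> fi fp; have mf := lebmeas_mollify lK K01 c0 fi.
  have mf' : lebmeas (mollify K f \_ Omega) by exact: lebmeas_restrict.
  apply/Lp_onE; split => //; apply: le_lt_trans fp.
  apply: le_trans (lebnorm_mollify lK K01 Kout c0 p1 fi).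
  by apply: le_lebnorm => // x; rewrite patchE; case: ifPn => // _; rewrite normr0.
exists (mollify K V), (fun i => mollify K (G i)); split.
- split; first exact: (mollify_lip lK K01 c0 iV).
  by move=> x; exact: (mollify_le lK K01 Kout c0 x M0 iV VM).
- exact: moll_Lp.
- move=> i; split; first exact: moll_Lp.
  apply: (mollify_weak_partial lK K01 Kout c0 iV (iG i)) => phi s tphi Ks.
  have [gp wp] := gw i; have [_ _ sO] := tphi.
  apply: (weak_product_shift bO (Lp_on_lebint up) (Lp_on_lebint gp) wp seta tphi).
  move=> x ex /sO Oxs.
  (* The closed ball of radius r / 2 contains the points where [eta] is nonzero, hence also the
     closure of that set. *)
  have xx0 : `|x - x0| <= r / 2.
    have cl : closed [set x : 'rV[R]_n | `|x - x0| <= r / 2].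
      rewrite (_ : [set x | _] = (fun x : 'rV[R]_n => `|x - x0|) @^-1` [set t : R | t <= r / 2])//.
      apply: closed_comp; last exact: closed_le.
      by move=> y _; apply: (@continuous_translate R 'rV[R]_n (fun z => `|z|)) => z; exact: norm_continuous.
    suff : [set y : 'rV[R]_n | `|y - x0| <= r / 2] x by [].
    rewrite (proj1 (closure_id _) cl).
    apply: closureS ex => y /=; rewrite leNgt; apply: contra => h.
    by apply/eqP; apply: eta0; exact: ltW.
  (* The cone starts at [x - s], a point of the support of [phi], and leads back to [x]. Both |x -
     x0| and |s| are bounded by r / 2, which puts the starting point within [r] of [x0]. *)
  have := cone (x - s) Oxs _ t _ s (Kne _ Ks); rewrite subrK; apply; last by rewrite t_gt0.
  rewrite addrAC (splitr r) (le_lt_trans (ler_normB _ _))//.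
  by rewrite ler_ltD// (lt_trans (Kz _ Ks)).
- rewrite (_ : _ \_ _ = (fun x => V x - mollify K V x) \_ Omega).
    by apply: (HV K rho lK K01 Kout c0); rewrite rho0 tdV.
  by apply/funext => x; rewrite !patchE; case: ifPn => // xO; rewrite /V patchE xO.
- move=> i; rewrite (_ : _ \_ _ = (fun x => G i x - mollify K (G i) x) \_ Omega).
    by apply: ((dGP i).2 K rho lK K01 Kout c0); rewrite rho0 (le_trans tdm).
  by apply/funext => x; rewrite !patchE; case: ifPn => // xO; rewrite /G patchE xO.
Qed.

End local_approximation.

(** * Bounds on traces *)

Section essential_bounds.
Context d (T : measurableType d) (R : realType) (mu : {measure set T -> \bar R}).
Implicit Types f : T -> R.

Lemma Lfun_iff (p : \bar R) f : f \in Lfun mu p <->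
  measurable_fun setT f /\ (Lnorm mu p (EFin \o f) < +oo)%E.
Proof.
split => [h|[m fp]]; last by apply/andP; split; exact: mem_set.
by split; [exact: (set_mem (sub_Lfun_mfun h))|exact: (set_mem (sub_Lfun_finLfun h))].
Qed.

Lemma ae_bounded_Lfuny f (M : R) : measurable_fun setT f ->
  {ae mu, forall x, `|f x| <= M} -> f \in Lfun mu +oo%E.
Proof.
move=> mf fM; apply/Lfun_iff; split => //; rewrite unlock; case: ifPn => // _.
apply: (@le_lt_trans _ _ M%:E); last exact: ltry.
apply/ess_supP; apply: ae_mono fM => x fx.
by rewrite /= lee_fin.
Qed.

Lemma Lfuny_ae_bounded f : f \in Lfun mu +oo%E ->
  exists2 M : R, 0 <= M & {ae mu, forall x, `|f x| <= M}.
Proof.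
move=> /Lfun_iff[mf]; rewrite unlock; case: ifPn => [mu0|mu0 _].
  move=> fy; pose s := ess_sup mu (abse \o (EFin \o f)).
  have : (s <= (Num.max (fine s) 0)%:E)%E.
    move: fy; rewrite -/s; case: s => [s|//|] _; last exact: leNye.
    by rewrite lee_fin le_max lexx.
  move=> /ess_supP h; exists (Num.max (fine s) 0); first by rewrite le_max lexx orbT.
  by apply: ae_mono h => x /=; rewrite lee_fin.
(* If the whole space is null, the norm is 0 by convention and any bound holds almost everywhere. *)
exists 0 => //; exists setT; split => //.
by apply/eqP; rewrite eq_le measure_ge0 andbT leNgt.
Qed.

(** Markov's inequality: where |f| exceeds M + 1, |h| is at least 1, so that set has measure at most
    the integral of |h|^p, which is arbitrarily small. *)
Lemma ae_bounded_approx f (p M : R) : 1 < p -> 0 <= M -> measurable_fun setT f ->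
  (forall e : R, 0 < e -> exists h, [/\ measurable_fun setT h,
    (Lnorm mu p%:E (EFin \o h) <= e%:E)%E & {ae mu, forall x, `|f x| <= `|h x| + M}]) ->
  {ae mu, forall x, `|f x| <= M + 1}.
Proof.
move=> p1 M0 mf H; have p0 : 0 < p by exact: lt_trans p1.
pose A := [set x | M + 1 < `|f x|].
have mA : measurable A.
  rewrite -[A]setTI; apply: (measurable_fun_ltr (f := cst (M + 1)) (g := fun x => `|f x|)) => //.
  exact: measurableT_comp.
exists A; split => //; last by move=> x /= /negP; rewrite -ltNge.
apply/eqP; rewrite eq_le measure_ge0 andbT; apply/lee_addgt0Pr => e e0; rewrite add0e.
(* A norm at most e^(1/p) makes the integral of |h|^p at most [e]. *)
have e'0 : 0 < e `^ p^-1 by rewrite powR_gt0.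
have [h [mh /(Lnorm_leP _ p1 _ (ltW e'0)) hp fh]] := H _ e'0.
rewrite -powRrM mulVf ?gt_eqF// powRr1 ?(ltW e0)// in hp.
apply: le_trans hp; rewrite -[X in mu X]setIT -integral_indic//.
apply: ae_ge0_le_integral.
- exact: measurableT.
- by move=> x _; rewrite lee_fin indicE ler0n.
- by apply/measurable_EFinP; exact: measurable_indic.
- by move=> x _; rewrite lee_fin powR_ge0.
- exact: measurable_normpowR.
apply: ae_mono fh => x fx _; rewrite lee_fin indicE; case: (boolP (x \in A)); last by rewrite powR_ge0.
rewrite inE /A /= => Mf; have h1 : 1 <= `|h x| by lra.
by rewrite (le_trans h1)// le1r_powR// ltW.
Qed.

End essential_bounds.

Section trace_bound.
Context (R : realType) (n : nat) (Omega : set 'rV[R]_n) (p : R)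
  (T : ('rV[R]_n -> R) -> 'rV[R]_n -> R).
Hypotheses (oO : open Omega) (bO : bounded_set Omega) (p1 : 1 < p)
  (TO : trace_operator p Omega T).
Implicit Types (u v w eta : 'rV[R]_n -> R) (g h : 'I_n -> 'rV[R]_n -> R).
Local Notation leb := (@lebesgue_rV R n).
Local Notation haus := (@hausdorff R n n.-1).
Local Notation bd := (boundary Omega).

(** The difference is written with the factor -1 to have the shape that [trace_linear] expects. *)
Lemma weak_gradient_sub u v g h : Lp_on leb Omega p%:E u -> Lp_on leb Omega p%:E v ->
  weak_gradient p Omega u g -> weak_gradient p Omega v h ->
  Lp_on leb Omega p%:E (fun x => -1 * v x + u x) /\
  weak_gradient p Omega (fun x => -1 * v x + u x) (fun i x => -1 * h i x + g i x).
Proof.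
move=> up vp gu hv.
have Lp_neg w : Lp_on leb Omega p%:E w -> Lp_on leb Omega p%:E (fun x => -1 * w x).
  move=> wp; have c1 : continuous (fun _ : 'rV[R]_n => -1 : R) by exact: cst_continuous.
  exact: (Lp_on_mul bO p1 c1 wp).
split; first by apply: (Lp_on_add p1) => //; exact: Lp_neg.
move=> i; have [gp wg] := gu i; have [hp wh] := hv i; split.
  by apply: (Lp_on_add p1) => //; exact: Lp_neg.
move=> phi tphi; have [sphi _ sO] := tphi.
have cphi := smooth_continuous sphi.
have cdphi := smooth_continuous (smooth_partial i sphi).
have lin (a b psi : 'rV[R]_n -> R) : Lp_on leb Omega p%:E a -> Lp_on leb Omega p%:E b ->
    continuous psi ->
    \int[leb]_(x in Omega) ((-1 * b x + a x) * psi x) =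
    \int[leb]_(x in Omega) (a x * psi x) - \int[leb]_(x in Omega) (b x * psi x).
  move=> ap bp cpsi; rewrite !(Rintegral_restrict Omega) -Rintegral_lebB.
  - by apply: eq_Rintegral_leb => x; rewrite !patchE; case: ifPn => _ /=; [ring|rewrite !mul0r subr0].
  - exact: (lebint_restrict_mul bO (Lp_on_lebint oO bO p1 ap) cpsi).
  - exact: (lebint_restrict_mul bO (Lp_on_lebint oO bO p1 bp) cpsi).
by rewrite !lin// (wg _ tphi) (wh _ tphi) opprD.
Qed.

Lemma sobolev_norm_le u g (eps : R) : (lebnorm p (u \_ Omega) <= eps%:E)%E ->
  (forall i, (lebnorm p (g i \_ Omega) <= eps%:E)%E) ->
  (sobolev_norm p Omega u g <= (n.+1%:R * eps)%:E)%E.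
Proof.
move=> ue ge.
apply: (@le_trans _ _ (eps%:E + \sum_(i < n) eps%:E)%E).
  by apply: leeD => //; apply: lee_sum => i _; exact: ge.
by rewrite sumEFin -EFinD lee_fin sumr_const card_ord -[n.+1%:R]natr1 mulrDl mul1r mulr_natl addrC.
Qed.

Definition trace_bounded_by u :=
  exists M : R, {ae haus, forall x, bd x -> `|T u x| <= M}.

(** The trace of a continuous [w] is [w], so |T v| <= |T (v - w)| + M almost everywhere on the
    boundary, and T (v - w) is small in L^p since [T] is bounded. [ae_bounded_approx] concludes. *)
Lemma trace_bounded_limit v g (M : R) : 0 <= M ->
  Lp_on leb Omega p%:E v -> weak_gradient p Omega v g ->
  (forall eps : R, 0 < eps -> exists w h,
    [/\ continuous w /\ (forall x, `|w x| <= M), Lp_on leb Omega p%:E w,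
        weak_gradient p Omega w h,
        (lebnorm p ((fun x => v x - w x)%R \_ Omega) <= eps%:E)%E &
        forall i, (lebnorm p ((fun x => g i x - h i x)%R \_ Omega) <= eps%:E)%E]) ->
  trace_bounded_by v.
Proof.
move=> M0 vp gv H; exists (M + 1).
have sv : sobolev p Omega v by split => //; exists g.
have [C HC] := trace_bounded TO.
have meas u : sobolev p Omega u -> measurable_fun [set: Defs.hausdorff_space R n n.-1] (T u \_ bd).
  by move=> su; have /Lfun_iff[] := trace_Lp TO su.
suff : {ae haus, forall x, `|(T v \_ bd) x| <= M + 1}.
  by apply: ae_mono => x + bx; rewrite patchE mem_set.
apply: (ae_bounded_approx p1 M0 (meas _ sv)) => e e0.
(* The Sobolev norm has n + 1 terms, each to be at most e / (|C| (n+1) + 1). The sign of [C] is not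
   known, hence |C|, and the 1 avoids a zero divisor. *)
have C0 : 0 < `|C| * n.+1%:R + 1 by rewrite ltr_wpDl// mulr_ge0.
have [w [h [[cw wM] wp hw vw gh]]] := H _ (divr_gt0 e0 C0).
pose f y := -1 * w y + v y; pose df i y := -1 * h i y + g i y.
have [dp dg] : Lp_on leb Omega p%:E f /\ weak_gradient p Omega f df.
  exact: weak_gradient_sub.
have sw : sobolev p Omega w by split => //; exists h.
have sd : sobolev p Omega f by split => //; exists df.
exists (T f \_ bd); split.
- exact: meas.
- apply: (le_trans (HC _ _ dp dg)).
  apply: (@le_trans _ _ (`|C|%:E * (n.+1%:R * (e / (`|C| * n.+1%:R + 1)))%:E)%E); last first.
    rewrite -EFinM lee_fin; set D := _ + 1 in C0 *.
    have -> : `|C| * (n.+1%:R * (e / D)) = e * (`|C| * n.+1%:R / D) by ring.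
    by rewrite ler_piMr ?(ltW e0)// ler_pdivrMr// mul1r lerDl.
  have sn : (sobolev_norm p Omega f df <= (n.+1%:R * (e / (`|C| * n.+1%:R + 1)))%:E)%E.
    apply: sobolev_norm_le.
      by rewrite (_ : f = (fun x => v x - w x))//; apply/funext => x; rewrite /f mulN1r addrC.
    by move=> i; rewrite (_ : df i = (fun x => g i x - h i x))//; apply/funext => x; rewrite /df mulN1r addrC.
  have sn0 : (0 <= sobolev_norm p Omega f df)%E.
    by rewrite adde_ge0 ?Lnorm_ge0// sume_ge0// => i _; exact: Lnorm_ge0.
  apply: (@le_trans _ _ (`|C|%:E * sobolev_norm p Omega f df)%E).
    by apply: lee_wpmul2r => //; rewrite lee_fin ler_norm.
  by apply: lee_wpmul2l => //; rewrite lee_fin.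
have Tw := trace_continuous TO sw (continuous_subspaceT cw).
have Td := trace_linear TO (-1) sw sv.
apply: ae_mono (ae_conj Tw Td) => x [Twx Tdx].
rewrite !patchE; case: ifPn => xb; last by rewrite normr0 add0r.
rewrite inE in xb; rewrite /f Tdx// Twx//.
have := ler_normD (-1 * w x + T v x) (w x).
have -> : -1 * w x + T v x + w x = T v x by ring.
by move=> /le_trans; apply; rewrite lerD2l.
Qed.

End trace_bound.

Lemma In_map (A : eqType) (B : Type) (f : A -> B) (s : seq A) (y : B) :
  List.In y (map f s) <-> exists2 x, x \in s & f x = y.
Proof.
elim: s => [|a s ih] /=; first by split => // -[].
rewrite ih; split => [[<-|[x xs <-]]|[x]].
- by exists a; rewrite ?mem_head.
- by exists x; rewrite // in_cons xs orbT.
by rewrite in_cons => /predU1P[-> <-|xs <-]; [left|right; exists x].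
Qed.

(** * From local to global bounds by finitely many cutoffs *)

Section trace_bounded.
Context (R : realType) (n : nat) (Omega : set 'rV[R]_n) (p : R)
  (T : ('rV[R]_n -> R) -> 'rV[R]_n -> R).
Hypotheses (oO : open Omega) (bO : bounded_set Omega) (p1 : 1 < p)
  (TO : trace_operator p Omega T) (O0 : (0 < lebesgue_outer Omega)%E).
Implicit Types (u v eta : 'rV[R]_n -> R) (g : 'I_n -> 'rV[R]_n -> R).
Local Notation leb := (@lebesgue_rV R n).
Local Notation haus := (@hausdorff R n n.-1).
Local Notation bd := (boundary Omega).

(** The cone is available up to radius [r] and the cutoff dies at r / 2: the gap leaves room for the
    shifts by the kernel. *)
Definition local_cutoff eta := [/\ smooth eta, forall x, 0 <= eta x <= 1 &
  exists (x0 e : 'rV[R]_n) (r t0 kappa : R), [/\ 0 < r, 0 < t0, 0 < kappa,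
    forall x, Omega x -> `|x - x0| < r -> forall t, 0 < t < t0 ->
      forall s, `|s - t *: e| < kappa * t -> Omega (x + s) &
    forall x, r / 2 <= `|x - x0| -> eta x = 0]].

Definition bounded_sobolev u := [/\ Lp_on leb Omega p%:E u,
  exists g, weak_gradient p Omega u g &
  exists2 M : R, 0 <= M & {ae leb, forall x, `|(u \_ Omega) x| <= M}].

Lemma bounded_sobolev_mul u eta : bounded_sobolev u -> smooth eta ->
  (forall x, 0 <= eta x <= 1) -> bounded_sobolev (fun x => eta x * u x).
Proof.
move=> [up [g gu] [M M0 uM]] seta eta01; split.
- exact: (Lp_on_mul bO p1 (smooth_continuous seta) up).
- by eexists; exact: (weak_gradient_mul oO bO p1 up gu seta).
exists M => //; apply: ae_mono uM => x; apply: le_trans.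
rewrite restrictM normrM ler_piMr//.
by have /andP[? ?] := eta01 x; rewrite ger0_norm.
Qed.

Lemma bounded_sobolev_sobolev u : bounded_sobolev u -> sobolev p Omega u.
Proof. by move=> [up gu _]. Qed.

Lemma trace_bounded_local u eta : bounded_sobolev u -> local_cutoff eta ->
  trace_bounded_by Omega T (fun x => eta x * u x).
Proof.
move=> bu [seta eta01 [x0 [e [r [t0 [kappa [r0 t00 k0 cone eta0]]]]]]].
have [_ _ [M M0 VM]] := bounded_sobolev_mul bu seta eta01.
have [up [g gu] _] := bu.
have vp := Lp_on_mul bO p1 (smooth_continuous seta) up.
have gv := weak_gradient_mul oO bO p1 up gu seta.
apply: (trace_bounded_limit oO bO p1 TO M0 vp gv) => eps eps0.
have [v [h [[lv vM] vLp hv e1 e2]]] :=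
  local_approx oO bO p1 up gu seta r0 t00 k0 cone eta0 M0 VM O0 eps0.
by exists v, h; split => //; split => //; exact: lip_continuous.
Qed.

Lemma trace_bounded_add u v : sobolev p Omega u -> sobolev p Omega v ->
  trace_bounded_by Omega T u -> trace_bounded_by Omega T v ->
  trace_bounded_by Omega T (fun x => u x + v x).
Proof.
move=> su sv [M uM] [M' vM]; exists (M + M').
have Tuv := trace_linear TO 1 su sv.
apply: ae_mono (ae_conj Tuv (ae_conj uM vM)) => x [Tx [ux vx]] bx.
rewrite (_ : (fun x => _) = (fun y => 1 * u y + v y)); last first.
  by apply/funext => y; rewrite mul1r.
by rewrite Tx// mul1r (le_trans (ler_normD _ _))// lerD// ?ux ?vx.
Qed.

(** Such a function is continuous on the closure, where it coincides with 0, so its trace is 0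
    almost everywhere on the boundary. *)
Lemma trace_bounded_zero u : sobolev p Omega u ->
  (forall x, closure Omega x -> u x = 0) -> trace_bounded_by Omega T u.
Proof.
move=> su u0; exists 0.
have cu : {within closure Omega, continuous u}.
  apply: (@subspace_eq_continuous _ _ _ (cst 0)); last exact/continuous_subspaceT/cst_continuous.
  by move=> x; rewrite inE => cx; exact/esym/(u0 x cx).
apply: ae_mono (trace_continuous TO su cu) => x Tx bx.
by rewrite Tx// u0 ?normr0//; case: bx.
Qed.

(* Induction on the cutoffs by u = eta u + (1 - eta) u: the second summand      *)
(* vanishes wherever eta = 1, and in the end on the whole closure.              *)
Lemma trace_bounded_cover (L : seq ('rV[R]_n -> R)) u : bounded_sobolev u ->
  (forall eta, List.In eta L -> local_cutoff eta) ->
  (forall x, closure Omega x -> u x = 0 \/ exists2 eta, List.In eta L & eta x = 1) ->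
  trace_bounded_by Omega T u.
Proof.
elim: L u => [|eta L ih] u bu hL hu.
  apply: trace_bounded_zero; first exact: bounded_sobolev_sobolev.
  by move=> x /hu[|[]].
have leta : local_cutoff eta by apply: hL; left.
have [seta eta01 _] := leta.
have sceta : smooth (fun x => 1 + -1 * eta x).
  by move=> k; apply: cdD; [exact: cd_cst|apply: cd_scale; exact: seta].
have ceta01 x : 0 <= 1 + -1 * eta x <= 1.
  by have /andP[? ?] := eta01 x; apply/andP; split; lra.
have b1 := bounded_sobolev_mul bu seta eta01.
have b2 := bounded_sobolev_mul bu sceta ceta01.
rewrite (_ : u = fun x => eta x * u x + (1 + -1 * eta x) * u x); last first.
  by apply/funext => x; ring.
apply: trace_bounded_add.
- exact: bounded_sobolev_sobolev b1.
- exact: bounded_sobolev_sobolev b2.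
- exact: trace_bounded_local.
apply: ih => // [eta' h|x cx]; first by apply: hL; right.
have [->|[eta' [<-|h] e1]] := hu x cx.
- by left; rewrite mulr0.
- by left; rewrite e1 mulr1 subrr mul0r.
- by right; exists eta'.
Qed.

(** Each point of the compact closure has a cone and a cutoff equal to 1 on a small ball around it;
    finitely many of these balls cover. *)
Lemma local_cutoffs_cover : lipschitz_boundary Omega ->
  exists L : seq ('rV[R]_n -> R),
    (forall eta, List.In eta L -> local_cutoff eta) /\
    forall x, closure Omega x -> exists2 eta, List.In eta L & eta x = 1.
Proof.
move=> lO.
have /choice[E EP] : forall x0 : 'rV[R]_n, exists eta_r : ('rV[R]_n -> R) * R,
    closure Omega x0 -> [/\ local_cutoff eta_r.1, 0 < eta_r.2 &
      forall x, `|x - x0| < eta_r.2 -> eta_r.1 x = 1].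
  (* The choice function must be total; off the closure it takes a dummy value. *)
  move=> x0; have [cx0|ncx0] := pselect (closure Omega x0); last by exists (cst 0, 0) => /ncx0.
  have [e [r [t0 [kappa [r0 t00 k0 cone]]]]] := interior_cone oO lO cx0.
  have [eta [seta eta01] [eta0 [r1 r10 eta1]]] := smooth_cutoff x0 (divr_gt0 r0 (ltr0n R 2)).
  exists (eta, r1) => _; split => //; split => //.
  by exists x0, e, r, t0, kappa.
have := compact_closure bO; rewrite compact_cover => /(_ 'rV[R]_n (closure Omega)
  (fun x0 => [set x | `|x - x0| < (E x0).2])).
case=> [x0 _|x cx|D DO cD].
- rewrite (_ : [set x | _] = (fun x : 'rV[R]_n => x - x0) @^-1` [set y : 'rV[R]_n | `|y| < (E x0).2])//.
  by apply: open_comp; [move=> x _; exact: (@continuous_sub_cst R 'rV[R]_n x0 x)|exact: open_norm_lt].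
- by exists x => //=; have [_ + _] := EP x cx; rewrite subrr normr0.
have clD x0 : x0 \in D -> closure Omega x0 by move=> /DO; rewrite inE.
exists [seq (E x0).1 | x0 <- enum_fset D]; split.
  by move=> eta /In_map[x0 x0D <-]; have [+ _ _] := EP x0 (clD _ x0D).
move=> x /cD[x0 /= Dx0 xx0]; exists (E x0).1; first by apply/In_map; exists x0.
by have [_ _] := EP x0 (clD _ Dx0); apply.
Qed.

End trace_bounded.

(** * The case of a domain of measure zero *)

Section null_domain.
Context (R : realType) (n : nat) (Omega : set 'rV[R]_n) (p : R)
  (T : ('rV[R]_n -> R) -> 'rV[R]_n -> R).
Hypotheses (oO : open Omega) (bO : bounded_set Omega) (p1 : 1 < p) (TO : trace_operator p Omega T)
  (O0 : lebesgue_outer Omega = 0%E).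
Local Notation leb := (@lebesgue_rV R n).

Lemma lebnorm_null f (e : R) : lebmeas (f \_ Omega) -> 0 <= e ->
  (lebnorm p (f \_ Omega) <= e%:E)%E.
Proof.
move=> mf e0; apply/(lebnorm_leP p1 _ e0).
pose F x := (`|(f \_ Omega) x| `^ p)%:E.
have mF : measurable_fun [set: lebesgue_space R n] F.
  by apply/measurable_EFinP; apply: lebmeas_powR; exact: lebmeas_norm.
have FE : F = F \_ Omega.
  apply/funext => x; rewrite /F !patchE; case: ifPn => // _.
  by rewrite normr0 powR0// gt_eqF// (lt_trans _ p1).
rewrite -/F FE -integral_mkcond (@null_set_integral _ _ _ leb _ _ (lebset_open oO) _ O0) ?lee_fin ?powR_ge0//.
have := @measurable_funS _ _ _ _ setT (Omega : set (lebesgue_space R n)) F measurableT (@subsetT _ _) mF.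
exact.
Qed.

Lemma Lp_on_zero : Lp_on leb Omega p%:E (cst 0).
Proof.
apply/Lp_onE; rewrite (_ : cst 0 \_ Omega = cst 0); last by apply/funext => x; rewrite patchE if_same.
split; first exact: measurable_cst.
by rewrite (lebnorm0 _ p1) ltry.
Qed.

Lemma weak_gradient_zero : weak_gradient p Omega (cst 0) (fun=> cst 0).
Proof.
move=> i; split=> [|phi _]; first exact: Lp_on_zero.
by rewrite /Rintegral; under eq_integral do rewrite mul0r; under [in RHS]eq_integral do rewrite mul0r; rewrite integral0 oppr0.
Qed.

(* The volume of a nonempty open set is not computed; for a null [Omega] every   *)
(* Sobolev norm is 0 and [u] is approximated by 0.                              *)
Lemma trace_bounded_null u : sobolev p Omega u -> trace_bounded_by Omega T u.
Proof.
move=> [up [g gu]].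
apply: (trace_bounded_limit oO bO p1 TO (lexx 0) up gu) => eps eps0.
have Lp_sub0 v : Lp_on leb Omega p%:E v -> lebmeas ((fun x => v x - 0) \_ Omega).
  rewrite (_ : (fun x => v x - 0) = v); last by apply/funext => x; rewrite subr0.
  by move=> /Lp_onE[].
exists (cst 0), (fun=> cst 0); split.
- by split=> [|x]; [exact: cst_continuous|rewrite normr0].
- exact: Lp_on_zero.
- exact: weak_gradient_zero.
- by apply: lebnorm_null (ltW eps0); exact: Lp_sub0.
by move=> i; apply: lebnorm_null (ltW eps0); apply: Lp_sub0; have [] := gu i.
Qed.

End null_domain.

Theorem proposition2p4 (R : realType) (N : nat) (Omega : set 'rV[R]_N) (p : R)
    (T : ('rV[R]_N -> R) -> ('rV[R]_N -> R)) (u : 'rV[R]_N -> R) :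
  (1 < N)%N ->
  bounded_domain Omega ->
  lipschitz_boundary Omega ->
  1 < p ->
  trace_operator p Omega T ->
  sobolev p Omega u ->
  Lp_on (@lebesgue_rV R N) Omega +oo%E u ->
  Lp_on (@hausdorff R N N.-1) (boundary Omega) +oo%E (T u).
Proof.
move=> _ [oO _ _ bO] lO p1 TO su uoo.
have [M uM] : trace_bounded_by Omega T u.
  have [nO|nO] := eqVneq (lebesgue_outer Omega) 0%E.
    exact: (trace_bounded_null oO bO p1 TO nO su).
  have Opos : (0 < lebesgue_outer Omega)%E by rewrite lt0e nO outer_measure_ge0.
  have [L [hL hcover]] := local_cutoffs_cover oO bO lO.
  apply: (trace_bounded_cover oO bO p1 TO Opos _ hL) => [|x /hcover]; last by right.
  have [up gu] := su; split => //.
  exact: Lfuny_ae_bounded uoo.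
(* Measurability of the trace comes from its being in L^p of the boundary. *)
have [mTu _] := (Lfun_iff _ _ _).1 (trace_Lp TO su).
(* The sign of [M] is not known, and the extension by 0 off the boundary calls for a nonnegative
   bound, hence |M|. *)
apply: (@ae_bounded_Lfuny _ _ _ _ _ `|M| mTu); apply: ae_mono uM => x ux.
rewrite patchE; case: ifPn => [/set_mem/ux /le_trans -> //|_]; first exact: ler_norm.
by rewrite normr0.
Qed.
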